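(* Let $\gamma,\kappa>0$, let $A:\mathbb{R}^n\to\mathbb{R}$ be a $\gamma$-function and $V:\mathbb{R}^n\to\mathbb{R}$ a $\kappa$-function, and let $q>0$ be such that $q+V(x)+A(\xi)\ge 1$ for all $x,\xi\in\mathbb{R}^n$. Assume that there exist constants $C_1,C_2>0$ such that $$A(\xi)\ge C_1|\xi|^{2\gamma}\ \text{ for } |\xi|\ge C_2,\qquad V(x)\ge C_1|x|^{2\kappa}\ \text{ for } |x|\ge C_2 .$$ Then $$\int_{\mathbb{R}^n}\int_{\mathbb{R}^n}(q+A(\xi)+V(x))^{-\mu}\,dx\,d\xi<\infty$$ provided $\mu>\frac{n(\kappa+\gamma)}{2\kappa\gamma}$. Consequently, if additionally $A,V$ are $C^\infty$ functions on $\mathbb{R}^n$ and the function $(x,\xi)\mapsto A(\xi)+V(x)$ belongs to $\Sigma^1_{A,V}$, then, for $1\le r<\infty$, $$T^{-\nu}=(q+A(D)+V(x))^{-\nu}\in S_r(L^2(\mathbb{R}^n))$$ provided $\nu>\frac{n(\kappa+\gamma)}{2r\kappa\gamma}$.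
   Context: $\tau$-functions: a continuous function $\Gamma:\mathbb{R}^n\to\mathbb{R}$ is a $\tau$-function ($\tau>0$) if there is $q_0>0$ such that (a) $\Gamma(x)+\frac{q_0}{4}>0$ for all $x\in\mathbb{R}^n$; and (b) there are $c>0$, $R>0$ with $c\,\big|(\frac{q_0}{2}+\Gamma(x))^{\frac1{2\tau}}-(\frac{q_0}{2}+\Gamma(y))^{\frac1{2\tau}}\big|\le |x-y|$ for all $|x|,|y|\ge R$. For $m\in\mathbb{R}$, $\Sigma^m_{A,V}$ is the set of $a\in C^\infty(\mathbb{R}^n\times\mathbb{R}^n)$ such that for all multi-indices $\alpha,\beta$ there is $C_{\alpha\beta}$ with $|\partial_x^\beta\partial_\xi^\alpha a(x,\xi)|\le C_{\alpha\beta}(q+V(x)+A(\xi))^{m-\frac{|\beta|}{2\kappa}-\frac{|\alpha|}{2\gamma}}$ for all $x,\xi\in\mathbb{R}^n$. $A(D)$ is the Fourier multiplier $A(D)u(x)=(2\pi)^{-n}\int e^{ix\cdot\xi}A(\xi)\hat u(\xi)\,d\xi$, $V(x)$ is multiplication by $V$, and $T=q+A(D)+V(x)$ is understood as the positive self-adjoint operator on $L^2(\mathbb{R}^n)$ determined by its action on Schwartz functions; $T^{-\nu}$ are its powers. $S_r(L^2(\mathbb{R}^n))$ is the Schatten-von Neumann class of order $r$. *)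

(* Defs.v *)
From HB Require Import structures.
From mathcomp Require Import all_boot all_order all_algebra.
From mathcomp Require Import complex.
From mathcomp Require Import all_classical all_reals all_analysis.

Set Implicit Arguments.
Unset Strict Implicit.
Unset Printing Implicit Defensive.

Import Order.TTheory GRing.Theory Num.Theory.
Import numFieldNormedType.Exports.

Local Open Scope classical_set_scope.
Local Open Scope ring_scope.

(** Row vectors carry the sigma-algebra generated by the coordinates, that is,
    the Borel sigma-algebra of R^n. *)

Definition measure_rV_display : measure_display.
Proof. exact default_measure_display. Qed.

Section measurable_rV.
Context {R : realType} (n : nat).

Let coord (i : 'I_n) (x : 'rV[R]_n) : R := x ord0 i.

Let rV_set0 : g_sigma_preimage coord set0.
Proof. exact: sigma_algebra0. Qed.

Let rV_setC A : g_sigma_preimage coord A -> g_sigma_preimage coord (~` A).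
Proof. exact: sigma_algebraC. Qed.

Let rV_bigcup (F : _^nat) : (forall i, g_sigma_preimage coord (F i)) ->
  g_sigma_preimage coord (\bigcup_i (F i)).
Proof. exact: sigma_algebra_bigcup. Qed.

HB.instance Definition _ := @isMeasurable.Build measure_rV_display
  'rV[R]_n (g_sigma_preimage coord) rV_set0 rV_setC rV_bigcup.

Lemma measurable_coord (i : 'I_n) :
  measurable_fun [set: 'rV[R]_n] (fun x : 'rV[R]_n => x ord0 i).
Proof.
move=> _ Y mY; rewrite setTI; apply: sub_sigma_algebra => /=.
rewrite -bigcup_seq/=; exists i => /=; first by rewrite mem_index_enum.
by exists Y => //; rewrite setTI.
Qed.

Lemma measurable_rVP d (T : measurableType d) (f : T -> 'rV[R]_n) :
  (forall i, measurable_fun setT (fun t => f t ord0 i)) ->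
  measurable_fun setT f.
Proof.
move=> mf; have H : g_sigma_preimage (fun i => coord i \o f) `<=` measurable.
  apply: smallest_sub; first exact: sigma_algebra_measurable.
  rewrite -bigcup_seq; apply: bigcup_sub => i _ A [B mB <-].
  exact: (mf i).
by rewrite g_sigma_preimage_comp in H => _ A mA; apply: H; exists A.
Qed.

End measurable_rV.

Section lebesgue_rV.
Context {R : realType}.

Definition rV_cons n (p : measurableTypeR R * 'rV[R]_n) : 'rV[R]_n.+1 :=
  \row_i (if unlift ord0 i is Some j then p.2 ord0 j else p.1).

Definition rV_uncons n (x : 'rV[R]_n.+1) : measurableTypeR R * 'rV[R]_n :=
  (x ord0 ord0, \row_j x ord0 (lift ord0 j)).

Lemma rV_consK n : cancel (@rV_cons n) (@rV_uncons n).
Proof.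
move=> [t v]; rewrite /rV_cons /rV_uncons/= mxE unlift_none; congr (_, _).
by apply/rowP => j; rewrite !mxE liftK.
Qed.

Lemma measurable_rV_cons n : measurable_fun setT (@rV_cons n).
Proof.
apply: measurable_rVP => i; case: (unliftP ord0 i) => [j|] ->.
  rewrite (_ : (fun _ => _) = (fun v : 'rV[R]_n => v ord0 j) \o snd).
    exact: measurableT_comp (@measurable_coord R n j) measurable_snd.
  by apply/funext => p; rewrite mxE liftK.
rewrite (_ : (fun _ => _) = fst); first exact: measurable_fst.
by apply/funext => p; rewrite mxE unlift_none.
Qed.

Lemma measurable_rV_uncons n : measurable_fun setT (@rV_uncons n).
Proof.
apply/measurable_fun_pairP; split => /=; first exact: measurable_coord.
apply: measurable_rVP => i.
rewrite (_ : (fun _ => _) = (fun v : 'rV[R]_n.+1 => v ord0 (lift ord0 i))).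
  exact: measurable_coord.
by apply/funext => v /=; rewrite mxE.
Qed.

Section lebesgue_rV_cons.
Variables (n : nat) (mu : {sigma_finite_measure set 'rV[R]_n -> \bar R}).

Definition lebesgue_rV_cons : set 'rV[R]_n.+1 -> \bar R :=
  pushforward (@lebesgue_measure R \x mu)%E (@rV_cons n).

Let lebesgue_rV_cons0 : lebesgue_rV_cons set0 = 0%E.
Proof. by rewrite /lebesgue_rV_cons /pushforward preimage_set0 measure0. Qed.

Let lebesgue_rV_cons_ge0 A : (0 <= lebesgue_rV_cons A)%E.
Proof. by rewrite /lebesgue_rV_cons /pushforward measure_ge0. Qed.

Let lebesgue_rV_cons_sigma_additive : semi_sigma_additive lebesgue_rV_cons.
Proof.
move=> F mF tF mUF; rewrite /lebesgue_rV_cons /pushforward preimage_bigcup.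
have mpre B : measurable B -> measurable (@rV_cons n @^-1` B).
  by move=> mB; rewrite -[X in measurable X]setTI; exact: measurable_rV_cons.
apply: measure_semi_sigma_additive; first by move=> k; exact: mpre.
- apply/trivIsetP => /= i j _ _ ij; rewrite -preimage_setI.
  by move/trivIsetP : tF => /(_ _ _ _ _ ij) ->//; rewrite preimage_set0.
- by rewrite -preimage_bigcup; exact: mpre.
Qed.

HB.instance Definition _ := isMeasure.Build _ _ _ lebesgue_rV_cons
  lebesgue_rV_cons0 lebesgue_rV_cons_ge0 lebesgue_rV_cons_sigma_additive.

Let lebesgue_rV_cons_sigma_finite : sigma_finite setT lebesgue_rV_cons.
Proof.
have /sigma_finiteP[F [TF ndF Foo]] := sigma_finiteT (@lebesgue_measure R).
have /sigma_finiteP[G [TG ndG Goo]] := sigma_finiteT mu.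
exists (fun k => @rV_uncons n @^-1` (F k `*` G k)).
  apply/esym; rewrite -subTset => x _.
  have [i _ Fi] : (\bigcup_i F i) (rV_uncons x).1 by rewrite -TF.
  have [j _ Gj] : (\bigcup_i G i) (rV_uncons x).2 by rewrite -TG.
  exists (maxn i j) => //; split.
  - by move: Fi; exact/subsetPset/ndF/leq_maxl.
  - by move: Gj; exact/subsetPset/ndG/leq_maxr.
move=> k; have [mFk Fk] := Foo k; have [mGk Gk] := Goo k.
split.
  rewrite -[X in measurable X]setTI; apply: measurable_rV_uncons => //.
  exact: measurableX.
rewrite /lebesgue_rV_cons /pushforward -comp_preimage.
rewrite (_ : _ \o _ = id); last by apply/funext => p /=; rewrite rV_consK.
by rewrite preimage_id product_measure1E// lte_mul_pinfty// ge0_fin_numE.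
Qed.

HB.instance Definition _ := Measure_isSigmaFinite.Build _ _ _
  lebesgue_rV_cons lebesgue_rV_cons_sigma_finite.

End lebesgue_rV_cons.

Fixpoint lebesgue_rV n : {sigma_finite_measure set 'rV[R]_n -> \bar R} :=
  if n is n'.+1 then lebesgue_rV_cons (lebesgue_rV n') else \d_(0 : 'rV[R]_0).

End lebesgue_rV.

Section symbols.
Context {R : realType}.

(** The norm of the library on ['rV[R]_n] is the sup norm. *)
Definition dotp n (x y : 'rV[R]_n) : R := \sum_(i < n) x ord0 i * y ord0 i.
Definition enorm n (x : 'rV[R]_n) : R := Num.sqrt (dotp x x).

Definition tau_function n (tau : R) (Gamma : 'rV[R]_n -> R) : Prop :=
  continuous Gamma /\
  exists q0 : R, [/\ 0 < q0, (forall x, 0 < Gamma x + q0 / 4) &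
    exists c r : R, [/\ 0 < c, 0 < r &
      forall x y, r <= enorm x -> r <= enorm y ->
        c * `|(q0 / 2 + Gamma x) `^ (1 / (2 * tau))
              - (q0 / 2 + Gamma y) `^ (1 / (2 * tau))| <= enorm (x - y)]].

(** [C^oo], for [W] of finite dimension: all iterated directional derivatives
    exist and are continuous. *)
Definition smooth (W : normedModType R) (f : W -> R) : Prop :=
  forall vs : seq W, let g := foldr (fun v h => 'D_v h) f vs in
    continuous g /\ forall x v, derivable g x v.

Definition csmooth (W : normedModType R) (f : W -> R[i]) : Prop :=
  smooth (fun x => complex.Re (f x)) /\ smooth (fun x => complex.Im (f x)).

Definition multi_deriv (W : normedModType R) n (e : 'I_n -> W)
    (alpha : 'I_n -> nat) (f : W -> R) : W -> R :=
  foldr (fun i g => iter (alpha i) (fun h => 'D_(e i) h) g) f (enum 'I_n).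

Definition cmulti_deriv (W : normedModType R) n (e : 'I_n -> W)
    (alpha : 'I_n -> nat) (f : W -> R[i]) (x : W) : R[i] :=
  Complex (multi_deriv e alpha (fun y => complex.Re (f y)) x)
          (multi_deriv e alpha (fun y => complex.Im (f y)) x).

Definition mdeg n (alpha : 'I_n -> nat) : nat := (\sum_(i < n) alpha i)%N.

Definition basis_rV n (i : 'I_n) : 'rV[R]_n := delta_mx ord0 i.

(** In phase space a point is [p = (x, xi)]. *)
Definition dir_x n (i : 'I_n) : 'rV[R]_n * 'rV[R]_n := (basis_rV i, 0).
Definition dir_xi n (i : 'I_n) : 'rV[R]_n * 'rV[R]_n := (0, basis_rV i).

Definition Sigma_class n (gamma kappa q : R) (A V : 'rV[R]_n -> R) (m : R)
    (a : 'rV[R]_n * 'rV[R]_n -> R[i]) : Prop :=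
  csmooth a /\
  forall alpha beta : 'I_n -> nat, exists C : R, forall x xi : 'rV[R]_n,
    ComplexField.Normc.normc
      (cmulti_deriv (@dir_x n) beta (cmulti_deriv (@dir_xi n) alpha a) (x, xi))
    <= C * (q + V x + A xi) `^
           (m - (mdeg beta)%:R / (2 * kappa) - (mdeg alpha)%:R / (2 * gamma)).

End symbols.

(** Elements of L^2(R^n; C) are represented by functions, up to equality almost
    everywhere. *)
Section L2.
Context {R : realType} {n : nat}.
Notation fct := ('rV[R]_n -> R[i]).
Implicit Types u v w f g : fct.

Definition cintegral f : R[i] :=
  Complex (\int[lebesgue_rV n]_x complex.Re (f x))
          (\int[lebesgue_rV n]_x complex.Im (f x)).

Definition sqr_integral f : \bar R :=
  (\int[lebesgue_rV n]_x (ComplexField.Normc.normc (f x) ^+ 2)%:E)%E.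

Definition L2 f : Prop :=
  [/\ measurable_fun setT (fun x => complex.Re (f x)),
      measurable_fun setT (fun x => complex.Im (f x)) &
      (sqr_integral f < +oo)%E].

Definition aeq f g : Prop := {ae lebesgue_rV n, forall x, f x = g x}.

Definition inner f g : R[i] := cintegral (fun x => f x * (g x)^*).

Definition l2norm f : R := Num.sqrt (fine (sqr_integral f)).

Definition l2cvg (u : nat -> fct) f : Prop :=
  [/\ (forall k, L2 (u k)), L2 f &
      (fun k => l2norm (fun x => u k x - f x)) @ \oo --> (0 : R)].

(** Possibly unbounded operators on L^2 are given by their graphs:
    [T u v] means that [u] is in the domain of [T] and [v = T u]. *)
Definition op := fct -> fct -> Prop.
Implicit Types S T K M P : op.

Definition linear_op T : Prop :=
  [/\ (forall u v, T u v -> L2 u /\ L2 v),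
      (forall u v u' v', T u v -> L2 u' -> L2 v' -> aeq u u' -> aeq v v' ->
         T u' v'),
      (forall u v v', T u v -> T u v' -> aeq v v'),
      T (fun=> 0) (fun=> 0) &
      (forall (a : R[i]) u v u' v', T u v -> T u' v' ->
         T (fun x => a * u x + u' x) (fun x => a * v x + v' x))].

Definition everywhere_defined T : Prop := forall u, L2 u -> exists v, T u v.

Definition densely_defined T : Prop :=
  forall u, L2 u -> exists uk vk : nat -> fct,
    (forall k, T (uk k) (vk k)) /\ l2cvg uk u.

Definition adjoint T : op := fun u v =>
  [/\ L2 u, L2 v & forall f g, T f g -> inner g u = inner f v].

Definition self_adjoint T : Prop :=
  densely_defined T /\ forall u v, T u v <-> adjoint T u v.

Definition positive_op T : Prop := forall u v, T u v -> 0 <= inner v u.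

Definition comp_op S T : op := fun u v => exists2 w, T u w & S w v.

Definition compact_op K : Prop :=
  [/\ linear_op K, everywhere_defined K &
    forall uk vk : nat -> fct, (forall k, K (uk k) (vk k)) ->
      (exists B : R, forall k, l2norm (uk k) <= B) ->
      exists s : nat -> nat, (forall k, (s k < s k.+1)%N) /\
        exists2 v, L2 v & l2cvg (fun k => vk (s k)) v].

(** [M = |K|], the positive square root of [K^* K] *)
Definition abs_op K M : Prop :=
  [/\ self_adjoint M, positive_op M &
    forall u v, comp_op M M u v <-> comp_op (adjoint K) K u v].

Definition orthonormal_basis (psi : nat -> fct) : Prop :=
  [/\ (forall k, L2 (psi k)),
      (forall j k, inner (psi j) (psi k) = (j == k)%:R) &
      (forall u, L2 u -> (forall k, inner u (psi k) = 0) -> aeq u (fun=> 0))].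

(** The [s k] are the singular values of [K], repeated according to
    multiplicity; L^2(R^n) is separable and infinite-dimensional for [n > 0]. *)
Definition schatten (r : R) K : Prop :=
  compact_op K /\
  exists M (psi : nat -> fct) (s : nat -> R),
    [/\ abs_op K M, orthonormal_basis psi,
        (forall k, M (psi k) (fun x => (s k)%:C%C * psi k x)) &
        cvgn (series (fun k => s k `^ r))].

Definition orthogonal_projection P : Prop :=
  [/\ linear_op P, everywhere_defined P, self_adjoint P &
      forall u v, P u v -> P v v].

(** [mu] is the measure [B |-> <E(B) u, u>]. *)
Definition spectral_form (E : set R -> op) u
    (mu : {measure set R -> \bar R}) : Prop :=
  forall B, measurable B -> forall v, E B u v ->
    mu B = (complex.Re (inner v u))%:E.

Definition spectral_measure (E : set R -> op) : Prop :=
  [/\ (forall B, measurable B -> orthogonal_projection (E B)),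
      (forall u, L2 u -> E setT u u),
      (forall B C, measurable B -> measurable C ->
         forall u v, E (B `&` C) u v <-> comp_op (E B) (E C) u v) &
      (forall u, L2 u -> exists mu : {measure set R -> \bar R},
         spectral_form E u mu)].

(** [S = \int f dE]: the domain is given by [\int f^2 d<E u, u> < +oo], where
    [<S u, u> = \int f d<E u, u>]; by polarization this determines [S]. *)
Definition spectral_integral (E : set R -> op) (f : R -> R) S : Prop :=
  linear_op S /\
  forall u (mu : {measure set R -> \bar R}), L2 u -> spectral_form E u mu ->
    ((exists v, S u v) <-> (\int[mu]_t ((f t) ^+ 2)%:E < +oo)%E) /\
    forall v, S u v -> inner v u = (\int[mu]_t f t)%:C%C.

(** [P = T^s] by the spectral theorem, for [T] positive self-adjoint.  For
    [s < 0] this is meant for injective [T]: the library sets [0 `^ s = 0]. *)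
Definition is_power T (s : R) P : Prop :=
  exists E : set R -> op, [/\ spectral_measure E,
    spectral_integral E id T & spectral_integral E (fun t => t `^ s) P].

Definition schwartz u : Prop :=
  csmooth u /\
  forall alpha beta : 'I_n -> nat, exists C : R, forall x : 'rV[R]_n,
    `|\prod_(i < n) x ord0 i ^+ alpha i|
      * ComplexField.Normc.normc (cmulti_deriv (@basis_rV R n) beta u x) <= C.

Definition cis (t : R) : R[i] := Complex (cos t) (sin t).

Definition fourier u : fct := fun xi =>
  cintegral (fun x => cis (- dotp x xi) * u x).

Definition fourier_multiplier (A : 'rV[R]_n -> R) u : fct := fun x =>
  ((2 * pi) ^- n)%:C%C *
  cintegral (fun xi => cis (dotp x xi) * (A xi)%:C%C * fourier u xi).

Definition T_schwartz (q : R) (A V : 'rV[R]_n -> R) u : fct := fun x =>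
  q%:C%C * u x + fourier_multiplier A u x + (V x)%:C%C * u x.

(** [T] is positive self-adjoint and is the closure of [q + A(D) + V(x)] acting
    on Schwartz functions. *)
Definition is_T (q : R) (A V : 'rV[R]_n -> R) T : Prop :=
  [/\ self_adjoint T, positive_op T &
    forall u v, T u v <-> [/\ L2 u, L2 v & exists uk : nat -> fct,
      [/\ (forall k, schwartz (uk k)), l2cvg uk u &
          l2cvg (fun k => T_schwartz q A V (uk k)) v]]].

End L2.

(* Main.v *)
From HB Require Import structures.
Require Import Defs.
From mathcomp Require Import all_boot all_order all_algebra.
From mathcomp Require Import complex.
From mathcomp Require Import all_classical all_reals all_analysis.
From mathcomp Require Import measurable_realfun ring lra.

Set Implicit Arguments.
Unset Strict Implicit.
Unset Printing Implicit Defensive.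

Import Order.TTheory GRing.Theory Num.Theory.
Import numFieldNormedType.Exports.

Local Open Scope classical_set_scope.
Local Open Scope ring_scope.

(** For a Schwartz function [u], Plancherel's identity gives
      [<T u, u> = q |u|^2 + (2 pi)^-n \int A |u^|^2 + \int V |u|^2].
    By the growth of [A] and [V], a unit vector of energy at most [lam >= 1]
    therefore has most of its mass in a cube [B] of side [~ lam^(1 / (2 kappa))],
    and most of the mass of its Fourier transform in a cube [B'] of side
    [~ lam^(1 / (2 gamma))].  Bessel's inequality for the functions
    [x |-> 1_B(x) e^(i x.xi)], integrated over [xi] in [B'], bounds the size of an
    orthonormal family of such vectors by
      [C |B| |B'| ~ lam^p0], [p0 = n (kappa + gamma) / (2 kappa gamma)].
    Hence the spectral measure of [T] is concentrated on eigenvalues [t_k] of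
    finite multiplicity with [k <= C t_k^p0], and [T^-nu] is compact with
    singular values [t_k^-nu], which are [r]-summable as soon as [nu r > p0].

    The integral of the symbol [W = q + A + V] converges because
    [W >= c (1 + |x|)^(2 kappa)] and [W >= c (1 + |xi|)^(2 gamma)]: the weighted
    geometric mean of the two bounds makes [W^-mu] a product of integrable
    functions of [x] and of [xi]. *)

(** The energy is known only on Schwartz functions, while the truncations of such functions to a
    cube are not Schwartz, so Plancherel is used in two strengths. The transform is regularised by a
    product of weights e^(-eps |xi_i|), whose own transform is a product of Poisson kernels. The
    regularised norm is then (2 pi)^n |f|^2 minus half of a nonnegative mean-square increment of f.
    Dropping this defect gives an inequality for every f in L^1 and L^2; letting it tend to 0 gives
    equality for Schwartz f.

    A spectral measure exhibits no eigenvector. The counting bound forces atoms, and eigenvectors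
    are then picked recursively with minimal integer part of the eigenvalue. Integer parts always
    have a minimum, and the loss is a factor 2.

    [spectral_integral] describes T^-nu only by its quadratic form. Polarisation makes it symmetric,
    and 0 <= P <= 1 gives |P u|^2 <= <P u, u>, so the form controls norms.

    The joint bound q + V + A >= 1 is split into separate lower bounds b0 of V and a0 of A with q +
    a0 + b0 = 1. The energy minus |u|^2 is then a sum of two nonnegative terms, each bounded by the
    energy. *)

Local Notation nc := ComplexField.Normc.normc.

(** * Complex-valued integrals *)

Section complex_norm.
Context {R : realType}.
Implicit Types z w : R[i].

Lemma nc_ge0 z : 0 <= nc z.
Proof. by case: z => a b; exact: sqrtr_ge0. Qed.

Lemma sqr_nc z : nc z ^+ 2 = complex.Re z ^+ 2 + complex.Im z ^+ 2.
Proof. by case: z => a b /=; rewrite sqr_sqrtr// addr_ge0 ?sqr_ge0. Qed.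

Lemma normr_Re z : `|complex.Re z| <= nc z.
Proof. by case: z => a b /=; rewrite -sqrtr_sqr ler_wsqrtr// lerDl sqr_ge0. Qed.

Lemma normr_Im z : `|complex.Im z| <= nc z.
Proof. by case: z => a b /=; rewrite -sqrtr_sqr ler_wsqrtr// lerDr sqr_ge0. Qed.

Lemma nc_le z (c : R) : 0 <= c ->
  complex.Re z ^+ 2 + complex.Im z ^+ 2 <= c ^+ 2 -> nc z <= c.
Proof. by move=> c0; rewrite -sqr_nc ler_sqr ?nnegrE ?nc_ge0. Qed.

Lemma nc_le_ReIm z : nc z <= `|complex.Re z| + `|complex.Im z|.
Proof.
apply: nc_le; rewrite ?addr_ge0//.
rewrite sqrrD !real_normK ?num_real// addrAC lerDl mulrn_wge0//.
Qed.

Lemma ncD z w : nc (z + w) <= nc z + nc w.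
Proof. by rewrite -lecR rmorphD; exact: (ler_normD z w). Qed.

Lemma ncM z w : nc (z * w) = nc z * nc w.
Proof. exact: ComplexField.Normc.normcM. Qed.

Lemma nc_conj z : nc z^* = nc z.
Proof. by case: z => a b /=; rewrite sqrrN. Qed.

Lemma ncN z : nc (- z) = nc z.
Proof. by case: z => a b /=; rewrite !sqrrN. Qed.

Lemma nc_real (a : R) : nc a%:C%C = `|a|.
Proof. by rewrite /= expr0n/= addr0 sqrtr_sqr. Qed.

Lemma nc_eq0 z : (nc z == 0) = (z == 0).
Proof.
apply/eqP/eqP => [/ComplexField.Normc.eq0_normc//|->].
exact: ComplexField.Normc.normc0.
Qed.

Lemma mulc_conj z : z * z^* = (nc z ^+ 2)%:C%C.
Proof.
rewrite sqr_nc; case: z => a b /=; apply/eqP; rewrite eq_complex/=.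
by apply/andP; split; apply/eqP; ring.
Qed.

Lemma nc_cis (t : R) : nc (cis t) = 1.
Proof. by rewrite /= cos2Dsin2 sqrtr1. Qed.

Lemma cisD (s t : R) : cis (s + t) = cis s * cis t.
Proof.
by rewrite /cis sinD cosD; apply/eqP; rewrite eq_complex/= eqxx/=; apply/eqP; ring.
Qed.

Lemma conj_cis (t : R) : (cis t)^* = cis (- t).
Proof. by rewrite /cis sinN cosN. Qed.

Lemma cis0 : cis (0 : R) = 1.
Proof. by rewrite /cis sin0 cos0. Qed.

Lemma eqcP z w : complex.Re z = complex.Re w -> complex.Im z = complex.Im w -> z = w.
Proof. by case: z w => [a b] [c d] /= -> ->. Qed.

Lemma ReD z w : complex.Re (z + w) = complex.Re z + complex.Re w.
Proof. by case: z; case: w. Qed.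

Lemma ImD z w : complex.Im (z + w) = complex.Im z + complex.Im w.
Proof. by case: z; case: w. Qed.

Lemma ReM z w : complex.Re (z * w) =
  complex.Re z * complex.Re w - complex.Im z * complex.Im w.
Proof. by case: z; case: w. Qed.

Lemma ImM z w : complex.Im (z * w) =
  complex.Re z * complex.Im w + complex.Im z * complex.Re w.
Proof. by case: z; case: w. Qed.

Lemma conjM z w : (z * w)^* = z^* * w^* :> R[i].
Proof. exact: rmorphM. Qed.

Lemma conjK z : z^*^* = z.
Proof. by case: z => a b; apply: eqcP => //=; rewrite opprK. Qed.

Lemma Re_conj z : complex.Re z^* = complex.Re z.
Proof. by case: z. Qed.

Lemma Im_conj z : complex.Im z^* = - complex.Im z.
Proof. by case: z. Qed.

End complex_norm.

Section complex_integral.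
Context d (T : measurableType d) (R : realType).
Implicit Types f g : T -> R[i].

Definition cmeas f : Prop :=
  measurable_fun setT (fun x => complex.Re (f x)) /\
  measurable_fun setT (fun x => complex.Im (f x)).

Lemma cmeasD f g : cmeas f -> cmeas g -> cmeas (fun x => f x + g x).
Proof.
move=> [f1 f2] [g1 g2]; split.
  by under eq_fun do rewrite ReD; exact: measurable_funD.
by under eq_fun do rewrite ImD; exact: measurable_funD.
Qed.

Lemma cmeasM f g : cmeas f -> cmeas g -> cmeas (fun x => f x * g x).
Proof.
move=> [f1 f2] [g1 g2]; split.
  by under eq_fun do rewrite ReM; apply: measurable_funB; exact: measurable_funM.
by under eq_fun do rewrite ImM; apply: measurable_funD; exact: measurable_funM.
Qed.

Lemma cmeas_cst (a : R[i]) : cmeas (fun=> a).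
Proof. by split; exact: measurable_cst. Qed.

Lemma cmeas_conj f : cmeas f -> cmeas (fun x => (f x)^*).
Proof.
move=> [f1 f2]; split; first by under eq_fun do rewrite Re_conj.
by under eq_fun do rewrite Im_conj; exact: measurableT_comp f2.
Qed.

Lemma cmeas_real (u : T -> R) : measurable_fun setT u -> cmeas (fun x => (u x)%:C%C).
Proof. by move=> mu; split=> //=; exact: measurable_cst. Qed.

Lemma cmeas_cis (u : T -> R) : measurable_fun setT u -> cmeas (fun x => cis (u x)).
Proof.
move=> mu; split => /=.
  exact: measurableT_comp (continuous_measurable_fun (@continuous_cos R)) mu.
exact: measurableT_comp (continuous_measurable_fun (@continuous_sin R)) mu.
Qed.

Lemma measurable_sqr_nc f : cmeas f -> measurable_fun setT (fun x => nc (f x) ^+ 2).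
Proof.
move=> [f1 f2]; under eq_fun do rewrite sqr_nc.
by apply: measurable_funD; exact: measurable_funX.
Qed.

Lemma measurable_nc f : cmeas f -> measurable_fun setT (fun x => nc (f x)).
Proof.
move=> mf; rewrite (_ : (fun x => _) = (fun x => Num.sqrt (nc (f x) ^+ 2))).
  apply: measurableT_comp (measurable_sqr_nc mf).
  exact: continuous_measurable_fun (@sqrt_continuous R).
by apply/funext => x; rewrite sqrtr_sqr ger0_norm ?nc_ge0.
Qed.

Variable mu : {measure set T -> \bar R}.

Definition rint (u : T -> R) : Prop := mu.-integrable setT (EFin \o u).

Lemma rintD (u v : T -> R) : rint u -> rint v -> rint (fun x => u x + v x).
Proof. by move=> iu iv; exact: (integrableD measurableT iu iv). Qed.

Lemma rintZ (a : R) (u : T -> R) : rint u -> rint (fun x => a * u x).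
Proof. by move=> iu; exact: (integrableZl measurableT a iu). Qed.

Lemma rint_meas (u : T -> R) : rint u -> measurable_fun setT u.
Proof. by move=> /measurable_int /measurable_EFinP. Qed.

Lemma le_rint (u v : T -> R) : measurable_fun setT u ->
  (forall x, `|u x| <= v x) -> rint v -> rint u.
Proof.
move=> mu' uv; apply: le_integrable => //; first exact/measurable_EFinP.
move=> x _ /=; rewrite lee_fin (le_trans (uv x))// ler_norm//.
Qed.

Lemma rint_lty (u : T -> R) : measurable_fun setT u -> (forall x, 0 <= u x) ->
  rint u <-> (\int[mu]_x (u x)%:E < +oo)%E.
Proof.
move=> mu' u0; split => [/integrableP[_]|H].
  by under eq_integral do rewrite /= ger0_norm//.
apply/integrableP; split; first exact/measurable_EFinP.
by under eq_integral do rewrite /= ger0_norm//.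
Qed.

Definition cL1 f : Prop :=
  rint (fun x => complex.Re (f x)) /\ rint (fun x => complex.Im (f x)).

Definition cint f : R[i] :=
  Complex (\int[mu]_x complex.Re (f x)) (\int[mu]_x complex.Im (f x)).

Lemma cL1_meas f : cL1 f -> cmeas f.
Proof. by move=> [/rint_meas ? /rint_meas ?]. Qed.

Lemma cL1_nc f : cL1 f -> rint (fun x => nc (f x)).
Proof.
move=> fi; have [f1 f2] := fi.
apply: (@le_rint _ (fun x => `|complex.Re (f x)| + `|complex.Im (f x)|)).
- exact/measurable_nc/cL1_meas.
- by move=> x; rewrite ger0_norm ?nc_ge0// nc_le_ReIm.
- by apply: rintD; exact: integrable_norm.
Qed.

Lemma le_cL1 f (v : T -> R) : cmeas f -> (forall x, nc (f x) <= v x) ->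
  rint v -> cL1 f.
Proof.
move=> [f1 f2] fv iv; split; apply: (le_rint _ _ iv) => // x;
  by apply: le_trans (fv x); rewrite ?normr_Re ?normr_Im.
Qed.

Lemma cL1D f g : cL1 f -> cL1 g -> cL1 (fun x => f x + g x).
Proof.
move=> [f1 f2] [g1 g2]; split.
  by under eq_fun do rewrite ReD; exact: rintD.
by under eq_fun do rewrite ImD; exact: rintD.
Qed.

Lemma cL1Z (a : R[i]) f : cL1 f -> cL1 (fun x => a * f x).
Proof.
move=> fi; apply: (@le_cL1 _ (fun x => nc a * nc (f x))).
- by apply: cmeasM; [exact: cmeas_cst|exact: cL1_meas].
- by move=> x; rewrite ncM.
- by apply: rintZ; exact: cL1_nc.
Qed.

Lemma cL1_conj f : cL1 f -> cL1 (fun x => (f x)^*).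
Proof.
move=> fi; apply: (@le_cL1 _ (fun x => nc (f x))).
- exact/cmeas_conj/cL1_meas.
- by move=> x; rewrite nc_conj.
- exact: cL1_nc.
Qed.

Lemma cint_eq f g : (forall x, f x = g x) -> cint f = cint g.
Proof. by move=> /funext ->. Qed.

Lemma cintD f g : cL1 f -> cL1 g -> cint (fun x => f x + g x) = cint f + cint g.
Proof.
move=> [f1 f2] [g1 g2]; apply: eqcP => /=.
  by under eq_Rintegral do rewrite ReD; rewrite RintegralD.
by under eq_Rintegral do rewrite ImD; rewrite RintegralD.
Qed.

Lemma cintZ (a : R[i]) f : cL1 f -> cint (fun x => a * f x) = a * cint f.
Proof.
move=> [f1 f2]; apply: eqcP.
  rewrite ReM /= -!RintegralZl// -RintegralB//; try exact: rintZ.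
  by apply: eq_Rintegral => x _; rewrite ReM.
rewrite ImM /= -!RintegralZl// -RintegralD//; try exact: rintZ.
by apply: eq_Rintegral => x _; rewrite ImM.
Qed.

Lemma cintZr (a : R[i]) f : cL1 f -> cint (fun x => f x * a) = cint f * a.
Proof.
move=> fi; rewrite mulrC -cintZ//; apply: cint_eq => x; exact: mulrC.
Qed.

Lemma cint_conj f : cL1 f -> cint (fun x => (f x)^*) = (cint f)^*.
Proof.
move=> [f1 f2]; apply: eqcP; rewrite ?Re_conj ?Im_conj /=.
  by apply: eq_Rintegral => x _; rewrite Re_conj.
rewrite -mulN1r -RintegralZl//; apply: eq_Rintegral => x _.
by rewrite Im_conj mulN1r.
Qed.

Lemma cint_real (u : T -> R) : cint (fun x => (u x)%:C%C) = (\int[mu]_x u x)%:C%C.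
Proof.
apply: eqcP => //=; rewrite /Rintegral integral0_eq//.
Qed.

(* Rotating the integral onto the real axis turns the bound into the one for
   [complex.Re]. *)
Lemma nc_cint f : cL1 f -> nc (cint f) <= \int[mu]_x nc (f x).
Proof.
move=> fi; have [z0|z0] := eqVneq (nc (cint f)) 0.
  by rewrite z0; apply: Rintegral_ge0 => x _; exact: nc_ge0.
have z1 : 0 < nc (cint f) by rewrite lt_neqAle eq_sym z0 nc_ge0.
rewrite -(ler_pM2l z1) -expr2.
have -> : nc (cint f) ^+ 2 = complex.Re (cint (fun x => (cint f)^* * f x)).
  by rewrite cintZ// mulrC mulc_conj.
rewrite -RintegralZl//; last exact: cL1_nc.
have [r1 _] := cL1Z (cint f)^* fi.
apply: le_Rintegral => //; first by apply: rintZ; exact: cL1_nc.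
by move=> x _; rewrite -(nc_conj (cint f)) -ncM (le_trans (ler_norm _))// normr_Re.
Qed.

Lemma ae_eq_cint f g : cmeas f -> cmeas g ->
  {ae mu, forall x, f x = g x} -> cint f = cint g.
Proof.
move=> [f1 f2] [g1 g2] fg.
apply: eqcP; rewrite /= /Rintegral; congr fine; apply: ae_eq_integral => //;
  try exact/measurable_EFinP; by apply: filterS fg => x /= ->.
Qed.

End complex_integral.

(** * Product measures and Fubini's theorem *)

Section product_integrals.
Context d1 d2 (T1 : measurableType d1) (T2 : measurableType d2) (R : realType).
Variables (m1 : {sigma_finite_measure set T1 -> \bar R}).
Variables (m2 : {sigma_finite_measure set T2 -> \bar R}).

Lemma rint_prod (a : T1 -> R) (b : T2 -> R) :
  (forall x, 0 <= a x) -> (forall y, 0 <= b y) -> rint m1 a -> rint m2 b ->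
  rint (m1 \x m2)%E (fun z => a z.1 * b z.2).
Proof.
move=> a0 b0 ia ib; have ma := rint_meas ia; have mb := rint_meas ib.
have mab : measurable_fun setT (fun z : T1 * T2 => a z.1 * b z.2).
  apply: measurable_funM.
  - exact: measurableT_comp ma measurable_fst.
  - exact: measurableT_comp mb measurable_snd.
apply/rint_lty => //; first by move=> z; exact: mulr_ge0.
rewrite (@fubini_tonelli1 _ _ _ _ _ m1 m2 (fun z => (a z.1 * b z.2)%:E)).
- rewrite /fubini_F /=.
  under eq_integral => x _.
    under eq_integral do rewrite EFinM.
    rewrite ge0_integralZl//; last 3 first.
    + exact/measurable_EFinP.
    + by move=> y _; rewrite lee_fin.
    + by rewrite lee_fin.
    over.
  have fb := integrable_fin_num measurableT ib.
  rewrite ge0_integralZr//; last 3 first.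
  - exact/measurable_EFinP.
  - by move=> x _; rewrite lee_fin.
  - by apply: integral_ge0 => y _; rewrite lee_fin.
  have fa := integrable_fin_num measurableT ia.
  by rewrite -(fineK fa) -(fineK fb) -EFinM ltry.
- exact/measurable_EFinP.
- by move=> z; rewrite lee_fin mulr_ge0.
Qed.

Variable (F : T1 * T2 -> R).
Hypothesis iF : rint (m1 \x m2)%E F.
Hypothesis iF1 : forall x, rint m2 (fun y => F (x, y)).
Hypothesis iF2 : forall y, rint m1 (fun x => F (x, y)).

Let E1 : fubini_F m2 (EFin \o F) =
  EFin \o (fun x => \int[m2]_y F (x, y)).
Proof.
by apply/funext => x; rewrite /fubini_F/= /Rintegral fineK//;
  exact: integrable_fin_num (iF1 x).
Qed.

Let E2 : fubini_G m1 (EFin \o F) =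
  EFin \o (fun y => \int[m1]_x F (x, y)).
Proof.
by apply/funext => y; rewrite /fubini_G/= /Rintegral fineK//;
  exact: integrable_fin_num (iF2 y).
Qed.

Lemma meas_partial1 : measurable_fun setT (fun x => \int[m2]_y F (x, y)).
Proof.
by apply/measurable_EFinP; rewrite -E1; exact: measurable_fubini_F iF.
Qed.

Lemma meas_partial2 : measurable_fun setT (fun y => \int[m1]_x F (x, y)).
Proof.
by apply/measurable_EFinP; rewrite -E2; exact: measurable_fubini_G iF.
Qed.

(** Every slice is integrable, not just almost every one, so the partial integrals are real-valued
    functions and the exchange descends from [\bar R] to real integrals. *)
Lemma Rintegral_swap :
  \int[m1]_x \int[m2]_y F (x, y) = \int[m2]_y \int[m1]_x F (x, y).
Proof.
have := Fubini iF; rewrite -/(fubini_F _ _) -/(fubini_G _ _).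
under eq_integral do rewrite -/(fubini_F m2 (EFin \o F) _) E1.
under [in RHS]eq_integral do rewrite -/(fubini_G m1 (EFin \o F) _) E2.
by rewrite /Rintegral => ->.
Qed.

Lemma Rintegral_prodE :
  \int[(m1 \x m2)%E]_z F z = \int[m1]_x \int[m2]_y F (x, y).
Proof.
rewrite /Rintegral -(integral12_prod_meas1 iF) E1//.
Qed.

End product_integrals.

Section complex_fubini.
Context d1 d2 (T1 : measurableType d1) (T2 : measurableType d2) (R : realType).
Variables (m1 : {sigma_finite_measure set T1 -> \bar R}).
Variables (m2 : {sigma_finite_measure set T2 -> \bar R}).
Variables (F : T1 * T2 -> R[i]) (a : T1 -> R) (b : T2 -> R).
Hypotheses (mF : cmeas F) (a0 : forall x, 0 <= a x) (b0 : forall y, 0 <= b y).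
Hypotheses (ia : rint m1 a) (ib : rint m2 b).
Hypothesis Fab : forall x y, nc (F (x, y)) <= a x * b y.

(** A bound by a product of integrable functions yields integrability on the product space and on
    every slice at once. Fubini for complex integrands is always applied in this form. *)
Lemma cL1_prod : cL1 (m1 \x m2)%E F.
Proof.
apply: (le_cL1 mF (v := fun z => a z.1 * b z.2)); last exact: rint_prod.
by case=> x y; exact: Fab.
Qed.

Lemma cL1_slice1 x : cL1 m2 (fun y => F (x, y)).
Proof.
apply: (le_cL1 (v := fun y => a x * b y)) => //; last exact: rintZ.
by case: mF => F1 F2; split;
  [apply: measurableT_comp F1 _ | apply: measurableT_comp F2 _];
  exact: pair1_measurable.
Qed.

Lemma cL1_slice2 y : cL1 m1 (fun x => F (x, y)).
Proof.
apply: (le_cL1 (v := fun x => b y * a x)) => //; last exact: rintZ.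
  by case: mF => F1 F2; split;
  [apply: measurableT_comp F1 _ | apply: measurableT_comp F2 _];
  exact: pair2_measurable.
by move=> x; rewrite mulrC.
Qed.

Lemma cL1_partial1 : cL1 m1 (fun x => cint m2 (fun y => F (x, y))).
Proof.
apply: (le_cL1 (v := fun x => (\int[m2]_y b y) * a x)); last exact: rintZ.
  split => /=.
    apply: (@meas_partial1 _ _ _ _ _ m1 m2 (fun z => complex.Re (F z))).
      by case: cL1_prod.
    by move=> x; case: (cL1_slice1 x).
  apply: (@meas_partial1 _ _ _ _ _ m1 m2 (fun z => complex.Im (F z))).
    by case: cL1_prod.
  by move=> x; case: (cL1_slice1 x).
move=> x; apply: le_trans (nc_cint (cL1_slice1 x)) _.
rewrite mulrC -RintegralZl//.
by apply: le_Rintegral => //; [exact/cL1_nc/cL1_slice1 | exact: rintZ].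
Qed.

Lemma cL1_partial2 : cL1 m2 (fun y => cint m1 (fun x => F (x, y))).
Proof.
apply: (le_cL1 (v := fun y => (\int[m1]_x a x) * b y)); last exact: rintZ.
  split => /=.
    apply: (@meas_partial2 _ _ _ _ _ m1 m2 (fun z => complex.Re (F z))).
      by case: cL1_prod.
    by move=> y; case: (cL1_slice2 y).
  apply: (@meas_partial2 _ _ _ _ _ m1 m2 (fun z => complex.Im (F z))).
    by case: cL1_prod.
  by move=> y; case: (cL1_slice2 y).
move=> y; apply: le_trans (nc_cint (cL1_slice2 y)) _.
rewrite mulrC -RintegralZl//.
apply: le_Rintegral => //; [exact/cL1_nc/cL1_slice2 | exact: rintZ |].
by move=> x _; rewrite mulrC.
Qed.

Lemma cint_swap : cint m1 (fun x => cint m2 (fun y => F (x, y))) =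
  cint m2 (fun y => cint m1 (fun x => F (x, y))).
Proof.
have [F1 F2] := cL1_prod.
apply: eqcP => /=.
  apply: (@Rintegral_swap _ _ _ _ _ m1 m2 (fun z => complex.Re (F z))) => //.
    by move=> x; case: (cL1_slice1 x).
  by move=> y; case: (cL1_slice2 y).
apply: (@Rintegral_swap _ _ _ _ _ m1 m2 (fun z => complex.Im (F z))) => //.
  by move=> x; case: (cL1_slice1 x).
by move=> y; case: (cL1_slice2 y).
Qed.

Lemma cint_prodE : cint (m1 \x m2)%E F =
  cint m1 (fun x => cint m2 (fun y => F (x, y))).
Proof.
have [F1 F2] := cL1_prod.
apply: eqcP => /=.
  apply: (@Rintegral_prodE _ _ _ _ _ m1 m2 (fun z => complex.Re (F z))) => //.
  by move=> x; case: (cL1_slice1 x).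
apply: (@Rintegral_prodE _ _ _ _ _ m1 m2 (fun z => complex.Im (F z))) => //.
by move=> x; case: (cL1_slice1 x).
Qed.

End complex_fubini.

(** A simple function below [f] is below [g], so this is an inequality between suprema, valid for
    arbitrary functions. It serves for the symbol, where the inner integral is a bare function of
    [xi]. *)
Lemma le_integral_ge0 d (T : measurableType d) (R : realType)
    (mu : {measure set T -> \bar R}) (f g : T -> \bar R) :
  (forall x, 0 <= f x)%E -> (forall x, f x <= g x)%E ->
  (\int[mu]_x f x <= \int[mu]_x g x)%E.
Proof.
move=> f0 fg; have g0 x : (0 <= g x)%E by exact: le_trans (f0 x) (fg x).
rewrite !ge0_integralTE//; apply: ereal_sup_le => _ [h hf <-].
by exists h => // x; exact: le_trans (hf x) (fg x).
Qed.

(** * One-dimensional integrals: decaying powers and translations *)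

Lemma powR_decay_continuous (R : realType) (p : R) :
  continuous (fun t : R => (1 + `|t|) `^ (- p)).
Proof.
move=> t; have t0 : 0 < 1 + `|t| :> R by rewrite ltr_pwDl.
apply: (continuous_comp (f := fun t : R => 1 + `|t|)
  (g := fun x : R => x `^ (- p)) (x := t)).
  by apply: cvgD; [exact: cvg_cst | exact: norm_continuous].
apply: differentiable_continuous; apply/derivable1_diffP.
by apply: derivable_powR; rewrite in_itv/= t0.
Qed.

Lemma powR_cvg_pinfty0 (R : realType) (s : R) : 0 < s ->
  (1 + t) `^ (- s) @[t --> +oo%R] --> (0 : R).
Proof.
move=> s0; apply/cvgrPdist_lt => e e0; near=> t.
have t0 : 0 < 1 + t by rewrite addr_gt0//; near: t; exact: nbhs_pinfty_gt.
rewrite sub0r normrN ger0_norm ?powR_ge0// powRN invf_plt ?posrE ?powR_gt0//.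
have -> : e^-1 = (e^-1 `^ s^-1) `^ s.
  by rewrite -powRrM mulVf ?gt_eqF// powRr1// invr_ge0 ltW.
apply: gt0_ltr_powR => //; rewrite ?nnegrE ?powR_ge0 ?(ltW t0)//.
suff : e^-1 `^ s^-1 < t by lra.
by near: t; exact: nbhs_pinfty_gt.
Unshelve. all: by end_near. Qed.

Lemma integral_powR_decay (R : realType) (p : R) : 1 < p ->
  (\int[lebesgue_measure]_t ((1 + `|t|) `^ (- p))%:E < +oo :> \bar R)%E.
Proof.
move=> p1; have s0 : 0 < p - 1 by rewrite subr_gt0.
rewrite ge0_symfun_integralT; last first.
- by move=> t /=; rewrite normrN.
- exact: powR_decay_continuous.
- by move=> t; exact: powR_ge0.
rewrite -set_itvcy.
(* The primitive of (1 + t)^-p on the half line that vanishes at infinity. *)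
pose F (t : R) := - (p - 1)^-1 * (1 + t) `^ (- (p - 1)).
have FE (t : R) : 0 <= t -> is_derive t 1 F ((1 + t) `^ (- p)).
  move=> t0; have t1 : 0 < 1 + t by rewrite ltr_pwDl.
  have d1 : is_derive t 1 (fun t : R => 1 + t) (0 + 1).
    by apply: is_deriveD.
  have d2 : is_derive (1 + t) 1 (fun x : R => x `^ (- (p - 1)))
      (- (p - 1) * (1 + t) `^ (- (p - 1) - 1)) by exact: is_derive1_powR.
  have d3 := @is_derive1_comp _ _ _ _ _ _ d2 d1.
  apply: is_derive_eq (@is_deriveZ _ _ _ _ (- (p - 1)^-1) _ _ _ d3) _.
  rewrite /GRing.scale/= add0r mulr1 mulrA mulrNN mulVf ?gt_eqF// mul1r.
  by congr (_ `^ _); ring.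
rewrite (@ge0_continuous_FTC2y _ _ F 0 0).
- by rewrite -EFinB -EFinM ltry.
- by move=> t _; exact: powR_ge0.
- by apply: continuous_subspaceT; exact: powR_decay_continuous.
- rewrite -[X in _ --> X](mulr0 (- (p - 1)^-1)).
  by apply: cvgM; [exact: cvg_cst | exact: powR_cvg_pinfty0].
- by move=> t t0; have [] := FE t (ltW t0).
- apply: cvg_at_right_filter; apply: differentiable_continuous.
  by apply/derivable1_diffP; have [] := FE 0 (lexx 0).
- move=> t; rewrite in_itv/= andbT => t0.
  by rewrite derive1E; have [_ ->] := FE t (ltW t0); rewrite gtr0_norm.
Qed.

(** The image measure under a translation agrees with Lebesgue measure on half-open intervals, and
    these determine it. *)
Lemma lebesgue_measure_shift (R : realType) (h : R) (A : set (measurableTypeR R)) :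
  measurable A ->
  lebesgue_measure A = lebesgue_measure ((fun t : R => t + h) @^-1` A).
Proof.
have mshift : measurable_fun setT (fun t : measurableTypeR R => (t + h : measurableTypeR R)).
  by apply: continuous_measurable_fun => t; apply: cvgD; [exact: cvg_id|exact: cvg_cst].
move=> mA.
rewrite (@lebesgue_measure_unique R (pushforward lebesgue_measure
  (fun t : measurableTypeR R => (t + h : measurableTypeR R))))//.
move=> _ [[a b] _ <-] /=; rewrite /pushforward.
rewrite (_ : _ @^-1` _ = `]a - h, b - h]%classic); last first.
  by apply/seteqP; split => t /=; rewrite !in_itv/= ltrBlDr lerBrDr.
rewrite [LHS]lebesgue_measure_itv [RHS]lebesgue_measure_itv/= !lte_fin ltrD2r.
by case: ifP => // _; rewrite -!EFinB opprB addrA subrK.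
Qed.

Lemma ge0_integral_shift (R : realType) (h : R) (f : R -> \bar R) :
  measurable_fun setT f -> (forall t, 0 <= f t)%E ->
  (\int[lebesgue_measure]_t f (t + h)%R = \int[lebesgue_measure]_t f t)%E.
Proof.
move=> mf f0.
have mshift : measurable_fun setT (fun t : measurableTypeR R => (t + h : measurableTypeR R)).
  by apply: continuous_measurable_fun => t; apply: cvgD; [exact: cvg_id|exact: cvg_cst].
rewrite [RHS](eq_measure_integral (pushforward lebesgue_measure
  (fun t : measurableTypeR R => (t + h : measurableTypeR R)))); last first.
  by move=> A mA _; exact: lebesgue_measure_shift.
by rewrite ge0_integral_pushforward.
Qed.

(** * Integrals over R^n as iterated integrals *)

Section integral_rV_cons.
Context {R : realType} (n : nat).
Implicit Types f : 'rV[R]_n.+1 -> \bar R.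

Lemma ge0_integral_rV_cons f : measurable_fun setT f -> (forall x, 0 <= f x)%E ->
  (\int[lebesgue_rV n.+1]_x f x =
   \int[lebesgue_measure]_t \int[lebesgue_rV n]_x f (rV_cons (t, x)))%E.
Proof.
move=> mf f0; rewrite /= [LHS](@ge0_integral_pushforward _ _ _ _ _ _
  (@measurable_rV_cons R n) _ setT)//.
rewrite preimage_setT fubini_tonelli1//=.
exact: measurableT_comp mf (@measurable_rV_cons R n).
Qed.

Lemma cint_rV_cons (f : 'rV[R]_n.+1 -> R[i]) (a : R -> R) (b : 'rV[R]_n -> R) :
  cmeas f -> (forall t, 0 <= a t) -> (forall x, 0 <= b x) ->
  rint lebesgue_measure a -> rint (lebesgue_rV n) b ->
  (forall t x, nc (f (rV_cons (t, x))) <= a t * b x) ->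
  cL1 (lebesgue_rV n.+1) f /\
  cint (lebesgue_rV n.+1) f =
  cint lebesgue_measure (fun t => cint (lebesgue_rV n) (fun x => f (rV_cons (t, x)))).
Proof.
move=> mf a0 b0 ia ib fab.
pose F := f \o @rV_cons R n.
have mF : cmeas F.
  by case: mf => f1 f2; split;
  [exact: measurableT_comp f1 (@measurable_rV_cons R n)
  |exact: measurableT_comp f2 (@measurable_rV_cons R n)].
have [F1 F2] := cL1_prod mF a0 b0 ia ib fab.
have [f1 f2] := mf.
split.
  by split; apply: (integrable_pushforward (@measurable_rV_cons R n)) => //;
    exact/measurable_EFinP.
rewrite -(cint_prodE mF a0 b0 ia ib fab).
apply: eqcP; congr fine.
  by apply: (integral_pushforward (@measurable_rV_cons R n)
    (f := fun x => (complex.Re (f x))%:E)) => //; exact/measurable_EFinP.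
by apply: (integral_pushforward (@measurable_rV_cons R n)
  (f := fun x => (complex.Im (f x))%:E)) => //; exact/measurable_EFinP.
Qed.

End integral_rV_cons.

Section integral_rV_prod.
Context {R : realType}.

Lemma measurable_prod_rV n (f : 'I_n -> R -> R) :
  (forall i, measurable_fun setT (f i)) ->
  measurable_fun setT (fun x : 'rV[R]_n => \prod_(i < n) f i (x ord0 i)).
Proof.
move=> mf; apply: measurable_prod => i _.
exact: measurableT_comp (mf i) (@measurable_coord R n i).
Qed.

Lemma prod_rV_cons n (S : comNzRingType) (f : 'I_n.+1 -> R -> S) t (x : 'rV[R]_n) :
  \prod_(i < n.+1) f i (rV_cons (t, x) ord0 i) =
  f ord0 t * \prod_(i < n) f (lift ord0 i) (x ord0 i).
Proof.
rewrite big_ord_recl mxE unlift_none; congr (_ * _).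
by apply: eq_bigr => i _; rewrite mxE liftK.
Qed.

(** Induction on the dimension, [lebesgue_rV n.+1] being the image of a product measure. In
    dimension 0 the measure is a point mass and both sides are an empty product. *)
Lemma integral_rV_prod n (f : 'I_n -> R -> R) (c : 'I_n -> R) :
  (forall i t, 0 <= f i t) -> (forall i, measurable_fun setT (f i)) ->
  (forall i, \int[lebesgue_measure]_t (f i t)%:E = (c i)%:E)%E ->
  (\int[lebesgue_rV n]_x (\prod_(i < n) f i (x ord0 i))%:E
   = (\prod_(i < n) c i)%:E)%E.
Proof.
elim: n f c => [|n IHn] f c f0 mf fc.
  rewrite /= integral_dirac//; first by rewrite diracT mul1e !big_ord0.
  by apply/measurable_EFinP; exact: measurable_prod_rV.
have c0 i : 0 <= c i.
  by rewrite -lee_fin -fc integral_ge0// => t _; rewrite lee_fin.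
rewrite ge0_integral_rV_cons; last 2 first.
- by apply/measurable_EFinP; exact: measurable_prod_rV.
- by move=> x; rewrite lee_fin prodr_ge0.
under eq_integral => t _.
  under eq_integral do rewrite prod_rV_cons EFinM.
  rewrite ge0_integralZl//; last 3 first.
  - by apply/measurable_EFinP; exact: (measurable_prod_rV (fun i => mf (lift ord0 i))).
  - by move=> x _; rewrite lee_fin prodr_ge0.
  - by rewrite lee_fin.
  rewrite (IHn (fun i => f (lift ord0 i)) (fun i => c (lift ord0 i)))// -EFinM mulrC EFinM.
  over.
rewrite ge0_integralZl//; last 3 first.
- by apply/measurable_EFinP; exact: mf.
- by move=> t _; rewrite lee_fin.
- by rewrite lee_fin prodr_ge0.
by rewrite fc -EFinM big_ord_recl mulrC.
Qed.

Lemma cmeas_prod d (T : measurableType d) I (s : seq I) (f : I -> T -> R[i]) :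
  (forall i, cmeas (f i)) -> cmeas (fun x => \prod_(i <- s) f i x).
Proof.
move=> mf; elim: s => [|i s IHs].
  by under eq_fun do rewrite big_nil; exact: cmeas_cst.
by under eq_fun do rewrite big_cons; exact: cmeasM.
Qed.

Lemma rint_rV_prod n (f : 'I_n -> R -> R) :
  (forall i t, 0 <= f i t) -> (forall i, rint lebesgue_measure (f i)) ->
  rint (lebesgue_rV n) (fun x => \prod_(i < n) f i (x ord0 i)).
Proof.
move=> f0 fi; have mf i := rint_meas (fi i).
apply/rint_lty; [exact: measurable_prod_rV|by move=> x; exact: prodr_ge0|].
rewrite (integral_rV_prod (c := fun i => \int[lebesgue_measure]_t f i t))//.
  by rewrite ltry.
by move=> i; rewrite /Rintegral fineK//; exact: integrable_fin_num (fi i).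
Qed.

Lemma cint_rV_prod n (f : 'I_n -> R -> R[i]) :
  (forall i, cL1 lebesgue_measure (f i)) ->
  cL1 (lebesgue_rV n) (fun x => \prod_(i < n) f i (x ord0 i)) /\
  cint (lebesgue_rV n) (fun x => \prod_(i < n) f i (x ord0 i)) =
  \prod_(i < n) cint lebesgue_measure (f i).
Proof.
elim: n f => [|n IHn] f fi.
  have -> : (fun x : 'rV[R]_0 => \prod_(i < 0) f i (x ord0 i)) = fun=> (1%:C)%C.
    by apply/funext => x; rewrite big_ord0.
  have m1 : measurable_fun [set: 'rV[R]_0] (EFin \o (fun=> 1 : R)).
    exact: measurable_cst.
  split.
    apply: (le_cL1 (v := fun=> 1)); first exact: cmeas_cst.
      by move=> x; rewrite nc_real normr1.
    apply/rint_lty => //; rewrite /= integral_dirac//.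
    by rewrite diracT mul1e ltry.
  rewrite big_ord0 cint_real /Rintegral /= integral_dirac//.
  by rewrite diracT mul1e.
pose g i := f (lift ord0 i); have [gi gE] := IHn g (fun i => fi (lift ord0 i)).
have mprod : cmeas (fun x : 'rV[R]_n.+1 => \prod_(i < n.+1) f i (x ord0 i)).
  apply: cmeas_prod => i; have [m1 m2] := cL1_meas (fi i); split.
    exact: measurableT_comp m1 (@measurable_coord R n.+1 i).
  exact: measurableT_comp m2 (@measurable_coord R n.+1 i).
have [|||||f1 f2] := @cint_rV_cons R n _ (fun t => nc (f ord0 t))
   (fun x => nc (\prod_(i < n) g i (x ord0 i))) mprod.
- by move=> t; exact: nc_ge0.
- by move=> t; exact: nc_ge0.
- exact: cL1_nc.
- exact: cL1_nc.
- by move=> t x; rewrite prod_rV_cons ncM.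
split=> //; rewrite f2 big_ord_recl -gE.
rewrite -cintZr//; apply: cint_eq => t.
by rewrite -cintZ//; apply: cint_eq => x; rewrite prod_rV_cons.
Qed.

End integral_rV_prod.

Section translation_rV.
Context {R : realType}.

Lemma measurable_shift_rV n (h : 'rV[R]_n) :
  measurable_fun setT (fun x : 'rV[R]_n => x + h).
Proof.
apply: measurable_rVP => i; under eq_fun do rewrite mxE.
by apply: measurable_funD; [exact: measurable_coord | exact: measurable_cst].
Qed.

(** One coordinate at a time: invariance on the line moves the first coordinate, the induction
    hypothesis the others. *)
Lemma ge0_integral_shift_rV n (h : 'rV[R]_n) (f : 'rV[R]_n -> \bar R) :
  measurable_fun setT f -> (forall x, 0 <= f x)%E ->
  (\int[lebesgue_rV n]_x f (x + h)%R = \int[lebesgue_rV n]_x f x)%E.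
Proof.
elim: n h f => [|n IHn] h f mf f0.
  by apply: eq_integral => x _; congr f; apply/rowP => -[].
rewrite ge0_integral_rV_cons//; last first.
  exact: measurableT_comp mf (measurable_shift_rV h).
rewrite [RHS]ge0_integral_rV_cons//.
pose G (t : R) : \bar R := (\int[lebesgue_rV n]_x f (rV_cons (t, x)))%E.
have mG : measurable_fun setT G.
  apply: (@measurable_fun_fubini_tonelli_F _ _ _ _ _ (lebesgue_rV n)
    (f \o @rV_cons R n)).
    exact: measurableT_comp mf (@measurable_rV_cons R n).
  by move=> z; exact: f0.
transitivity (\int[lebesgue_measure]_t G (t + h ord0 ord0)%R)%E; last first.
  by apply: ge0_integral_shift => // t; exact: integral_ge0.
apply: eq_integral => t _; rewrite /G.
rewrite -[RHS](IHn (\row_i h ord0 (lift ord0 i))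
  (fun x => f (rV_cons (t + h ord0 ord0, x))))//; last first.
  have := @pair1_measurable _ _ (measurableTypeR R) 'rV[R]_n (t + h ord0 ord0 : R).
  move=> mp; apply: measurableT_comp mf _.
  exact: measurableT_comp (@measurable_rV_cons R n) mp.
apply: eq_integral => x _; congr f; apply/rowP => i.
by rewrite !mxE; case: (unliftP ord0 i) => [j|] ->; rewrite ?mxE.
Qed.

Lemma Rintegral_shift_rV n (h : 'rV[R]_n) (f : 'rV[R]_n -> R) :
  measurable_fun setT f ->
  \int[lebesgue_rV n]_x f (x + h) = \int[lebesgue_rV n]_x f x.
Proof.
move=> mf; congr fine; rewrite integralE [RHS]integralE.
congr (_ - _)%E.
  transitivity (\int[lebesgue_rV n]_x ((EFin \o f)^\+ (x + h)%R))%E.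
    by apply: eq_integral => x _; rewrite !funeposE.
  apply: ge0_integral_shift_rV => //.
  by apply: measurable_funepos; exact/measurable_EFinP.
transitivity (\int[lebesgue_rV n]_x ((EFin \o f)^\- (x + h)%R))%E.
  by apply: eq_integral => x _; rewrite !funenegE.
apply: ge0_integral_shift_rV => //.
by apply: measurable_funeneg; exact/measurable_EFinP.
Qed.

End translation_rV.

(** * Atoms of measures *)

Lemma measure_bigcup_null d (T : measurableType d) (R : realType)
    (m : {measure set T -> \bar R}) (F : nat -> set T) :
  (forall k, measurable (F k)) -> (forall k, m (F k) = 0%E) ->
  m (\bigcup_k F k) = 0%E.
Proof.
move=> mF F0; apply: measure_negligible.
  by apply: bigcup_measurable => k _.
by apply: negligible_bigcup => k; apply/negligibleP; [exact: mF|exact: F0].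
Qed.

Section finite_measure_on_line.
Context {R : realType}.
Variable m : {measure set R -> \bar R}.

(** Suppose there is no splitting point. Then [c, e[ is null up to a threshold [l] and [e, d[ is
    null beyond it, so all the mass sits at [l], which must be an atom. *)
Lemma atom_or_split (c d : R) : c < d -> (0 < m `[c, d[%classic)%E ->
  (exists2 l, c <= l < d & (0 < m [set l])%E) \/
  (exists e, [/\ c < e, e < d, (0 < m `[c, e[%classic)%E & (0 < m `[e, d[%classic)%E]).
Proof.
move=> cd mcd.
have [|noatom] := pselect (exists2 l, c <= l < d & (0 < m [set l])%E).
  by left.
right; apply: contrapT => nosplit.
have at0 l : c <= l < d -> m [set l] = 0%E.
  move=> cld; apply/eqP; rewrite eq_le measure_ge0 andbT leNgt; apply/negP => ml.
  by apply: noatom; exists l.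
have sp0 e : c < e < d -> m `[c, e[%classic = 0%E \/ m `[e, d[%classic = 0%E.
  move=> /andP[ce ed]; have [mce|mce] := leP (m `[c, e[%classic) 0%E.
    by left; apply/eqP; rewrite eq_le mce measure_ge0.
  right; apply/eqP; rewrite eq_le measure_ge0 andbT leNgt; apply/negP => med.
  by apply: nosplit; exists e.
pose Z := [set e : R | c <= e < d /\ m `[c, e[%classic = 0%E].
have Zc : Z c by split; rewrite ?lexx// set_itvE measure0.
have Zub : has_sup Z.
  by split; [exists c|exists d => e [/andP[_ /ltW]]].
pose l := sup Z.
have cl : c <= l by apply: sup_upper_bound.
have ld : l <= d by apply: sup_le_ub => [|e [/andP[_ /ltW]]//]; exists c.
have left0 e : e < l -> m `[c, e[%classic = 0%E.
  move=> el; have [y [_ my] ey] := sup_adherent (eps := l - e) (E := Z) (etrans (subr_gt0 e l) el) Zub.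
  rewrite -/l opprB addrC subrK in ey.
  apply/eqP; rewrite eq_le measure_ge0 andbT -my; apply: le_measure; rewrite ?inE//.
  by apply: subset_itvl; rewrite bnd_simp ltW.
have right0 e : l < e -> e < d -> m `[e, d[%classic = 0%E.
  move=> le ed; have ce : c < e by exact: le_lt_trans le.
  have /sp0[mce|//] : c < e < d by rewrite ce.
  have : e <= l by apply: sup_upper_bound => //; split => //; rewrite (ltW ce) ed.
  by rewrite leNgt le.
have N1 : m `[c, l[%classic = 0%E.
  have -> : `[c, l[%classic = \bigcup_k `[c, l - k.+1%:R^-1[%classic.
    apply/seteqP; split => [x /=|x [k _] /=]; rewrite !in_itv/=.
      move=> /andP[cx xl]; have := ltr_add_invr xl => -[k kx]; exists k => //=.
      by rewrite in_itv/= cx ltrBrDr.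
    by move=> /andP[-> /lt_le_trans]; apply; rewrite gerBl.
  apply: measure_bigcup_null => // k; apply: left0.
  by rewrite ltrBlDr ltrDl invr_gt0.
have N2 : m `]l, d[%classic = 0%E.
  have -> : `]l, d[%classic = \bigcup_k `[l + k.+1%:R^-1, d[%classic.
    apply/seteqP; split => [x /=|x [k _] /=]; rewrite !in_itv/=.
      move=> /andP[lx xd]; have := ltr_add_invr lx => -[k kx]; exists k => //=.
      by rewrite in_itv/= xd (ltW kx).
    by move=> /andP[h ->]; rewrite andbT (lt_le_trans _ h)// ltrDl invr_gt0.
  apply: measure_bigcup_null => // k.
  have [led|] := ltP (l + k.+1%:R^-1) d; first by apply: right0 => //; rewrite ltrDl invr_gt0.
  by move=> h; rewrite set_itv_ge ?measure0// -leNgt.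
have : (m `[c, d[%classic <= m `[c, l[%classic + m ([set l] `&` `[c, d[%classic) + m `]l, d[%classic)%E.
  apply: (@le_trans _ _ (m ((`[c, l[%classic `|` ([set l] `&` `[c, d[%classic)) `|` `]l, d[%classic))).
    apply: le_measure; rewrite ?inE//.
      by apply: measurableU => //; apply: measurableU => //; exact: measurableI.
    move=> x /=; rewrite !in_itv/= => /andP[cx xd].
    have [xl|lx|xl] := ltgtP x l.
    - by left; left; rewrite /= ?in_itv/= ?cx ?xl.
    - by right; rewrite /= ?in_itv/= ?lx ?xd.
    - by left; right; split => //=; rewrite ?in_itv/= ?cx ?xd.
  apply: le_trans (measureU2 _ _ _) _ => //.
    by apply: measurableU => //; exact: measurableI.
  by rewrite leeD2r//; apply: measureU2 => //; exact: measurableI.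
rewrite N1 N2 add0e adde0 leNgt => /negP; apply.
apply: le_lt_trans mcd.
(* The threshold may be the excluded end point [d]; then [c, d[ does not contain it. *)
move: ld; rewrite le_eqVlt => /predU1P[ld|ld].
  rewrite (_ : _ `&` _ = set0) ?measure0//.
  by apply/seteqP; split => // x [/= ->]; rewrite in_itv/= ld ltxx andbF.
rewrite -(at0 l) ?cl//.
by apply: le_measure; rewrite ?inE//; exact: measurableI.
Qed.

(** As long as no atom shows up, an initial piece of positive measure is split off and the remainder
    is treated again. [M] will exceed the possible size of an orthonormal family of bounded
    energy. *)
Lemma atom_or_many M (c d : R) : c < d -> (0 < m `[c, d[%classic)%E ->
  (exists2 l, c <= l < d & (0 < m [set l])%E) \/
  (exists F : nat -> set R, [/\ forall i, measurable (F i),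
     forall i, F i `<=` `[c, d[%classic, forall i, (i < M)%N -> (0 < m (F i))%E &
     forall i j, (i < M)%N -> (j < M)%N -> i != j -> F i `&` F j = set0]).
Proof.
elim: M c d => [|M IHM] c d cd mcd.
  by right; exists (fun=> set0); split => // i x.
have [|[e [ce ed mce med]]] := atom_or_split cd mcd; first by left.
have [[l /andP[el ld] ml]|[F [mF Fs F0 Fd]]] := IHM e d ed med.
  by left; exists l => //; rewrite ld (le_trans (ltW ce) el).
right; exists (fun i => if i is i'.+1 then F i' else `[c, e[%classic); split.
- by case.
- case=> [|i].
    by apply: subset_itvl; rewrite bnd_simp ltW.
  by apply: subset_trans (Fs i) _; apply: subset_itvr; rewrite bnd_simp ltW.
- by case=> [|i] //; exact: F0.
- have dj i : `[c, e[%classic `&` F i = set0.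
    apply/seteqP; split => // x [/= + /Fs] /=; rewrite !in_itv/=.
    by move=> /andP[_ xe] /andP[]; rewrite leNgt xe.
  case=> [|i] [|j] iM jM ij.
  + by rewrite eqxx in ij.
  + exact: (dj j).
  + by rewrite setIC; exact: (dj i).
  + exact: Fd.
Qed.

End finite_measure_on_line.

Section bounded_integral.
Context {R : realType}.
Variable m : {measure set R -> \bar R}.

(** Truncating [f] to values in [a, b] changes it only on the null set outside [B], and the
    truncation is bounded, hence integrable for a finite measure. *)
Lemma Rintegral_between (M : R) (f : R -> R) (B : set R) (a b : R) :
  m setT = M%:E -> measurable_fun setT f -> measurable B -> m (~` B) = 0%E ->
  a <= b -> (forall t, B t -> a <= f t <= b) ->
  [/\ rint m f, a * M <= \int[m]_t f t & \int[m]_t f t <= b * M].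
Proof.
move=> mM mf mB mB0 ab fab.
pose g t := Num.max a (Num.min b (f t)).
have mg : measurable_fun setT g.
  by apply: measurable_maxr => //; exact: measurable_minr.
have gab t : a <= g t <= b.
  by rewrite /g le_max lexx/= ge_max ab ge_min lexx.
have cst_int c : rint m (fun=> c).
  apply/integrableP; split; first exact/measurable_EFinP.
  by rewrite (@integral_cst _ _ _ m _ measurableT (`|c|%:E)%E) mM -EFinM ltry.
have gint : rint m g.
  apply: (@le_rint _ _ _ _ _ (fun=> `|a| + `|b|)) => // t.
  have /andP[h1 h2] := gab t.
  have := ler_norm b; have := ler_norm (- a); rewrite normrN => h3 h4.
  have := normr_ge0 a; have := normr_ge0 b => h5 h6.
  by rewrite ler_norml; apply/andP; split; lra.
have fg : ae_eq m setT (EFin \o f) (EFin \o g).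
  exists (~` B); split => //; first exact: measurableC.
  move=> t /= H Bt; apply: H => _; rewrite /g.
  have /andP[h1 h2] := fab t Bt.
  by congr EFin; rewrite (min_idPr h2) (max_idPr h1).
have E : \int[m]_t f t = \int[m]_t g t.
  by congr fine; apply: ae_eq_integral => //; exact/measurable_EFinP.
have fint : rint m f.
  apply/integrableP; split; first exact/measurable_EFinP.
  have /integrableP[_] := gint; congr (_ < _)%E.
  apply: ae_eq_integral => //; [exact/measurableT_comp/measurable_EFinP|exact/measurableT_comp/measurable_EFinP|].
  by apply: filterS fg => t H /H /= [->].
have Ic c : \int[m]_t c = c * M.
  by rewrite Rintegral_cst// mM.
have ca := cst_int a; have cb := cst_int b.
by split=> //; rewrite E -Ic; apply: le_Rintegral => // t _; have /andP[] := gab t.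
Qed.

End bounded_integral.

(** * The Hilbert space L^2 *)

Section L2_algebra.
Context {R : realType} {n : nat}.
Notation fct := ('rV[R]_n -> R[i]).
Notation mu := (@lebesgue_rV R n).
Implicit Types f g u v w : fct.

Definition nsq f : R := fine (sqr_integral f).

(** The shape of the closure clause of [linear_op]. Sums, multiples and differences are instances;
    note that [lc (-1) u v] is v - u. *)
Definition lc (a : R[i]) u v : fct := fun x => a * u x + v x.

Lemma L2P f : L2 f <-> cmeas f /\ rint mu (fun x => nc (f x) ^+ 2).
Proof.
split=> [[f1 f2 f3]|[[f1 f2] f3]].
  have mf : cmeas f by [].
  split=> //; apply/rint_lty => //; first exact: measurable_sqr_nc.
  by move=> x; exact: sqr_ge0.
split=> //; apply/rint_lty => //; first exact: (measurable_sqr_nc (conj f1 f2)).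
by move=> x; exact: sqr_ge0.
Qed.

Lemma nsqE f : nsq f = \int[mu]_x (nc (f x) ^+ 2).
Proof. by []. Qed.

Lemma nsq_ge0 f : 0 <= nsq f.
Proof. by rewrite nsqE; apply: Rintegral_ge0 => x _; exact: sqr_ge0. Qed.

Lemma l2normE f : l2norm f = Num.sqrt (nsq f).
Proof. by []. Qed.

Lemma L2_0 : @L2 R n (fun=> 0).
Proof.
apply/L2P; split; first exact: cmeas_cst.
under eq_fun do rewrite ComplexField.Normc.normc0 expr0n/=.
exact: integrable0.
Qed.

Lemma L2_prod f g : L2 f -> L2 g -> cL1 mu (fun x => f x * (g x)^*).
Proof.
move=> /L2P[mf f2] /L2P[mg g2].
apply: (le_cL1 (v := fun x => nc (f x) ^+ 2 + nc (g x) ^+ 2)).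
- by apply: cmeasM => //; exact: cmeas_conj.
- move=> x; rewrite ncM nc_conj.
  have := sqr_ge0 (nc (f x) - nc (g x)); have := sqr_ge0 (nc (f x)).
  by have := sqr_ge0 (nc (g x)); nra.
- exact: rintD.
Qed.

Lemma L2_lc a u v : L2 u -> L2 v -> L2 (lc a u v).
Proof.
move=> /L2P[mu' u2] /L2P[mv v2]; apply/L2P.
have mlc : cmeas (lc a u v).
  by apply: cmeasD => //; apply: cmeasM => //; exact: cmeas_cst.
split => //.
apply: (@le_rint _ _ _ _ _ (fun x => (2 * nc a ^+ 2) * nc (u x) ^+ 2 + 2 * nc (v x) ^+ 2)).
- exact: measurable_sqr_nc.
- move=> x; rewrite ger0_norm ?sqr_ge0//.
  have h := ncD (a * u x) (v x); rewrite ncM in h.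
  have := nc_ge0 (a * u x + v x).
  have := sqr_ge0 (nc a * nc (u x) - nc (v x)).
  by rewrite /lc; nra.
- by apply: rintD; exact: rintZ.
Qed.

Lemma inner_lcl a u v w : L2 u -> L2 v -> L2 w ->
  inner (lc a u v) w = a * inner u w + inner v w.
Proof.
move=> u2 v2 w2; have uw := L2_prod u2 w2; have vw := L2_prod v2 w2.
rewrite /inner -[cintegral]/(cint mu) -cintZ// -cintD//; last exact: cL1Z.
by apply: cint_eq => x; rewrite /lc mulrDl mulrA.
Qed.

Lemma inner_conj u v : L2 u -> L2 v -> inner v u = (inner u v)^*.
Proof.
move=> u2 v2; rewrite /inner -[cintegral]/(cint mu) -cint_conj; last exact: L2_prod.
by apply: cint_eq => x; rewrite conjM conjK mulrC.
Qed.

Lemma inner_lcr a u v w : L2 u -> L2 v -> L2 w ->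
  inner w (lc a u v) = a^* * inner w u + inner w v.
Proof.
move=> u2 v2 w2; rewrite inner_conj//; last exact: L2_lc.
rewrite inner_lcl// rmorphD rmorphM /=.
by rewrite -(inner_conj u2 w2) -(inner_conj v2 w2).
Qed.

Lemma inner_self u : inner u u = (nsq u)%:C%C.
Proof.
rewrite nsqE -cint_real; apply: cint_eq => x; exact: mulc_conj.
Qed.

Lemma nsq_lc a u v : L2 u -> L2 v ->
  nsq (lc a u v) = nc a ^+ 2 * nsq u + 2 * complex.Re (a * inner u v) + nsq v.
Proof.
move=> u2 v2; have lc2 := L2_lc a u2 v2.
have := inner_self (lc a u v).
rewrite inner_lcl// !inner_lcr// !inner_self (inner_conj u2 v2).
move=> /(congr1 (@complex.Re R)) /= <-; rewrite sqr_nc.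
case: (inner u v) => p r; case: a lc2 => b c _ /=.
ring.
Qed.

Lemma nsq_sub u v : L2 u -> L2 v ->
  nsq (lc (-1) u v) = nsq u - 2 * complex.Re (inner u v) + nsq v.
Proof.
move=> u2 v2; rewrite nsq_lc// ncN ComplexField.Normc.normc1.
by rewrite mulN1r; case: (inner u v) => p r /=; ring.
Qed.

Lemma cauchy_schwarz u v : L2 u -> L2 v ->
  nc (inner u v) ^+ 2 <= nsq u * nsq v.
Proof.
move=> u2 v2; set z := inner u v.
(* The phase of the coefficient turns the cross term into the real number 2 t |z|^2, so the squared
   norm is a real quadratic polynomial in [t]. *)
have H (t : R) : 0 <= t ^+ 2 * (nc z ^+ 2 * nsq u) + 2 * t * nc z ^+ 2 + nsq v.
  have := nsq_ge0 (lc (t%:C%C * z^*) u v).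
  rewrite nsq_lc// ncM nc_conj nc_real exprMn real_normK ?num_real//.
  rewrite -/z -[_ * z^* * z]mulrA [z^* * z]mulrC mulc_conj -rmorphM/=.
  by congr (0 <= _); ring.
have [z0|z0] := eqVneq (nc z) 0; first by rewrite z0 expr0n/= mulr_ge0 ?nsq_ge0.
have zp : 0 < nc z ^+ 2 by rewrite exprn_gt0// lt_neqAle eq_sym z0 nc_ge0.
have [u0|u0] := eqVneq (nsq u) 0.
  (* Here the polynomial is affine in [t], and this value of [t] makes it equal to -1. *)
  have := H (- (nsq v + 1) / (2 * nc z ^+ 2)); rewrite u0 mulr0 mulr0 add0r.
  rewrite (_ : 2 * _ * _ = - (nsq v + 1)); first by lra.
  by field; rewrite z0.
have up : 0 < nsq u by rewrite lt_neqAle eq_sym u0 nsq_ge0.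
have := H (- (nsq u)^-1).
rewrite (_ : (- (nsq u)^-1) ^+ 2 * (nc z ^+ 2 * nsq u) +
  2 * - (nsq u)^-1 * nc z ^+ 2 = - (nc z ^+ 2 / nsq u)); last by field.
by rewrite addrC subr_ge0 ler_pdivrMr// mulrC.
Qed.

Lemma nsq0 : nsq (fun=> 0) = 0.
Proof.
rewrite /nsq /sqr_integral integral0_eq// => x _.
by rewrite ComplexField.Normc.normc0 expr0n.
Qed.

Lemma inner0r u : L2 u -> inner u (fun=> 0) = 0.
Proof.
move=> u2; have := cauchy_schwarz u2 L2_0; rewrite nsq0 mulr0 => h.
by apply/eqP; rewrite -nc_eq0 -sqrf_eq0 eq_le h sqr_ge0.
Qed.

Lemma inner0l u : L2 u -> inner (fun=> 0) u = 0.
Proof.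
move=> u2; rewrite (inner_conj u2 L2_0) inner0r//; exact: rmorph0.
Qed.

Lemma aeq_refl u : aeq u u.
Proof. exact: aeW. Qed.

Lemma aeq_sym u v : aeq u v -> aeq v u.
Proof. by apply: filterS => x ->. Qed.

Lemma inner_aeq u u' v v' : L2 u -> L2 u' -> L2 v -> L2 v' ->
  aeq u u' -> aeq v v' -> inner u v = inner u' v'.
Proof.
move=> u2 u2' v2 v2' uu vv; apply: ae_eq_cint.
- exact/cL1_meas/L2_prod.
- exact/cL1_meas/L2_prod.
- by near=> x; rewrite (near uu x)// (near vv x).
Unshelve. all: by end_near. Qed.

Lemma nsq_aeq u v : L2 u -> L2 v -> aeq u v -> nsq u = nsq v.
Proof.
move=> u2 v2 uv; have := inner_aeq u2 v2 u2 v2 uv uv.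
by rewrite !inner_self => -[].
Qed.

Lemma nsq0_aeq u : L2 u -> nsq u = 0 -> aeq u (fun=> 0).
Proof.
move=> /L2P[mu' u2] u0.
have : {ae mu, forall x, setT x -> (nc (u x) ^+ 2)%:E = 0%E}.
  apply/ae_eq_integral_abs => //; first exact/measurable_EFinP/measurable_sqr_nc.
  under eq_integral do rewrite /= ger0_norm ?sqr_ge0//.
  by rewrite -[LHS]fineK ?(integrable_fin_num _ u2)// -[fine _]/(nsq u) u0.
apply: filterS => x /(_ I) [] /eqP; rewrite sqrf_eq0 nc_eq0 => /eqP//.
Qed.

Lemma nsq_sub_aeq u v : L2 u -> L2 v -> nsq (lc (-1) u v) = 0 -> aeq u v.
Proof.
move=> u2 v2 /(nsq0_aeq (L2_lc _ u2 v2)); apply: filterS => x.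
by rewrite /lc mulN1r addrC => /eqP; rewrite subr_eq0 => /eqP ->.
Qed.

Lemma nsqD_le u v : L2 u -> L2 v -> nsq (lc 1 u v) <= 2 * nsq u + 2 * nsq v.
Proof.
move=> u2 v2; have := nsq_ge0 (lc (-1) u v).
rewrite nsq_sub// nsq_lc// ComplexField.Normc.normc1 mul1r.
by rewrite expr1n; lra.
Qed.

Lemma l2cvgE (uk : nat -> fct) u : l2cvg uk u <->
  [/\ (forall k, L2 (uk k)), L2 u & nsq (lc (-1) (uk k) u) @[k --> \oo] --> (0 : R)].
Proof.
have E k : (forall k, L2 (uk k)) -> L2 u ->
    l2norm (fun x => uk k x - u x) = Num.sqrt (nsq (lc (-1) (uk k) u)).
  move=> uk2 u2; rewrite l2normE /nsq /sqr_integral; congr (Num.sqrt (fine _)).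
  by apply: eq_integral => x _; rewrite /lc -ncN opprB mulN1r addrC.
split=> -[uk2 u2 H]; split=> //.
  rewrite (_ : (fun k => _) = fun k => (l2norm (fun x => uk k x - u x)) ^+ 2).
    by rewrite -[X in _ --> X](mulr0 0); exact: cvgM.
  by apply/funext => k; rewrite E// sqr_sqrtr// nsq_ge0.
rewrite (_ : (fun k => _) = fun k => Num.sqrt (nsq (lc (-1) (uk k) u))).
  rewrite -[X in _ --> X](@sqrtr0 R).
  exact: (continuous_cvg _ (@sqrt_continuous R 0)).
by apply/funext => k; rewrite E.
Qed.

Lemma nsq_cvg (uk : nat -> fct) u : l2cvg uk u ->
  nsq (uk k) @[k --> \oo] --> nsq u.
Proof.
move=> /l2cvgE[uk2 u2]; set d := fun k => lc (-1) (uk k) u => uc.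
have d2 k : L2 (d k) by exact: L2_lc.
have E k : nsq (uk k) = nsq (d k) - 2 * complex.Re (inner (d k) u) + nsq u.
  rewrite -nsq_sub//; congr (fine (integral _ _ _)); apply/funext => x.
  by rewrite /d /lc; congr (nc _ ^+ 2)%:E; ring.
have ic : complex.Re (inner (d k) u) @[k --> \oo] --> (0 : R).
  apply/norm_cvg0P.
  apply: (@squeeze_cvgr _ _ _ _ (fun=> 0) (fun k => Num.sqrt (nsq (d k) * nsq u))).
  - near=> k; apply/andP; split; first exact: normr_ge0.
    apply: le_trans (normr_Re _) _.
    rewrite -[leLHS]ger0_norm ?nc_ge0// -sqrtr_sqr ler_wsqrtr//.
    exact: cauchy_schwarz.
  - exact: cvg_cst.
  - rewrite -[X in _ --> X](@sqrtr0 R) -[X in Num.sqrt X](mul0r (nsq u)).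
    apply: (continuous_cvg _ (@sqrt_continuous R _)).
    by apply: cvgM => //; exact: cvg_cst.
rewrite (funext E).
suff : nsq (d k) - 2 * complex.Re (inner (d k) u) + nsq u @[k --> \oo] -->
    0 - 2 * 0 + nsq u by rewrite mulr0 subr0 add0r.
exact: (cvgD (cvgB uc (cvgM (cvg_cst (2 : R)) ic)) (cvg_cst (nsq u))).
Unshelve. all: by end_near. Qed.

Lemma l2cvgD (uk vk : nat -> fct) u v : l2cvg uk u -> l2cvg vk v ->
  l2cvg (fun k => lc 1 (uk k) (vk k)) (lc 1 u v).
Proof.
move=> /l2cvgE[uk2 u2 uc] /l2cvgE[vk2 v2 vc]; apply/l2cvgE; split.
- by move=> k; exact: L2_lc.
- exact: L2_lc.
apply: (@squeeze_cvgr _ _ _ _ (fun=> 0) (fun k => 2 * nsq (lc (-1) (uk k) u)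
   + 2 * nsq (lc (-1) (vk k) v))).
- near=> k; rewrite nsq_ge0/=.
  apply: le_trans (nsqD_le (L2_lc _ (uk2 k) u2) (L2_lc _ (vk2 k) v2)).
  rewrite le_eqVlt; apply/orP; left; apply/eqP.
  congr (fine (integral _ _ _)); apply/funext => x.
  by rewrite /lc; congr (nc _ ^+ 2)%:E; ring.
- exact: cvg_cst.
- suff : 2 * nsq (lc (-1) (uk k) u) + 2 * nsq (lc (-1) (vk k) v) @[k --> \oo]
      --> (2 * 0 + 2 * 0 : R) by rewrite mulr0 addr0.
  exact: (cvgD (cvgM (cvg_cst (2 : R)) uc) (cvgM (cvg_cst (2 : R)) vc)).
Unshelve. all: by end_near. Qed.

Lemma Re_inner_cvg (uk vk : nat -> fct) u v : l2cvg uk u -> l2cvg vk v ->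
  complex.Re (inner (uk k) (vk k)) @[k --> \oo] --> complex.Re (inner u v).
Proof.
move=> uc vc; have [uk2 u2 _] := uc; have [vk2 v2 _] := vc.
(* By polarisation it is enough to follow norms. *)
have E a b : L2 a -> L2 b ->
    complex.Re (inner a b) = 2^-1 * (nsq (lc 1 a b) - nsq a - nsq b).
  move=> a2 b2; rewrite nsq_lc// ComplexField.Normc.normc1 expr1n !mul1r.
  by field.
rewrite (funext (fun k => E _ _ (uk2 k) (vk2 k))) E//.
exact: (cvgM (cvg_cst (2^-1 : R))
  (cvgB (cvgB (nsq_cvg (l2cvgD uc vc)) (nsq_cvg uc)) (nsq_cvg vc))).
Qed.

End L2_algebra.

(** * Completeness of L^2 *)

Section riesz_fischer.
Context {R : realType} {n : nat}.
Notation fct := ('rV[R]_n -> R[i]).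
Notation mu := (@lebesgue_rV R n).

Lemma cvgn_fast_cauchy (a : nat -> R) (b : nat -> R) :
  (forall k, 0 <= b k) -> cvgn (series b) ->
  (forall k, `|a k.+1 - a k| <= b k) -> cvgn a.
Proof.
move=> b0 cb ab.
have cd : cvgn (series (fun k => a k.+1 - a k)).
  by apply: normed_cvg; apply: (series_le_cvg _ b0 ab cb) => k; exact: normr_ge0.
have -> : a = fun k => a 0%N + series (fun k => a k.+1 - a k) k.
  by apply/funext => k; rewrite seriesEnat/= telescope_sumr// addrC subrK.
by apply: is_cvgD => //; exact: is_cvg_cst.
Qed.

Lemma L2_complete (f : nat -> fct) : (forall k, L2 (f k)) ->
  (forall k m, (k <= m)%N -> nsq (lc (-1) (f k) (f m)) <= 4^-1 ^+ k) ->
  exists2 v, L2 v & l2cvg f v.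
Proof.
move=> f2 fc.
have mf k : cmeas (f k) by have /L2P[] := f2 k.
pose d k := lc (-1) (f k) (f k.+1).
have d2 k : L2 (d k) by exact: L2_lc.
(* The factor 2^k leaves integrals summing like 2^k 4^-k = 2^-k. It also makes the increments
   summable at almost every point, since |d_k| <= 2^-k + 2^k |d_k|^2. *)
pose g k x := ((2 ^+ k * nc (d k x) ^+ 2)%:E : \bar R).
have mg k : measurable_fun setT (g k).
  apply/measurable_EFinP; apply: measurable_funM; first exact: measurable_cst.
  by apply: measurable_sqr_nc; have /L2P[] := d2 k.
have g0 k x : (0 <= g k x)%E.
  by rewrite lee_fin; apply: mulr_ge0; [exact: exprn_ge0|exact: sqr_ge0].
have Ig : (\int[mu]_x (\sum_(k <oo) g k x) < +oo)%E.
  rewrite integral_nneseries//.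
  apply: (@le_lt_trans _ _ (\sum_(k <oo) (2 / (2 ^ k.+1)%:R)%:E)%E); last first.
    by apply: (le_lt_trans (epsilon_trick0 xpredT _)); rewrite ?ltry.
  apply: lee_nneseries => k; first by move=> _ _; exact: integral_ge0.
  move=> _.
  have /L2P[_ dk] := d2 k.
  rewrite (_ : integral _ _ _ = \int[mu]_x ((2 ^+ k)%:E * (nc (d k x) ^+ 2)%:E))%E//.
  rewrite integralZl//.
  rewrite -[X in (_ * X)%E]fineK ?(integrable_fin_num _ dk)// -EFinM lee_fin.
  rewrite -[fine _]/(nsq (d k)).
  have e0 : 0 <= 2 ^+ k :> R by exact: exprn_ge0.
  apply: le_trans (ler_wpM2l e0 (fc k k.+1 (leqnSn k))) _.
  rewrite natrX -exprMn exprS invfM mulrA divff ?mul1r//.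
  rewrite -exprVn le_eqVlt; apply/orP; left; apply/eqP; congr (_ ^+ k).
  by field.
have aeg : {ae mu, forall x, (\sum_(k <oo) g k x < +oo)%E}.
  have Gi : mu.-integrable setT (fun x => \sum_(k <oo) g k x)%E.
    apply/integrableP; split; first exact: ge0_emeasurable_sum.
    by under eq_integral do rewrite gee0_abs ?nneseries_ge0//.
  have := integrable_ae measurableT Gi; apply: filterS => x /(_ I).
  by rewrite fin_numElt => /andP[].
have aec : {ae mu, forall x, cvgn (fun k => complex.Re (f k x)) /\
                             cvgn (fun k => complex.Im (f k x))}.
  apply: filterS aeg => x gx.
  pose b k := 2^-1 ^+ k + 2 ^+ k * nc (d k x) ^+ 2.
  have b1 k : 0 <= 2 ^+ k * nc (d k x) ^+ 2 by have := g0 k x; rewrite lee_fin.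
  have b0 k : 0 <= b k by rewrite addr_ge0// exprn_ge0.
  have cb : cvgn (series b).
    have c1 : cvgn (series (fun k => 2^-1 ^+ k : R)).
      have := @is_cvg_geometric_series R 1 2^-1.
      rewrite ger0_norm// invf_lt1// ltr1n => /(_ isT).
      rewrite (_ : geometric 1 2^-1 = fun k => 2^-1 ^+ k)//.
      by apply/funext => k; rewrite /geometric/= mul1r.
    have c2 : cvgn (series (fun k => 2 ^+ k * nc (d k x) ^+ 2)).
      apply: nondecreasing_is_cvgn.
        by apply/nondecreasing_seqP => k; rewrite seriesSr lerDl.
      exists (fine (\sum_(k <oo) g k x)%E) => _ [k _ <-].
      rewrite -lee_fin fineK; last first.
        by rewrite ge0_fin_numE// nneseries_ge0.
      rewrite seriesEnat/= -sumEFin.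
      by apply: (@nneseries_lim_ge R (fun k => g k x) xpredT 0%N k) => *.
    rewrite (_ : series b = series (fun k => 2^-1 ^+ k) +
        series (fun k => 2 ^+ k * nc (d k x) ^+ 2)); first exact: is_cvgD.
    by apply/funext => k; rewrite !seriesEnat/= fctE big_split.
  have db k : nc (d k x) <= b k.
    have e0 : 0 < 2 ^+ k :> R by exact: exprn_gt0.
    rewrite /b exprVn -(ler_pM2l e0) mulrDr mulfV ?gt_eqF// mulrA -expr2 -exprMn.
    set y := 2 ^+ k * _; have := sqr_ge0 (y - 1); have := sqr_ge0 y; nra.
  by split; apply: (cvgn_fast_cauchy b0 cb) => k; apply: le_trans (db k);
    [have := normr_Re (d k x)|have := normr_Im (d k x)];
    rewrite /d /lc mulN1r ?ReD ?ImD; case: (f k x) => p q /=; rewrite addrC.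
(* The upper limit is measurable on the whole space and equals the limit wherever the sequence
   converges, that is, almost everywhere. *)
pose vr x := fine (limn_esup (fun k => (complex.Re (f k x))%:E)).
pose vi x := fine (limn_esup (fun k => (complex.Im (f k x))%:E)).
pose v x : R[i] := Complex (vr x) (vi x).
have mv : cmeas v.
  by split; apply: measurableT_comp (@fine_measurable _ _ measurableT) _;
    apply: measurable_fun_limn_esup => k; apply/measurable_EFinP; case: (mf k).
have limE (a : nat -> R) : cvgn a -> a @ \oo --> fine (limn_esup (fun k => (a k)%:E)).
  move=> /cvg_ex[l al].
  have al' : (a k)%:E @[k --> \oo] --> l%:E by apply: cvg_EFin; [exact: nearW|exact: al].
  by have [_ ->] := cvg_limn_einf_sup al'.
have aev : {ae mu, forall x, forall m, (nc (lc (-1) (f m) (f k) x) ^+ 2)%:E @[k --> \oo] -->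
    (nc (lc (-1) (f m) v x) ^+ 2)%:E}.
  apply: filterS aec => x [/limE cr /limE ci] m.
  apply: cvg_EFin; first exact: nearW.
  have E k : complex.Re (- f m x + f k x) = complex.Re (f k x) - complex.Re (f m x).
    by rewrite ReD addrC; case: (f m x).
  have E' k : complex.Im (- f m x + f k x) = complex.Im (f k x) - complex.Im (f m x).
    by rewrite ImD addrC; case: (f m x).
  have F : complex.Re (- f m x + v x) = vr x - complex.Re (f m x).
    by rewrite ReD addrC; case: (f m x).
  have F' : complex.Im (- f m x + v x) = vi x - complex.Im (f m x).
    by rewrite ImD addrC; case: (f m x).
  have Hr : complex.Re (f k x) - complex.Re (f m x) @[k --> \oo] -->
      vr x - complex.Re (f m x) by exact: (cvgB cr (cvg_cst _)).
  have Hi : complex.Im (f k x) - complex.Im (f m x) @[k --> \oo] -->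
      vi x - complex.Im (f m x) by exact: (cvgB ci (cvg_cst _)).
  rewrite (_ : _ \o _ = fun k => (complex.Re (f k x) - complex.Re (f m x)) *
    (complex.Re (f k x) - complex.Re (f m x)) + (complex.Im (f k x) -
    complex.Im (f m x)) * (complex.Im (f k x) - complex.Im (f m x))).
    by rewrite sqr_nc /lc mulN1r F// F'// !expr2; exact: (cvgD (cvgM Hr Hr) (cvgM Hi Hi)).
  by apply/funext => k /=; rewrite sqr_nc /lc mulN1r E E' !expr2.
have mlc m (w : fct) : cmeas w -> measurable_fun setT (fun x => nc (lc (-1) (f m) w x) ^+ 2).
  move=> mw; apply: measurable_sqr_nc; apply: cmeasD => //.
  by apply: cmeasM => //; exact: cmeas_cst.
have fv m : (\int[mu]_x (nc (lc (-1) (f m) v x) ^+ 2)%:E <= (4^-1 ^+ m)%:E)%E.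
  (* Shifted by [m], so that every term obeys the Cauchy bound 4^-m when Fatou's lemma is
     applied. *)
  pose h k x := ((nc (lc (-1) (f m) (f (k + m)%N) x) ^+ 2)%:E : \bar R).
  have mh k : measurable_fun setT (h k) by apply/measurable_EFinP; exact: mlc.
  have h0 k x : setT x -> (0 <= h k x)%E by move=> _; rewrite lee_fin sqr_ge0.
  have hv : {ae mu, forall x, h ^~ x @ \oo --> (nc (lc (-1) (f m) v x) ^+ 2)%:E}.
    apply: filterS aev => x /(_ m) H.
    by move: H; rewrite -(cvg_shiftn m).
  have := fatou mu measurableT mh h0.
  rewrite (_ : integral _ _ _ = \int[mu]_x (nc (lc (-1) (f m) v x) ^+ 2)%:E)%E.
    move=> /le_trans; apply; rewrite limn_einf_lim; apply: lime_le.
      exact: is_cvg_einfs.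
    apply: nearW => k; apply: (@le_trans _ _ (\int[mu]_x h k x)%E).
      by apply: ereal_inf_lbound; exists k => /=.
    have /L2P[_ dk] := L2_lc (-1) (f2 m) (f2 (k + m)%N).
    rewrite -[leLHS]fineK ?(integrable_fin_num _ dk)// lee_fin.
    by apply: fc; exact: leq_addl.
  apply: ae_eq_integral => //.
    rewrite (_ : (fun x => _) =
        fun x => (- limn_esup (fun k => - h k x))%E); last first.
      by apply/funext => x; rewrite (limn_esupN (h ^~ x)) oppeK.
    apply: measurableT_comp => //; apply: measurable_fun_limn_esup => k.
    exact: measurableT_comp.
  - by apply/measurable_EFinP; exact: mlc.
  - by apply: filterS hv => x H _; have [-> _] := cvg_limn_einf_sup H.
have v2 : L2 v.
  have d02 : L2 (lc (-1) (f 0%N) v).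
    apply/L2P; split.
      by apply: cmeasD => //; apply: cmeasM => //; exact: cmeas_cst.
    apply/rint_lty; [exact: mlc|by move=> x; exact: sqr_ge0|].
    exact: le_lt_trans (fv 0%N) (ltry _).
  have -> : v = lc 1 (f 0%N) (lc (-1) (f 0%N) v).
    apply/funext => x; have E (a b : R[i]) : b = 1 * a + (-1 * a + b) by ring.
    exact: E.
  exact: L2_lc.
exists v => //; apply/l2cvgE; split=> //.
apply: (@squeeze_cvgr _ _ _ _ (fun=> 0) (fun k => 4^-1 ^+ k)).
- near=> k; rewrite nsq_ge0/= -lee_fin.
  have /L2P[_ dk] := L2_lc (-1) (f2 k) v2.
  by rewrite [(nsq _)%:E]fineK ?(integrable_fin_num _ dk)//; exact: fv.
- exact: cvg_cst.
- have := @cvg_geometric R 1 4^-1; rewrite ger0_norm// invf_lt1// ltr1n => /(_ isT).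
  rewrite (_ : geometric 1 4^-1 = fun k => 4^-1 ^+ k)//.
  by apply/funext => k; rewrite /geometric/= mul1r.
Unshelve. all: by end_near. Qed.
End riesz_fischer.

(** * Choosing images of operators given by graphs *)

Section selector.
Context {R : realType} {n : nat}.
Notation fct := ('rV[R]_n -> R[i]).
Implicit Types (S : @op R n) (u v w : fct).

(** A graph determines images up to null sets only; a representative is chosen, with the zero
    function as default outside the domain. *)
Definition opfun S u : fct := xget (fun=> 0) [set v | S u v].

Lemma opfunP S u : (exists v, S u v) -> S u (opfun S u).
Proof. by move=> h; exact: (xgetPex (fun=> 0) h). Qed.

Variable S : @op R n.
Hypotheses (Slin : linear_op S) (Sall : everywhere_defined S).

Lemma opfunE u : L2 u -> S u (opfun S u).
Proof. by move=> u2; apply: opfunP; exact: Sall. Qed.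

Lemma opfun_L2 u : L2 u -> L2 (opfun S u).
Proof. by move=> u2; have [/(_ _ _ (opfunE u2))[]] := Slin. Qed.

Lemma op_L2 u v : S u v -> L2 u /\ L2 v.
Proof. by have [+ _ _ _ _] := Slin => /[apply]. Qed.

Lemma opfun_aeq u v : S u v -> aeq (opfun S u) v.
Proof.
move=> uv; have [u2 _] := op_L2 uv.
by have [_ _ + _ _] := Slin => /(_ _ _ _ (opfunE u2) uv).
Qed.

Lemma op_aeq u v u' v' : S u v -> L2 u' -> L2 v' -> aeq u u' -> aeq v v' -> S u' v'.
Proof. by have [_ H _ _ _] := Slin; exact: H. Qed.

Lemma op_lc a u v u' v' : S u v -> S u' v' -> S (lc a u u') (lc a v v').
Proof. by have [_ _ _ _ H] := Slin; exact: H. Qed.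

Lemma opfun_lc a u v : L2 u -> L2 v ->
  aeq (opfun S (lc a u v)) (lc a (opfun S u) (opfun S v)).
Proof. by move=> u2 v2; apply: opfun_aeq; apply: op_lc; exact: opfunE. Qed.

Lemma inner_op u v w : S u v -> L2 w -> inner v w = inner (opfun S u) w.
Proof.
move=> uv w2; have [u2 v2] := op_L2 uv.
by apply: inner_aeq => //; [exact: opfun_L2|exact/aeq_sym/opfun_aeq|exact: aeq_refl].
Qed.

Lemma nsq_op u v : S u v -> nsq v = nsq (opfun S u).
Proof.
move=> uv; have [u2 v2] := op_L2 uv.
by apply: nsq_aeq => //; [exact: opfun_L2|exact/aeq_sym/opfun_aeq].
Qed.

End selector.

(** * Spectral projections and quadratic forms *)

Section spectral_projections.
Context {R : realType} {n : nat}.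
Notation fct := ('rV[R]_n -> R[i]).
Implicit Types (u v w : fct) (B C : set R).
Variable E : set R -> @op R n.
Hypothesis hE : spectral_measure E.

Definition proj B := opfun (E B).

Let EP B : measurable B -> orthogonal_projection (E B).
Proof. by case: hE => + _ _ _; apply. Qed.

Lemma proj_linear B : measurable B -> linear_op (E B).
Proof. by move=> /EP[]. Qed.

Lemma proj_all B : measurable B -> everywhere_defined (E B).
Proof. by move=> /EP[]. Qed.

Lemma projE B u : measurable B -> L2 u -> E B u (proj B u).
Proof. by move=> mB u2; apply: opfunE => //; exact: proj_all. Qed.

Lemma proj_L2 B u : measurable B -> L2 u -> L2 (proj B u).
Proof. by move=> mB u2; apply: opfun_L2 => //; [exact: proj_linear|exact: proj_all]. Qed.

Lemma proj_proj B u : measurable B -> L2 u -> E B (proj B u) (proj B u).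
Proof. by move=> mB u2; have [_ _ _ H] := EP mB; apply: H (projE mB u2). Qed.

Lemma proj_sym B u w : measurable B -> L2 u -> L2 w ->
  inner (proj B u) w = inner u (proj B w).
Proof.
move=> mB u2 w2; have [_ _ [_ sa] _] := EP mB.
by have [_ _ /(_ _ _ (projE mB u2))] := (sa _ _).1 (projE mB w2).
Qed.

Lemma proj_mul B C u : measurable B -> measurable C -> L2 u ->
  aeq (proj (B `&` C) u) (proj B (proj C u)).
Proof.
move=> mB mC u2; have [_ _ H _] := hE.
apply: opfun_aeq; [exact/proj_linear/measurableI|exact/proj_all/measurableI|].
apply/(H _ _ mB mC); exists (proj C u); first exact: projE.
by apply: projE => //; exact: proj_L2.
Qed.

Lemma inner_projproj B C u w : measurable B -> measurable C -> L2 u -> L2 w ->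
  inner (proj B u) (proj C w) = inner (proj (C `&` B) u) w.
Proof.
move=> mB mC u2 w2; rewrite -proj_sym//; last exact: proj_L2.
apply: inner_aeq => //.
- by do 2![apply: proj_L2 => //].
- by apply: proj_L2 => //; exact: measurableI.
- exact/aeq_sym/proj_mul.
- exact: aeq_refl.
Qed.

Lemma proj_self B u : measurable B -> L2 u ->
  inner (proj B u) u = (nsq (proj B u))%:C%C.
Proof.
by move=> mB u2; rewrite -inner_self inner_projproj// setIid.
Qed.

Lemma spectral_form_ex u : L2 u -> exists mu : {measure set R -> \bar R},
  spectral_form E u mu /\ forall B, measurable B -> mu B = (nsq (proj B u))%:E.
Proof.
move=> u2; have [_ _ _ /(_ _ u2)[mu hmu]] := hE; exists mu; split=> // B mB.
by rewrite (hmu B mB _ (projE mB u2)) proj_self.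
Qed.

(** For an orthogonal projection, |E u - u|^2 = |u|^2 - |E u|^2. *)
Lemma proj_fix B u : measurable B -> L2 u -> nsq (proj B u) = nsq u -> E B u u.
Proof.
move=> mB u2 h; apply: (op_aeq (proj_linear mB) (projE mB u2) u2 u2).
  exact: aeq_refl.
have p2 := proj_L2 mB u2.
apply: nsq_sub_aeq => //; rewrite nsq_sub// proj_self//= h; ring.
Qed.

Lemma fix_proj B u : measurable B -> E B u u -> aeq (proj B u) u.
Proof. by move=> mB; apply: opfun_aeq; [exact: proj_linear|exact: proj_all]. Qed.

Lemma projT u : L2 u -> nsq (proj setT u) = nsq u.
Proof.
move=> u2; have [_ /(_ _ u2) h _ _] := hE.
by apply: nsq_aeq => //; [exact: proj_L2|exact: fix_proj].
Qed.

Lemma proj0 u : L2 u -> nsq (proj set0 u) = 0.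
Proof.
move=> u2; have [mu [_ h]] := spectral_form_ex u2.
by have := h _ measurable0; rewrite measure0 => -[].
Qed.

Lemma nsq_projI B C u : measurable B -> measurable C -> L2 u -> E B u u ->
  nsq (proj (C `&` B) u) = nsq (proj C u).
Proof.
move=> mB mC u2 Bu; have p2 := proj_L2 mB u2.
have := inner_projproj mB mC u2 u2.
rewrite proj_self; [|exact: measurableI|by []].
rewrite (@inner_aeq _ _ _ u _ (proj C u))//; last 4 first.
- exact: proj_L2.
- exact: proj_L2.
- exact: fix_proj.
- exact: aeq_refl.
by rewrite -proj_sym// proj_self// => -[].
Qed.

Lemma inner_proj_fix B C u w : measurable B -> measurable C -> L2 u -> L2 w ->
  E B u u -> inner (proj C w) u = inner (proj (B `&` C) w) u.
Proof.
move=> mB mC u2 w2 Bu; rewrite -inner_projproj//.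
apply: inner_aeq => //; try exact: proj_L2.
  exact: aeq_refl.
exact/aeq_sym/fix_proj.
Qed.

Lemma inner_proj0 u w : L2 u -> L2 w -> inner (proj set0 w) u = 0.
Proof.
move=> u2 w2; have := cauchy_schwarz (proj_L2 measurable0 w2) u2.
rewrite proj0// mul0r => h; apply/eqP; rewrite -nc_eq0 -sqrf_eq0 eq_le h.
exact: sqr_ge0.
Qed.

(** On the range of the projection at [l], the projection of [C] acts as the identity or as zero,
    according to whether [C] contains [l]. Orthogonality to an eigenvector therefore survives
    projecting. *)
Lemma inner_proj_eigen l C u w : measurable C -> L2 u -> L2 w -> E [set l] u u ->
  inner w u = 0 -> inner (proj C w) u = 0.
Proof.
move=> mC u2 w2 lu wu; rewrite (inner_proj_fix _ mC u2 w2 lu)//.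
have [lC|lC] := pselect (C l).
  rewrite (_ : _ `&` _ = [set l]); last by apply/seteqP; split => [x []|x ->].
  rewrite proj_sym// -wu; apply: inner_aeq => //; first exact: proj_L2.
    exact: aeq_refl.
  exact: fix_proj.
rewrite (_ : _ `&` _ = set0); first exact: inner_proj0.
by apply/seteqP; split => // x [/= ->].
Qed.

Variables (f : R -> R) (S : @op R n).
Hypotheses (mf : measurable_fun setT f) (hS : spectral_integral E f S).

(** The scalar measure of [u] is carried by [B] and has total mass [nsq u]. Boundedness of f^2 on
    [B] puts [u] in the domain, and the form is the integral of [f] against that measure. *)
Lemma spectral_integral_between B u (a b : R) : measurable B -> L2 u -> E B u u ->
  a <= b -> (forall t, B t -> a <= f t <= b) ->
  exists v, [/\ S u v, inner v u = (complex.Re (inner v u))%:C%C,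
    a * nsq u <= complex.Re (inner v u) & complex.Re (inner v u) <= b * nsq u].
Proof.
move=> mB u2 Bu ab fab; have [mu [hmu muE]] := spectral_form_ex u2.
have [Slin /(_ u mu u2 hmu)[dom quad]] := hS.
have muT : mu setT = (nsq u)%:E by rewrite muE// projT.
have muB : mu (~` B) = 0%E.
  by rewrite muE ?(nsq_projI mB _ u2 Bu)//= -?(nsq_projI mB (measurableC mB) u2 Bu) ?setICl ?proj0//; exact: measurableC.
have [_ h1 h2] := Rintegral_between muT mf mB muB ab fab.
have f2 : rint mu (fun t => f t ^+ 2).
  have [] // := @Rintegral_between _ mu _ (fun t => f t ^+ 2) B 0 (a ^+ 2 + b ^+ 2) muT _ mB muB.
  - exact: measurable_funX.
  - by rewrite addr_ge0 ?sqr_ge0.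
  - move=> t /fab/andP[h3 h4]; rewrite sqr_ge0/=.
    have := sqr_ge0 a; have := sqr_ge0 b.
    have [t0|t0] := leP 0 (f t); nra.
have f2oo : (\int[mu]_t ((f t) ^+ 2)%:E < +oo)%E.
  by apply/rint_lty => //; [exact: measurable_funX|move=> x; exact: sqr_ge0].
have [v uv] := dom.2 f2oo.
by exists v; rewrite (quad v uv)/=; split.
Qed.

End spectral_projections.

(** * An eigenbasis from the counting bound *)

Section eigenbasis.
Context {R : realType} {n : nat}.
Notation fct := ('rV[R]_n -> R[i]).
Implicit Types (u v w : fct) (B C : set R).
Variables (E : set R -> @op R n) (T : @op R n) (K p0 : R).
Hypothesis hE : spectral_measure E.
Hypothesis hT : spectral_integral E id T.
Hypothesis hT1 : forall u v, T u v -> nsq u <= complex.Re (inner v u).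
Hypothesis hcount : forall N (f : nat -> fct) (lam : R), 1 <= lam ->
  (forall i, (i < N)%N -> exists v, T (f i) v /\ complex.Re (inner v (f i)) <= lam) ->
  (forall i j, (i < N)%N -> (j < N)%N -> inner (f i) (f j) = (i == j)%:R) ->
  N%:R <= K * lam `^ p0.
Hypothesis infdim : forall s : seq fct, (forall i, (i < size s)%N -> L2 (nth (fun=> 0) s i)) ->
  exists w, [/\ L2 w, nsq w != 0 & forall i, (i < size s)%N -> inner w (nth (fun=> 0) s i) = 0].

Let m_id : measurable_fun setT (id : R -> R).
Proof. exact: measurable_id. Qed.

Lemma energy_fix u (a b : R) B : measurable B -> L2 u -> E B u u -> a <= b ->
  B `<=` `[a, b]%classic ->
  exists v, T u v /\ complex.Re (inner v u) <= b * nsq u.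
Proof.
move=> mB u2 Bu ab Bab.
have [|v [uv _ _ h]] := spectral_integral_between hE m_id hT mB u2 Bu ab.
  by move=> t /Bab; rewrite /= in_itv.
by exists v.
Qed.

(** A vector carried by [-k, 1 - 1/(k+1)] has energy at most (1 - 1/(k+1)) |u|^2, which contradicts
    [hT1] unless it is null. These bounded intervals exhaust the half line below 1. *)
Lemma proj_lt1 u : L2 u -> nsq (proj E `]-oo, 1[ u) = 0.
Proof.
move=> u2; have [mu [_ muE]] := spectral_form_ex hE u2.
suff : mu `]-oo, 1[%classic = 0%E by rewrite muE// => -[].
have -> : `]-oo, 1[%classic = \bigcup_k `[- k%:R, 1 - k.+1%:R^-1]%classic :> set R.
  apply/seteqP; split => [x /=|x [k _] /=]; rewrite !in_itv/=.
    move=> x1; have [k1 hk1] := ltr_add_invr x1.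
    pose k := maxn k1 (Num.truncn `|x|).+1; exists k => //=; rewrite in_itv/=.
    apply/andP; split.
      rewrite lerNl (le_trans (ler_norm _))// normrN.
      apply: ltW; apply: lt_le_trans (truncnS_gt _) _.
      by rewrite ler_nat leq_max leqnn orbT.
    rewrite lerBrDr; apply: ltW; apply: le_lt_trans hk1.
    by rewrite lerD2l lef_pV2 ?posrE ?ltr0n// ler_nat ltnS leq_max leqnn.
  move=> /andP[_ h]; apply: (le_lt_trans h).
  by rewrite ltrBlDr ltrDl invr_gt0 ltr0n.
apply: measure_bigcup_null => // k.
set B := `[_, _]%classic; have mB : measurable B by exact: measurable_itv.
rewrite muE//; congr EFin; apply/eqP; rewrite eq_le nsq_ge0 andbT.
have ab : - k%:R <= 1 - k.+1%:R^-1 :> R.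
  apply: (@le_trans _ _ 0); first by rewrite oppr_le0 ler0n.
  by rewrite subr_ge0 invf_le1 ?ltr0n// ler1n.
have [v [Tv le]] := energy_fix mB (proj_L2 hE mB u2) (proj_proj hE mB u2) ab (@subset_refl _ B).
have kp : 0 < k.+1%:R^-1 :> R by rewrite invr_gt0 ltr0n.
move: kp (le_trans (hT1 Tv) le); move: (_^-1) (nsq _) => c N c0.
by rewrite mulrBl mul1r lerBrDr gerDl pmulr_rle0.
Qed.

Lemma proj_ge1 u B : measurable B -> L2 u ->
  nsq (proj E (B `&` `[1, +oo[) u) = nsq (proj E B u).
Proof.
move=> mB u2; have [mu [_ muE]] := spectral_form_ex hE u2.
have mI : measurable (B `&` `[1, +oo[%classic) by exact: measurableI.
have mI' : measurable (B `&` `]-oo, 1[%classic) by exact: measurableI.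
suff : mu B = mu (B `&` `[1, +oo[%classic) by rewrite !muE// => -[].
have := @measureU _ _ _ mu _ _ mI mI'; rewrite -setIUr.
rewrite (_ : _ `|` _ = setT) ?setIT; last first.
  apply/seteqP; split => // x _ /=; rewrite !in_itv/= andbT.
  by have [|] := leP 1 x; [left|right].
move=> ->; last first.
  apply/seteqP; split => // x [[_ /=] + [_ /=]]; rewrite !in_itv/= andbT.
  by move=> h /(le_lt_trans h); rewrite ltxx.
rewrite [X in (_ + X)%E](_ : _ = 0%E) ?adde0//.
apply/eqP; rewrite eq_le measure_ge0 andbT.
apply: (@le_trans _ _ (mu `]-oo, 1[%classic)).
  by apply: le_measure; rewrite ?inE.
by rewrite muE// proj_lt1.
Qed.

(** Eigenvectors are described through an atom of the spectral measure, so that the projections act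
    on them directly. *)
Definition eigenpair u (l : R) := L2 u /\ E [set l] u u.

Lemma nsq_normalize u : L2 u -> nsq u != 0 ->
  let c := ((Num.sqrt (nsq u))^-1)%:C%C in
  L2 (lc c u (fun=> 0)) /\ nsq (lc c u (fun=> 0)) = 1.
Proof.
move=> u2 u0 c; split; first exact: L2_lc u2 L2_0.
rewrite nsq_lc//; last exact: L2_0.
rewrite nc_real real_normK ?num_real// exprVn sqr_sqrtr ?nsq_ge0// mulVf//.
by rewrite inner0r// nsq0 mulr0 /= mulr0 !addr0.
Qed.

(* Orthonormal families below a given energy have bounded size, so the spectral
   measure of [w] on [m, m+1) cannot be split indefinitely and has an atom. *)
Lemma eigenpair_exists (S : fct -> R -> Prop) w (m : nat) :
  (forall u l, S u l -> eigenpair u l /\ inner w u = 0) -> L2 w ->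
  nsq (proj E `[m%:R, m.+1%:R[ w) != 0 ->
  exists u l, [/\ eigenpair u l, nsq u = 1, m%:R <= l < m.+1%:R &
    forall v k, S v k -> inner u v = 0].
Proof.
move=> Sw w2 w0; have [mu [_ muE]] := spectral_form_ex hE w2.
have mm : m%:R < m.+1%:R :> R by rewrite ltr_nat.
have mpos : (0 < mu `[m%:R, m.+1%:R[%classic)%E.
  by rewrite muE// lte_fin lt_neqAle eq_sym w0 nsq_ge0.
have lam1 : 1 <= m.+1%:R :> R by rewrite ler1n.
(* One more than the counting bound allows for orthonormal vectors of energy at most m + 1. *)
pose M := (Num.truncn (K * m.+1%:R `^ p0)).+1.
have [[l lm ml]|[F [mF Fs F0 Fd]]] := atom_or_many M mm mpos.
  have ml1 : measurable [set l] by exact: measurable_set1.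
  rewrite muE// lte_fin in ml; have p2 := proj_L2 hE ml1 w2.
  have [n2 n1] := nsq_normalize p2 (lt0r_neq0 ml).
  set c := (_%:C)%C in n2 n1.
  (* The normalised projection of [w] on the atom inherits the orthogonality of [w] to the vectors
     of [S]. *)
  exists (lc c (proj E [set l] w) (fun=> 0)), l; split => //.
    split => //; apply: (op_lc (proj_linear hE ml1)); first exact: proj_proj.
    by have [_ _ _ H _] := proj_linear hE ml1.
  move=> v k vk; have [[v2 kv] wv] := Sw v k vk.
  rewrite inner_lcl//; last exact: L2_0.
  rewrite (inner_proj_eigen hE ml1 v2 w2 kv wv) mulr0 add0r.
  exact: inner0l.
exfalso; have p2 i : L2 (proj E (F i) w) by exact: proj_L2.
have pn0 i : (i < M)%N -> nsq (proj E (F i) w) != 0.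
  by move=> /F0; rewrite muE// lte_fin => /lt0r_neq0.
pose c i : R[i] := ((Num.sqrt (nsq (proj E (F i) w)))^-1)%:C%C.
pose g i := lc (c i) (proj E (F i) w) (fun=> 0).
have g2 i : L2 (g i) by exact: L2_lc (p2 i) L2_0.
have := @hcount M g m.+1%:R lam1.
have H1 i : (i < M)%N -> exists v, T (g i) v /\ complex.Re (inner v (g i)) <= m.+1%:R.
  move=> iM; have [_ n1] := nsq_normalize (p2 i) (pn0 i iM).
  have gi : E (F i) (g i) (g i).
    apply: (op_lc (proj_linear hE (mF i))); first exact: proj_proj.
    by have [_ _ _ H _] := proj_linear hE (mF i).
  have [|v [Tv le]] := energy_fix (mF i) (g2 i) gi (ltW mm).
    by move=> x /Fs /=; rewrite !in_itv/= => /andP[-> /ltW].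
  by exists v; split => //; rewrite (le_trans le)// n1 mulr1.
have H2 i j : (i < M)%N -> (j < M)%N -> inner (g i) (g j) = (i == j)%:R.
  move=> iM jM; have [<-|ij] := eqVneq i j.
    rewrite inner_self; have [_ n1] := nsq_normalize (p2 i) (pn0 i iM).
    by rewrite -[nsq _]/(nsq (lc (c i) _ _)) n1.
  rewrite inner_lcl//; last exact: L2_0.
  rewrite inner0l// addr0 inner_lcr//; last exact: L2_0.
  rewrite inner0r// addr0 inner_projproj// Fd 1?eq_sym// inner_proj0//.
  by rewrite !mulr0.
move=> /(_ H1 H2); rewrite leNgt => /negP; apply.
exact: truncnS_gt.
Qed.

Let d0 : fct * R := (fun=> 0, 0).

Definition perp_list (s : seq (fct * R)) u : Prop :=
  forall i, (i < size s)%N -> inner u (nth d0 s i).1 = 0.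

Definition admissible (s : seq (fct * R)) (p : fct * R) : Prop :=
  [/\ eigenpair p.1 p.2, nsq p.1 = 1, 1 <= p.2 & perp_list s p.1].

(** Only the integer part is minimised: an infimum of eigenvalues would first have to be shown
    attained, while natural numbers always have a least element. The eigenvalues come out sorted up
    to an error below 1. *)
Definition next_pair (s : seq (fct * R)) (p : fct * R) : Prop :=
  admissible s p /\
  forall p', admissible s p' -> (Num.truncn p.2 <= Num.truncn p'.2)%N.

Definition eigenlist (s : seq (fct * R)) : Prop :=
  forall i, (i < size s)%N -> eigenpair (nth d0 s i).1 (nth d0 s i).2.

Lemma admissible_from s w m : eigenlist s -> L2 w -> perp_list s w ->
  nsq (proj E `[m%:R, m.+1%:R[ w) != 0 ->
  exists p, admissible s p /\ Num.truncn p.2 = m.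
Proof.
move=> es w2 ws w0.
pose S u l := exists2 i, (i < size s)%N & (u, l) = nth d0 s i.
have [|u [l [ul u1 lm uS]]] := @eigenpair_exists S w m _ w2 w0.
  by move=> u l [i si ulE]; have := es i si; have := ws i si; rewrite -ulE.
exists (u, l); split; last exact: truncn_def lm.
split => //=; last first.
  move=> i si; have := uS (nth d0 s i).1 (nth d0 s i).2; apply.
  by exists i => //; rewrite -surjective_pairing.
rewrite leNgt; apply/negP => l1; have [u2 lu] := ul.
have := proj_lt1 u2; rewrite -(nsq_projI hE _ _ u2 lu)//.
rewrite (_ : _ `&` _ = [set l]).
  rewrite (nsq_aeq _ u2 (fix_proj hE (measurable_set1 l) lu)) ?u1; last exact: proj_L2.
  by move/eqP; rewrite oner_eq0.
by apply/seteqP; split => [x [_ ->]//|x /= ->]; split => //=; rewrite ?in_itv.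
Qed.

Lemma positive_window u : L2 u -> nsq u != 0 ->
  exists m, nsq (proj E `[m%:R, m.+1%:R[ u) != 0.
Proof.
move=> u2; apply: contraPP => /forallNP H.
have [mu [_ muE]] := spectral_form_ex hE u2.
apply/negP; rewrite negbK -(projT hE u2) -(proj_ge1 measurableT u2) setTI.
suff : mu `[1, +oo[%classic = 0%E by rewrite muE// => -[->].
apply/eqP; rewrite eq_le measure_ge0 andbT.
pose F m : set R := `[m%:R, m.+1%:R[%classic.
have mF m : measurable (F m) by exact: measurable_itv.
have <- : mu (\bigcup_m F m) = 0%E.
  apply: measure_bigcup_null => // m; rewrite muE//; congr EFin.
  by have /negP := H m; rewrite negbK => /eqP.
apply: le_measure; rewrite ?inE//; first by apply: bigcup_measurable.
move=> x /=; rewrite in_itv/= andbT => x1; exists (Num.truncn x) => //=.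
by rewrite /F /= in_itv/= truncn_le truncnS_gt (le_trans _ x1).
Qed.

Lemma next_pair_exists s : eigenlist s -> exists p, next_pair s p.
Proof.
move=> es.
pose P m := `[< exists p, admissible s p /\ Num.truncn p.2 = m >].
have exP : exists m, P m.
  have [i|w [w2 w0 ws]] := @infdim (map fst s).
    by rewrite size_map => si; rewrite (nth_map d0)//; have [] := es i si.
  have [m wm] := positive_window w2 w0.
  exists m; apply/asboolP; apply: (admissible_from es w2 _ wm) => i si.
  by have := ws i; rewrite size_map (nth_map d0)//; apply.
have [m /asboolP[p [ap pm]] mmin] := ex_minnP exP.
exists p; split => // p' ap'; rewrite pm; apply: mmin; apply/asboolP.
by exists p'.
Qed.

Definition next s := xget d0 [set p | next_pair s p].

Lemma nextP s : eigenlist s -> next_pair s (next s).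
Proof. by move=> /next_pair_exists h; exact: (xgetPex d0 h). Qed.

Fixpoint eigenseq k : seq (fct * R) :=
  if k is k'.+1 then rcons (eigenseq k') (next (eigenseq k')) else [::].

Definition eigenvec k : fct := (next (eigenseq k)).1.
Definition eigenval k : R := (next (eigenseq k)).2.

Lemma size_eigenseq k : size (eigenseq k) = k.
Proof. by elim: k => //= k IHk; rewrite size_rcons IHk. Qed.

Lemma nth_eigenseq k j : (j < k)%N -> nth d0 (eigenseq k) j = next (eigenseq j).
Proof.
elim: k => // k IHk; rewrite ltnS leq_eqVlt /= nth_rcons size_eigenseq.
by case/predU1P => [->|jk]; [rewrite ltnn eqxx|rewrite jk IHk].
Qed.

Lemma eigenlist_eigenseq k : eigenlist (eigenseq k).
Proof.
elim: k => [[]//|k IHk] i; rewrite size_eigenseq ltnS leq_eqVlt.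
case/predU1P => [->|ik].
  rewrite nth_eigenseq//.
  by have [[]] := nextP IHk.
by rewrite nth_eigenseq 1?ltnW//= -(nth_eigenseq ik); apply: IHk; rewrite size_eigenseq.
Qed.

Lemma next_eigenseq k : next_pair (eigenseq k) (next (eigenseq k)).
Proof. exact/nextP/eigenlist_eigenseq. Qed.

Lemma eigenvecP k : [/\ L2 (eigenvec k), E [set eigenval k] (eigenvec k) (eigenvec k),
  nsq (eigenvec k) = 1 & 1 <= eigenval k].
Proof. by have [[[? ?] ? ? _] _] := next_eigenseq k. Qed.

Lemma eigenvec_orth j k : inner (eigenvec j) (eigenvec k) = (j == k)%:R.
Proof.
wlog jk : j k / (j <= k)%N.
  move=> H; have [|kj] := leqP j k; first exact: H.
  have [j2 _ _ _] := eigenvecP j; have [k2 _ _ _] := eigenvecP k.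
  rewrite (inner_conj k2 j2) H 1?ltnW// eq_sym.
  by case: (_ == _); [exact: rmorph1|exact: rmorph0].
have [j2 _ j1 _] := eigenvecP j; have [k2 _ _ _] := eigenvecP k.
have [<-|jk'] := eqVneq j k; first by rewrite inner_self j1.
rewrite (inner_conj k2 j2); have [[_ _ _ p] _] := next_eigenseq k.
have jk1 : (j < k)%N by rewrite ltn_neqAle jk'.
have := p j; rewrite size_eigenseq nth_eigenseq// => /(_ jk1).
rewrite -/(eigenvec j) -/(eigenvec k) => ->; exact: rmorph0.
Qed.

Lemma eigenval_min k p : admissible (eigenseq k) p ->
  (Num.truncn (eigenval k) <= Num.truncn p.2)%N.
Proof. by have [_] := next_eigenseq k; apply. Qed.

Lemma truncn_eigenval_mono j k : (j <= k)%N ->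
  (Num.truncn (eigenval j) <= Num.truncn (eigenval k))%N.
Proof.
move=> jk; apply: (@eigenval_min j (next (eigenseq k))).
have [[p1 p2 p3 p4] _] := next_eigenseq k; split => // i; rewrite size_eigenseq => ij.
have ik := leq_trans ij jk.
by rewrite nth_eigenseq// -(nth_eigenseq ik); apply: p4; rewrite size_eigenseq.
Qed.

Lemma eigenval_energy k : exists v, T (eigenvec k) v /\
  complex.Re (inner v (eigenvec k)) <= eigenval k.
Proof.
have [k2 kk k1 _] := eigenvecP k.
have [|v [Tv le]] := energy_fix (measurable_set1 _) k2 kk (lexx (eigenval k)).
  by move=> x /= ->; rewrite in_itv/= lexx.
by exists v; rewrite k1 mulr1 in le.
Qed.

(** The first k + 1 eigenvalues t_i satisfy t_i < floor(t_i) + 1 <= floor(t_k) + 1 <= 2 t_k, the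
    last step because t_k >= 1. The counting bound then applies at energy 2 t_k. *)
Lemma eigenval_count k : k.+1%:R <= K * (2 * eigenval k) `^ p0.
Proof.
have [_ _ _ k1] := eigenvecP k; apply: (@hcount _ eigenvec).
- by lra.
- move=> i ik; have [v [Tv le]] := eigenval_energy i; exists v; split => //.
  apply: le_trans le _; apply: ltW; apply: lt_le_trans (truncnS_gt _) _.
  apply: (@le_trans _ _ (Num.truncn (eigenval k)).+1%:R).
    by rewrite ler_nat ltnS truncn_eigenval_mono.
  have tk : (Num.truncn (eigenval k))%:R <= eigenval k.
    by rewrite truncn_le (le_trans _ k1).
  by rewrite -natr1; lra.
- by move=> i j _ _; exact: eigenvec_orth.
Qed.

(** Mass of [w] in such a window would produce an admissible pair of integer part [m], against the
    minimality of the choice made at stage [J]. *)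
Lemma low_window J w m : L2 w -> (forall j, (j < J)%N -> inner w (eigenvec j) = 0) ->
  (m < Num.truncn (eigenval J))%N -> nsq (proj E `[m%:R, m.+1%:R[ w) = 0.
Proof.
move=> w2 wJ mJ; apply/eqP; apply: contraTT mJ => wm.
have [|p [ap <-]] := admissible_from (@eigenlist_eigenseq J) w2 _ wm.
  move=> i; rewrite size_eigenseq => iJ.
  by rewrite nth_eigenseq//; exact: wJ.
by rewrite -leqNgt; exact: eigenval_min.
Qed.

Hypothesis p0_gt0 : 0 < p0.

(** If all integer parts were at most [m], [eigenval_count] would bound every index. *)
Lemma eigenval_unbounded m : exists J, (m < Num.truncn (eigenval J))%N.
Proof.
apply: contrapT => /forallNP H.
have Jm J : (Num.truncn (eigenval J) <= m)%N by have /negP := H J; rewrite -leqNgt.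
pose N := Num.truncn (`|K| * (2 * m.+1%:R) `^ p0).
have := eigenval_count N; rewrite leNgt => /negP; apply.
apply: le_lt_trans (truncnS_gt _); have [_ _ _ k1] := eigenvecP N.
apply: le_trans (ler_wpM2r (powR_ge0 _ _) (ler_norm K)) _.
rewrite ler_wpM2l//; apply: ge0_ler_powR.
- exact: ltW.
- by rewrite nnegrE mulr_ge0// (le_trans _ k1).
- by rewrite nnegrE mulr_ge0.
rewrite ler_pM2l//; apply: ltW; apply: lt_le_trans (truncnS_gt _) _.
by rewrite ler_nat ltnS.
Qed.

(** A nonzero [u] has mass in some window [m, m+1[; once the eigenvalues have passed [m],
    orthogonality contradicts [low_window]. *)
Lemma eigenvec_complete u : L2 u -> (forall k, inner u (eigenvec k) = 0) ->
  aeq u (fun=> 0).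
Proof.
move=> u2 uk; apply: nsq0_aeq => //; apply/eqP; apply: contrapT => /negP u0.
have [m] := positive_window u2 u0; have [J mJ] := eigenval_unbounded m.
by rewrite (low_window u2 _ mJ) ?eqxx// => j _; exact: uk.
Qed.

End eigenbasis.

Lemma is_cvg_powR_series (R : realType) (p : R) : 1 < p ->
  cvgn (series (fun k => k.+1%:R `^ (- p) : R)).
Proof.
move=> p1; pose f (t : R) := ((1 + `|t|) `^ (- p))%:E.
have mf D : measurable D -> measurable_fun D f.
  move=> mD; apply/measurable_EFinP; apply: measurable_funTS.
  exact: continuous_measurable_fun (@powR_decay_continuous R p).
have f0 t : (0 <= f t)%E by rewrite lee_fin powR_ge0.
(* Integral test: on [N, N + 1[ the integrand is at least (N + 2)^-p, so the comparison starts with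
   the second term of the series. The first term, equal to 1, is added to the final bound. *)
have H N : ((\sum_(k < N) k.+2%:R `^ (- p))%:E <=
    \int[lebesgue_measure]_(t in `[0%R, N%:R[) f t)%E.
  elim: N => [|N IHN]; first by rewrite big_ord0 integral_ge0.
  rewrite big_ord_recr EFinD /=.
  rewrite (_ : `[0, N.+1%:R[%classic = `[0, N%:R[%classic `|` `[N%:R, N.+1%:R[%classic); last first.
    by rewrite (@itv_bndbnd_setU _ _ _ (BLeft N%:R))// bnd_simp ?ler0n// ler_nat.
  rewrite ge0_integral_setU//; last 2 first.
  - by apply: mf; exact: measurableU.
  - apply/disj_set2P/seteqP; split => // x [/=]; rewrite !in_itv/=.
    by move=> /andP[_ xN] /andP[]; rewrite leNgt xN.
  rewrite leeD//.
  apply: (@le_trans _ _ (\int[lebesgue_measure]_(t in `[N%:R, N.+1%:R[) (N.+2%:R `^ (- p))%:E)%E).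
    rewrite integral_cst//.
    rewrite [X in (_ * X)%E](lebesgue_measure_itv `[N%:R, N.+1%:R[)/= lte_fin ltr_nat leqnn -EFinB.
    by rewrite -(natr1 N) addrAC subrr add0r mule1.
  apply: ge0_le_integral => //; first exact: mf.
  move=> t; rewrite /= in_itv/= => /andP[Nt tN]; rewrite lee_fin !powRN.
  have t0 : 0 <= t by apply: le_trans Nt; rewrite ler0n.
  have t1 : 0 < 1 + `|t| by rewrite ltr_pwDl.
  rewrite lef_pV2 ?posrE ?powR_gt0//.
  apply: ge0_ler_powR; rewrite ?nnegrE ?(ltW t1)//; first by lra.
  by rewrite ger0_norm// -(natr1 N.+1) addrC lerD2r ltW.
have fin : (\int[lebesgue_measure]_t f t < +oo)%E by exact: integral_powR_decay.
have fin' : (\int[lebesgue_measure]_t f t \is a fin_num)%E.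
  by rewrite ge0_fin_numE// integral_ge0.
apply: nondecreasing_is_cvgn.
  by apply/nondecreasing_seqP => k; rewrite seriesSr lerDl powR_ge0.
exists (1 + fine (\int[lebesgue_measure]_t f t)) => _ [N _ <-].
apply: (@le_trans _ _ (\sum_(k < N.+1) k.+1%:R `^ (- p))).
  by rewrite seriesEord/= big_ord_recr/= lerDl powR_ge0.
rewrite big_ord_recl/= powR1 lerD2l -lee_fin fineK//.
apply: (le_trans (H N)); apply: ge0_subset_integral => //.
exact: mf.
Qed.

(** * Negative powers: compactness and singular values *)

Section schatten_power.
Context {R : realType} {n : nat}.
Notation fct := ('rV[R]_n -> R[i]).
Implicit Types (u v w : fct) (B C : set R).
Variables (E : set R -> @op R n) (T P : @op R n) (K p0 nu r : R).
Hypothesis hE : spectral_measure E.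
Hypothesis hT : spectral_integral E id T.
Hypothesis hT1 : forall u v, T u v -> nsq u <= complex.Re (inner v u).
Hypothesis hcount : forall N (f : nat -> fct) (lam : R), 1 <= lam ->
  (forall i, (i < N)%N -> exists v, T (f i) v /\ complex.Re (inner v (f i)) <= lam) ->
  (forall i j, (i < N)%N -> (j < N)%N -> inner (f i) (f j) = (i == j)%:R) ->
  N%:R <= K * lam `^ p0.
Hypothesis infdim : forall s : seq fct, (forall i, (i < size s)%N -> L2 (nth (fun=> 0) s i)) ->
  exists w, [/\ L2 w, nsq w != 0 & forall i, (i < size s)%N -> inner w (nth (fun=> 0) s i) = 0].
Hypotheses (p0_gt0 : 0 < p0) (nu_gt0 : 0 < nu) (r_gt0 : 0 < r) (nur : p0 < nu * r).
Hypothesis hP : spectral_integral E (fun t => t `^ (- nu)) P.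

Let mpow : measurable_fun setT (fun t : R => t `^ (- nu)).
Proof. exact: measurable_powR. Qed.

Let Plin : linear_op P. Proof. by case: hP. Qed.

Lemma proj_tail u L : L2 u ->
  (forall m, (m < L)%N -> nsq (proj E `[m%:R, m.+1%:R[ u) = 0) ->
  E `[L%:R, +oo[ u u.
Proof.
move=> u2 uL; apply: proj_fix => //.
have [mu [_ muE]] := spectral_form_ex hE u2.
rewrite -(projT hE u2).
suff : mu setT = mu `[L%:R, +oo[%classic by rewrite !muE// => -[].
have := @measureU _ _ _ mu `]-oo, L%:R[%classic `[L%:R, +oo[%classic.
rewrite (_ : _ `|` _ = setT); last first.
  apply/seteqP; split => // x _ /=; rewrite !in_itv/= andbT.
  by have [|] := leP L%:R x; [right|left].
move=> ->//; last first.
  apply/seteqP; split => // x [/= + /=]; rewrite !in_itv/= andbT.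
  by move=> h /le_lt_trans /(_ h); rewrite ltxx.
rewrite [X in (X + _)%E](_ : _ = 0%E) ?add0e//.
pose F m : set R := if m is m'.+1 then
  (if (m' < L)%N then `[m'%:R, m'.+1%:R[%classic else set0) else `]-oo, 1[%classic.
have mF m : measurable (F m) by case: m => //= m; case: ifP.
apply/eqP; rewrite eq_le measure_ge0 andbT.
have <- : mu (\bigcup_m F m) = 0%E.
  apply: measure_bigcup_null => // -[|m].
    by rewrite muE//; rewrite (proj_lt1 hE hT hT1).
  by rewrite /F; case: ifP => mL; rewrite ?measure0// muE// uL.
apply: le_measure; rewrite ?inE//; first by apply: bigcup_measurable.
move=> x /=; rewrite in_itv/= => xL; have [x1|x1] := ltP x 1.
  by exists 0%N.
exists (Num.truncn x).+1 => //=.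
have tx : (Num.truncn x)%:R <= x by rewrite truncn_le (le_trans _ x1).
have -> : (Num.truncn x < L)%N by rewrite -(ltr_nat R) (le_lt_trans tx).
by rewrite /= in_itv/= tx truncnS_gt.
Qed.

(** The spectral measure of [u] lives on [L, +oo[, where 0 <= t^-nu <= L^-nu. For [L = 0] the
    right-hand side would be the default value 0, hence the positivity of [L]. *)
Lemma pow_quad u L : (0 < L)%N -> L2 u ->
  (forall m, (m < L)%N -> nsq (proj E `[m%:R, m.+1%:R[ u) = 0) ->
  exists v, [/\ P u v, inner v u = (complex.Re (inner v u))%:C%C,
    0 <= complex.Re (inner v u) & complex.Re (inner v u) <= L%:R `^ (- nu) * nsq u].
Proof.
move=> L0 u2 uL; have Lu := proj_tail u2 uL.
have [||v [Puv h1 h2 h3]] := spectral_integral_between hE mpow hP _ u2 Lu (powR_ge0 L%:R (- nu)) => //.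
  move=> t /=; rewrite in_itv/= andbT => Lt.
  have L0' : 0 < L%:R :> R by rewrite ltr0n.
  rewrite powR_ge0/= !powRN lef_pV2 ?posrE ?powR_gt0//; last exact: lt_le_trans Lt.
  by apply: ge0_ler_powR; rewrite ?nnegrE ?(ltW nu_gt0) ?(ltW L0')// (le_trans (ltW L0')).
by exists v; rewrite mul0r in h2; split.
Qed.

Lemma pow_quad1 u : L2 u ->
  exists v, [/\ P u v, inner v u = (complex.Re (inner v u))%:C%C,
    0 <= complex.Re (inner v u) & complex.Re (inner v u) <= nsq u].
Proof.
move=> u2; have [||v] := @pow_quad u 1 _ u2 => //.
  case=> // _; have [mu [_ muE]] := spectral_form_ex hE u2.
  have := proj_lt1 hE hT hT1 u2 => h.
  suff : mu `[0%:R, 1%:R[%classic = 0%E by rewrite muE// => -[].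
  apply/eqP; rewrite eq_le measure_ge0 andbT.
  apply: (@le_trans _ _ (mu `]-oo, 1[%classic)); last by rewrite muE// h.
  by apply: le_measure; rewrite ?inE//; apply: subset_itvr.
by rewrite powR1 mul1r => h; exists v.
Qed.

Lemma pow_all : everywhere_defined P.
Proof. by move=> u u2; have [v [? _ _ _]] := pow_quad1 u2; exists v. Qed.

Let pf := opfun P.

Let pf_L2 u : L2 u -> L2 (pf u).
Proof. by move=> u2; apply: opfun_L2 => //; exact: pow_all. Qed.

Let pfE u : L2 u -> P u (pf u).
Proof. by move=> u2; apply: opfunE => //; exact: pow_all. Qed.

Let pf_lc a u v w : L2 u -> L2 v -> L2 w ->
  inner (pf (lc a u v)) w = a * inner (pf u) w + inner (pf v) w.
Proof.
move=> u2 v2 w2; rewrite -inner_lcl//; try exact: pf_L2.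
apply: inner_aeq => //.
- by apply: pf_L2; exact: L2_lc.
- by apply: L2_lc; exact: pf_L2.
- by apply: opfun_lc => //; exact: pow_all.
- exact: aeq_refl.
Qed.

Let pf_quad u : L2 u -> [/\ complex.Im (inner (pf u) u) = 0,
  0 <= complex.Re (inner (pf u) u) & complex.Re (inner (pf u) u) <= nsq u].
Proof.
move=> u2; have [v [uv h1 h2 h3]] := pow_quad1 u2.
by rewrite -(inner_op Plin pow_all uv u2) h1.
Qed.

(** The form is known on the diagonal only. Its reality at [u], [w], u + w and i u + w gives
    Hermitian symmetry by polarisation. *)
Lemma pow_sym u w : L2 u -> L2 w -> inner (pf u) w = inner u (pf w).
Proof.
move=> u2 w2; rewrite (inner_conj (pf_L2 w2) u2).
have [u0 _ _] := pf_quad u2; have [w0 _ _] := pf_quad w2.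
have [h1 _ _] := pf_quad (L2_lc 1 u2 w2).
have [h2 _ _] := pf_quad (L2_lc 'i%C u2 w2).
move: h1 h2; rewrite !pf_lc ?inner_lcr//; try exact: L2_lc; try exact: pf_L2.
rewrite -[1 : R[i]]/(Complex 1 0).
case: (inner (pf u) u) u0 => a1 a2; case: (inner (pf w) w) w0 => b1 b2.
case: (inner (pf u) w) => c1 c2; case: (inner (pf w) u) => d1 d2 /= u0 w0 h1 h2.
apply: eqcP => /=; lra.
Qed.

(** This is P^2 <= P for 0 <= P <= 1: the form is nonnegative at u - P u and is at most |P u|^2 at P
    u. *)
Lemma pow_norm u : L2 u -> nsq (pf u) <= complex.Re (inner (pf u) u).
Proof.
move=> u2; have p2 := pf_L2 u2.
have [_ h _] := pf_quad (L2_lc (-1) p2 u2); have [_ _ hp] := pf_quad p2.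
move: h; rewrite pf_lc ?inner_lcr//; try exact: L2_lc; try exact: pf_L2.
have -> : inner (pf (pf u)) u = (nsq (pf u))%:C%C.
  by rewrite pow_sym// inner_self.
rewrite inner_self.
move: hp; case: (inner (pf (pf u)) (pf u)) => a b /= hp.
by case: (inner (pf u) u) => c e /=; lra.
Qed.
Lemma pow_integral u : L2 u -> exists mu : {measure set R -> \bar R},
  [/\ forall B, measurable B -> mu B = (nsq (proj E B u))%:E,
   rint mu (fun t => t `^ (- nu)) &
   complex.Re (inner (pf u) u) = \int[mu]_t t `^ (- nu)].
Proof.
move=> u2; have [mu [hmu muE]] := spectral_form_ex hE u2.
have [_ /(_ u mu u2 hmu)[_ quad]] := hP.
exists mu; split => //; last by rewrite (quad _ (pfE u2)).
have m1 : measurable (`[1%R, +oo[%classic : set R) by exact: measurable_itv.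
have muT : mu setT = (nsq u)%:E by rewrite muE// projT.
have mu0 : mu (~` `[1%R, +oo[%classic) = 0%E.
  rewrite (_ : ~` _ = `]-oo, 1[%classic) ?muE ?(proj_lt1 hE hT hT1)//.
  by apply/seteqP; split => x /=; rewrite !in_itv/= andbT;
    [move=> /negP; rewrite -ltNge | rewrite ltNge => /negP].
have [] // := Rintegral_between muT mpow m1 mu0 (ler01).
move=> t /=; rewrite in_itv/= andbT => t1; rewrite powR_ge0 powRN/=.
have t0 : 0 < t by lra.
rewrite invf_le1 ?powR_gt0//.
apply: (@le_trans _ _ (1 `^ nu)); first by rewrite powR1.
by apply: ge0_ler_powR; rewrite ?nnegrE ?(ltW nu_gt0) ?(ltW t0).
Qed.

Lemma nsq_projC B u : measurable B -> L2 u ->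
  nsq (proj E B u) = nsq u - nsq (proj E (~` B) u).
Proof.
move=> mB u2; have [mu [_ muE]] := spectral_form_ex hE u2.
have mC := measurableC mB.
have : mu setT = (mu B + mu (~` B))%E by rewrite -measureU ?setUCr ?setICr.
by rewrite !muE// projT// -EFinD => -[->]; rewrite addrK.
Qed.

Lemma proj_eigenD l u w B : measurable B -> ~ B l -> L2 u -> L2 w -> E [set l] u u ->
  nsq (proj E B (lc 1 u w)) = nsq (proj E B w).
Proof.
move=> mB Bl u2 w2 lu; have l2 := L2_lc 1 u2 w2.
have pu : nsq (proj E B u) = 0.
  rewrite -(nsq_projI hE (measurable_set1 l) mB u2 lu) (_ : _ `&` _ = set0) ?proj0//.
  by apply/seteqP; split => // x [/= + xl]; rewrite xl.
have puL := proj_L2 hE mB u2; have pwL := proj_L2 hE mB w2.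
rewrite (nsq_aeq _ (L2_lc 1 puL pwL) (opfun_lc (proj_linear hE mB) (proj_all hE mB) 1 u2 w2)).
  rewrite nsq_lc// pu mulr0 add0r mul1r.
  have := cauchy_schwarz puL pwL; rewrite pu mul0r => h.
  have /eqP : nc (inner (proj E B u) (proj E B w)) ^+ 2 = 0.
    by apply/eqP; rewrite eq_le h sqr_ge0.
  by rewrite sqrf_eq0 nc_eq0 => /eqP -> /=; rewrite mulr0 add0r.
exact: proj_L2.
Qed.

(* The spectral measures of [u + w] and [w] only differ at the atom [l]. *)
Lemma pow_eigen l u : L2 u -> E [set l] u u ->
  P u (fun x => (l `^ (- nu))%:C%C * u x).
Proof.
move=> u2 lu; set s := l `^ (- nu); pose v := pf u.
have v2 : L2 v by exact: pf_L2.
have [w wE] : exists w, w = lc (- s%:C%C) u v by exists (lc (- s%:C%C) u v).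
have w2 : L2 w by rewrite wE; exact: L2_lc.
have l2 := L2_lc 1 u2 w2.
have ml : measurable [set l] by exact: measurable_set1.
have mC := measurableC ml.
have key g : L2 g -> exists mu : {measure set R -> \bar R},
   (forall B, measurable B -> mu B = (nsq (proj E B g))%:E) /\
   complex.Re (inner (pf g) g) = s * nsq (proj E [set l] g) +
    \int[mu]_(t in ~` [set l]) t `^ (- nu).
  move=> g2; have [mu [muE int ->]] := pow_integral g2; exists mu; split => //.
  rewrite -[in LHS](setUCr [set l]) Rintegral_setU ?setUCr//; last exact/disj_set2P/setICr.
  congr (_ + _); rewrite (@eq_Rintegral _ _ _ mu _ (fun=> s)).
    by rewrite Rintegral_cst// muE.
  by move=> t; rewrite inE => ->.
have [mu1 [mu1E q1]] := key _ l2; have [mu2 [mu2E q2]] := key _ w2.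
have same : \int[mu1]_(t in ~` [set l]) t `^ (- nu) = \int[mu2]_(t in ~` [set l]) t `^ (- nu).
  congr fine; apply: eq_measure_integral => A mA Al.
  rewrite mu1E// mu2E//; congr EFin; apply: proj_eigenD lu => //.
  by move=> /Al; apply.
have qu : complex.Re (inner v u) = s * nsq u.
  have [|v' [uv' h1 h2 h3]] := spectral_integral_between hE mpow hP ml u2 lu (lexx s).
    by move=> t /= ->; rewrite lexx.
  by move: h2 h3; rewrite (inner_op Plin pow_all uv' u2) -/pf -/v => h2 h3; apply/eqP; rewrite eq_le h2 h3.
have e1 : nsq (proj E [set l] (lc 1 u w)) = nsq (lc 1 u w) - nsq (proj E (~` [set l]) w).
  by rewrite nsq_projC// (@proj_eigenD l)//; apply.
have e2 : nsq (proj E [set l] w) = nsq w - nsq (proj E (~` [set l]) w) by rewrite nsq_projC.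
have wu : inner (pf w) u = (inner v w)^*.
  by rewrite pow_sym// -(inner_conj v2 w2).
(* Subtracting the forms at u + w and at w cancels everything off the atom, and [qu] removes the
   terms in [u] alone. As w = v - s u, the identity left over says that w is null. *)
have Rw : complex.Re (inner v w) = s * complex.Re (inner u w).
  move: q1; rewrite pf_lc// !inner_lcr// ?wu; try exact: pf_L2.
  rewrite e1 same nsq_lc//.
  have := q2; rewrite e2 => q2'; move: q2' qu; rewrite -/v.
  rewrite -[1 : R[i]]/(Complex 1 0).
  case: (inner v u) => a1 a2; case: (inner v w) => b1 b2; case: (inner u w) => c1 c2.
  case: (inner (pf w) w) => d1 d2 /=; rewrite !(mul1r,mul0r,mulr1,mulr0,oppr0,subr0,addr0,add0r,expr1n,expr0n,mulrBr,mulrDr,mulNr,mulrN,opprK)/= ?sqrtr1 ?expr1n.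
  by rewrite ?mul1r ?mulr1; lra.
have w0 : nsq w = 0.
  have := inner_self w; rewrite {1}wE inner_lcl// => /(congr1 (@complex.Re R)).
  move: Rw; case: (inner u w) => a1 a2; case: (inner v w) => b1 b2 /= Rw <-.
  by rewrite Rw; ring.
apply: (op_aeq Plin (pfE u2) u2); last 2 first.
- exact: aeq_refl.
- apply: filterS (nsq0_aeq w2 w0) => x.
  rewrite wE /lc -/v => /eqP; rewrite mulNr addrC subr_eq0 => /eqP ->//.
have := L2_lc s%:C%C u2 (@L2_0 R n); rewrite /lc.
by under eq_fun do rewrite addr0.
Qed.
Let psi := eigenvec E.
Let tv := eigenval E.

Let psiP k : [/\ L2 (psi k), E [set tv k] (psi k) (psi k), nsq (psi k) = 1 & 1 <= tv k].
Proof. exact: (eigenvecP hE hT hT1 hcount infdim). Qed.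

Let psi_orth j k : inner (psi j) (psi k) = (j == k)%:R.
Proof. exact: (eigenvec_orth hE hT hT1 hcount infdim). Qed.

Let psi_L2 k : L2 (psi k). Proof. by have [] := psiP k. Qed.

Fixpoint psum w J : fct :=
  if J is J'.+1 then lc (inner w (psi J')) (psi J') (psum w J') else fun=> 0.

Lemma psum_L2 w J : L2 (psum w J).
Proof. by elim: J => [|J IHJ] /=; [exact: L2_0|exact: L2_lc]. Qed.

Let natb0 : (nat_of_bool false)%:R = 0 :> R[i]. Proof. by []. Qed.

Lemma inner_psum w J j : inner (psum w J) (psi j) = inner w (psi j) * (j < J)%:R.
Proof.
elim: J => [|J IHJ] /=; first by rewrite inner0l// natb0 mulr0.
rewrite inner_lcl//; last exact: psum_L2.
rewrite IHJ psi_orth [J == j]eq_sym [in RHS]ltnS [in RHS]leq_eqVlt.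
by have [->|jJ] := eqVneq j J; rewrite ?ltnn natb0 mulr0 ?addr0 ?add0r.
Qed.

Lemma nsq_psum w J : nsq (psum w J) = \sum_(j < J) nc (inner w (psi j)) ^+ 2.
Proof.
elim: J => [|J IHJ] /=; first by rewrite nsq0 big_ord0.
rewrite nsq_lc//; last exact: psum_L2.
have [_ _ n1 _] := psiP J.
rewrite (inner_conj (psum_L2 w J) (psi_L2 J)) inner_psum ltnn natb0 mulr0.
by rewrite rmorph0 mulr0 /= mulr0 addr0 n1 mulr1 big_ord_recr/= -IHJ addrC.
Qed.

Lemma inner_psum_self w J : L2 w -> inner (psum w J) w = (nsq (psum w J))%:C%C.
Proof.
move=> w2; elim: J => [|J IHJ] /=; first by rewrite inner0l// nsq0.
rewrite inner_lcl//; last exact: psum_L2.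
rewrite IHJ !nsq_psum -[lc _ _ _]/(psum w J.+1) nsq_psum big_ord_recr/=.
by rewrite (inner_conj w2 (psi_L2 J)) mulc_conj -rmorphD addrC.
Qed.

(** Approximation by finite rank: [w] is split into its components along the first [J] eigenvectors
    and a rest. On the first part P <= 1; the rest has no mass below floor(t_J) by [low_window], so
    P is small there. *)
Lemma pow_compact_bound w J : L2 w -> nsq (pf w) <=
  2 * \sum_(j < J) nc (inner w (psi j)) ^+ 2 +
  2 * ((Num.truncn (tv J))%:R `^ (- nu) * nsq w).
Proof.
move=> w2; have p2 := psum_L2 w J.
pose w' := lc (-1) (psum w J) w; have w'2 : L2 w' by exact: L2_lc.
have tJ : (0 < Num.truncn (tv J))%N by rewrite truncn_gt0; have [] := psiP J.
have w'0 j : (j < J)%N -> inner w' (psi j) = 0.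
  by move=> jJ; rewrite inner_lcl// inner_psum jJ mulr1 mulN1r addNr.
have [v [Pv h1 h2 h3]] := pow_quad tJ w'2 (fun m => low_window hE hT hT1 hcount infdim w'2 w'0).
rewrite (inner_op Plin pow_all Pv w'2) -/pf in h3.
have n' : nsq w' <= nsq w.
  by rewrite nsq_sub// inner_psum_self//=; have := nsq_ge0 (psum w J); lra.
have wE : w = lc 1 (psum w J) w'.
  apply/funext => x; rewrite /w' /lc.
  have H (a b : R[i]) : b = 1 * a + (-1 * a + b) by ring.
  exact: H.
have E1 : nsq (pf w) = nsq (lc 1 (pf (psum w J)) (pf w')).
  rewrite {1}wE; apply: nsq_aeq.
  - by apply: pf_L2; exact: L2_lc.
  - by apply: L2_lc; exact: pf_L2.
  - exact: (opfun_lc Plin pow_all 1 p2 w'2).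
rewrite E1; apply: le_trans (nsqD_le (pf_L2 p2) (pf_L2 w'2)) _.
apply: lerD; rewrite ler_pM2l//.
  rewrite -nsq_psum; apply: le_trans (pow_norm p2) _.
  by have [_ _] := pf_quad p2.
apply: le_trans (pow_norm w'2) _; apply: le_trans h3 _.
by rewrite ler_wpM2l ?powR_ge0.
Qed.

Lemma eigenval_powR_series : cvgn (series (fun k => (tv k `^ (- nu)) `^ r)).
Proof.
have K0 : 0 < K.
  have := eigenval_count hE hT hT1 hcount infdim 0.
  rewrite ltNge; apply: contraPN => K0; apply/negP; rewrite -ltNge.
  by rewrite (le_lt_trans (mulr_le0_ge0 K0 (powR_ge0 _ _))).
pose p := nu * r / p0.
have p1 : 1 < p by rewrite /p ltr_pdivlMr// mul1r.
(* Obtained by solving k + 1 <= K (2 t_k)^p0 for t_k and raising to the power -(nu r). *)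
pose C := (2^-1 * K `^ (- p0^-1)) `^ (- (nu * r)).
apply: (@series_le_cvg _ _ (fun k => C * k.+1%:R `^ (- p))).
- by move=> k; exact: powR_ge0.
- by move=> k; rewrite mulr_ge0 ?powR_ge0.
- move=> k; rewrite -powRrM mulNr.
  have [_ _ _ t1] := psiP k; have t0 : 0 < tv k by lra.
  have h := eigenval_count hE hT hT1 hcount infdim k; rewrite -/(tv k) in h.
  have k0 : 0 < k.+1%:R :> R by rewrite ltr0n.
  have h' : 2^-1 * K `^ (- p0^-1) * k.+1%:R `^ (p0^-1) <= tv k.
    rewrite -mulrA ler_pdivrMl// powRN -(@ler_pM2l _ (K `^ p0^-1)) ?powR_gt0//.
    rewrite mulrA mulfV ?gt_eqF ?powR_gt0// mul1r.
    have -> : 2 * tv k = ((2 * tv k) `^ p0) `^ p0^-1.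
      by rewrite -powRrM mulfV ?gt_eqF// powRr1// mulr_ge0// ltW.
    rewrite -powRM ?powR_ge0 ?(ltW K0)//.
    apply: ge0_ler_powR => //; rewrite ?nnegrE ?invr_ge0 ?(ltW p0_gt0)//.
    by rewrite mulr_ge0 ?powR_ge0 ?(ltW K0).
  have C0 : 0 < 2^-1 * K `^ (- p0^-1) by rewrite mulr_gt0 ?powR_gt0// invr_gt0.
  have -> : k.+1%:R `^ (- p) = (k.+1%:R `^ p0^-1) `^ (- (nu * r)) :> R.
    by rewrite -powRrM /p mulrN [p0^-1 * _]mulrC.
  rewrite /C; move: C0 h'; move: (2^-1 * K `^ (- p0^-1)) => c C0 h'.
  rewrite -powRM ?powR_ge0 ?(ltW C0)// !powRN lef_pV2 ?posrE ?powR_gt0 ?mulr_gt0 ?powR_gt0//.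
  apply: ge0_ler_powR; [|rewrite nnegrE|by rewrite nnegrE ltW|exact: h'].
    by apply: mulr_ge0; exact: ltW.
  by apply: mulr_ge0; [exact: ltW|exact: powR_ge0].
- have := is_cvg_powR_series p1.
  rewrite (_ : series (fun k => C * _) = C *: series (fun k => k.+1%:R `^ (- p) : R)).
    by move=> h; exact: is_cvgZr.
  by apply/funext => k; rewrite fctE !seriesEnat/= /GRing.scale/= mulr_sumr.
Qed.

Lemma cvg0_powR_eigenval (e : R) : 0 < e ->
  exists J, (Num.truncn (tv J))%:R `^ (- nu) < e.
Proof.
move=> e0; pose m := Num.truncn (e^-1 `^ nu^-1).
have [J mJ] := eigenval_unbounded hE hT hT1 hcount infdim p0_gt0 m.
exists J; have e1 : 0 < e^-1 by rewrite invr_gt0.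
have t0 : 0 < (Num.truncn (tv J))%:R :> R by rewrite ltr0n (leq_trans _ mJ).
rewrite powRN invf_plt ?posrE ?powR_gt0//.
have -> : e^-1 = (e^-1 `^ nu^-1) `^ nu.
  by rewrite -powRrM mulVf ?gt_eqF// powRr1// ltW.
apply: gt0_ltr_powR => //; rewrite ?nnegrE ?powR_ge0 ?(ltW t0)//.
by apply: lt_le_trans (truncnS_gt _) _; rewrite ler_nat.
Qed.

(** The image of [U] clusters in the compact interval [-D, D]. An ultrafilter contains each set or
    its complement, so it is eventually close to a cluster point. *)
Lemma ultra_bounded (U : set_system nat) (a : nat -> R) (D e : R) :
  UltraFilter U -> (forall k, `|a k| <= D) -> 0 < e ->
  exists z, U [set k | `|a k - z| < e].
Proof.
move=> UU aD e0.
have [z [_ zc]] : `[- D, D]%classic `&` cluster (a @ U) !=set0.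
  apply: (@segment_compact R (- D) D (a @ U)).
  suff : U (a @^-1` `[- D, D]%classic) by [].
  apply: (@filterS _ U _ setT); last exact: filterT.
  by move=> k _ /=; rewrite in_itv/= -ler_norml; exact: aD.
exists z; have [//|UC] := in_ultra_setVsetC [set k | `|a k - z| < e] UU.
have [|y [/= ye yz]] := zc [set y | ~ (`|y - z| < e)] (ball z e) UC.
  exact: nbhsx_ballx.
by exfalso; apply: ye; move: yz; rewrite /ball/= distrC.
Qed.

(** Along one ultrafilter finer than [\oo] all coordinates in the eigenbasis stabilise at once; it
    takes the place of a diagonal extraction. With [pow_compact_bound] the images become Cauchy
    along it. *)
Lemma pow_compact : compact_op P.
Proof.
split; [exact: Plin|exact: pow_all|].
move=> uk vk uv [Bd hBd].
have u2 k : L2 (uk k) by have [] := op_L2 Plin (uv k).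
have v2 k : L2 (vk k) by have [] := op_L2 Plin (uv k).
pose D := `|Bd| ^+ 2 + 1.
have D0 : 0 < D by rewrite ltr_pwDr// sqr_ge0.
have uD k : nsq (uk k) <= D.
  have := hBd k; rewrite l2normE => h.
  have h2 : Num.sqrt (nsq (uk k)) ^+ 2 <= `|Bd| ^+ 2.
    by rewrite ler_sqr ?nnegrE ?sqrtr_ge0// (le_trans h)// ler_norm.
  by rewrite sqr_sqrtr ?nsq_ge0// in h2; rewrite /D; lra.
have diffD k l : nsq (lc (-1) (uk k) (uk l)) <= 4 * D.
  rewrite nsq_sub//; have := nsq_ge0 (lc 1 (uk k) (uk l)).
  rewrite nsq_lc// ComplexField.Normc.normc1 expr1n !mul1r.
  by have := uD k; have := uD l; lra.
have [U [UU Uoo]] := @ultraFilterLemma nat \oo _.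
have coord j (e : R) : 0 < e ->
    exists A, U A /\ forall k l, A k -> A l ->
      nc (inner (lc (-1) (uk k) (uk l)) (psi j)) ^+ 2 <= e.
  (* Real and imaginary parts differ by at most 2 d, so the squares add up to at most 8 d^2 <= 8 d
     <= e. *)
  move=> e0; pose d := Num.min 1 (e / 8).
  have d0 : 0 < d by rewrite lt_min ltr01 divr_gt0.
  have cD k : nc (inner (uk k) (psi j)) <= D + 1.
    have := cauchy_schwarz (u2 k) (psi_L2 j); have [_ _ -> _] := psiP j.
    rewrite mulr1 => h; have := nc_ge0 (inner (uk k) (psi j)).
    by have := uD k; nra.
  have [zr Ur] := ultra_bounded UU (fun k => le_trans (normr_Re _) (cD k)) d0.
  have [zi Ui] := ultra_bounded UU (fun k => le_trans (normr_Im _) (cD k)) d0.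
  eexists; split; first exact: filterI Ur Ui.
  move=> k l [kr0 ki0] [lr0 li0]; rewrite inner_lcl// sqr_nc.
  have kr : `|complex.Re (inner (uk k) (psi j)) - zr| < d := kr0.
  have ki : `|complex.Im (inner (uk k) (psi j)) - zi| < d := ki0.
  have lr : `|complex.Re (inner (uk l) (psi j)) - zr| < d := lr0.
  have li : `|complex.Im (inner (uk l) (psi j)) - zi| < d := li0.
  move: kr ki lr li; case: (inner (uk k) (psi j)) => a1 a2.
  case: (inner (uk l) (psi j)) => b1 b2.
  rewrite mulN1r /= => kr ki lr li; move: kr ki lr li; rewrite !ltr_norml => /andP[h1 h2] /andP[h3 h4] /andP[h5 h6] /andP[h7 h8].
  have dd : d <= e / 8 by rewrite ge_min lexx orbT.
  have d1 : d <= 1 by rewrite ge_min lexx.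
  have sq (x : R) : - (2 * d) <= x -> x <= 2 * d -> x ^+ 2 <= 4 * d.
    move=> x1 x2; have xx : 0 <= (2 * d - x) * (2 * d + x) by apply: mulr_ge0; lra.
    have dd2 : d * d <= d * 1 by rewrite ler_pM2l.
    by rewrite expr2; lra.
  have s1 : (- a1 + b1) ^+ 2 <= 4 * d by apply: sq; lra.
  have s2 : (- a2 + b2) ^+ 2 <= 4 * d by apply: sq; lra.
  by lra.
have near_m m : exists A, U A /\ forall k l, A k -> A l ->
    nsq (lc (-1) (vk k) (vk l)) <= 4^-1 ^+ m.
  pose e : R := 4^-1 ^+ m; have e0 : 0 < e by rewrite exprn_gt0// invr_gt0.
  (* Squared distances of the u_k are at most 4 D, so the tail term is at most e / 4. The finite
     part is also kept below e / 4, and the factors 2 of [pow_compact_bound] bring the total to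
     e. *)
  have [J hJ] := @cvg0_powR_eigenval (e / (16 * D)) ltac:(by rewrite divr_gt0// mulr_gt0).
  have [A [UA hA]] : exists A, U A /\ forall k l, A k -> A l ->
      \sum_(j < J) nc (inner (lc (-1) (uk k) (uk l)) (psi j)) ^+ 2 <= e / 4.
    have e4 : 0 < e / 4 by rewrite divr_gt0.
    elim: (J) (e / 4) e4 => [|J' IHJ] f f0.
      exists setT; split; first exact: filterT.
      by move=> k l _ _; rewrite big_ord0 ltW.
    have f2 : 0 < f / 2 by rewrite divr_gt0.
    have [A [UA hA]] := IHJ _ f2; have [A' [UA' hA']] := coord J' _ f2.
    exists (A `&` A'); split; first exact: filterI.
    move=> k l [k1 k2] [l1 l2]; rewrite big_ord_recr.
    by apply: le_trans (lerD (hA k l k1 l1) (hA' k l k2 l2)) _; lra.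
  exists A; split => // k l Ak Al.
  have w2 := L2_lc (-1) (u2 k) (u2 l).
  have Pw := op_lc Plin (-1) (uv k) (uv l).
  rewrite (nsq_op Plin pow_all Pw) -/pf.
  apply: le_trans (pow_compact_bound J w2) _.
  have h1 := hA k l Ak Al; have h2 := diffD k l.
  have h3 : (Num.truncn (tv J))%:R `^ (- nu) * nsq (lc (-1) (uk k) (uk l)) <= e / (16 * D) * (4 * D).
    by apply: ler_pM; rewrite ?powR_ge0 ?nsq_ge0// ltW.
  have h4 : e / (16 * D) * (4 * D) = e / 4 by field; rewrite gt_eqF.
  by rewrite h4 in h3; rewrite -/e; lra.
pose A m := sval (cid (near_m m)).
have UA m : U (A m) by rewrite /A; case: cid => /= B [].
have hA m k l : A m k -> A m l -> nsq (lc (-1) (vk k) (vk l)) <= 4^-1 ^+ m.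
  by rewrite /A; case: cid => /= B [_]; exact.
(* Intersecting the sets up to [m] keeps all later terms of the subsequence inside the earlier
   sets. *)
pose Bm m := [set k | forall i, (i <= m)%N -> A i k].
have UB m : U (Bm m).
  elim: m => [|m IHm].
    by apply: filterS (UA 0%N) => k Ak i; rewrite leqn0 => /eqP ->.
  apply: filterS (filterI IHm (UA m.+1)) => k [/= h1 h2] i.
  by rewrite leq_eqVlt => /predU1P[->//|]; rewrite ltnS; exact: h1.
have step m N : exists k, (N < k)%N /\ Bm m k.
  have UN : U [set k | (N < k)%N] := Uoo _ (nbhs_infty_gt N).
  have [k [? ?]] := @filter_ex _ U _ _ (filterI UN (UB m)).
  by exists k.
pose nxt m N := sval (cid (step m N)).
have nxtP m N : (N < nxt m N)%N /\ Bm m (nxt m N) by rewrite /nxt; case: cid.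
pose sq := fix sq k := if k is k'.+1 then nxt k (sq k') else nxt 0%N 0%N.
have sB k : Bm k (sq k) by case: k => [|k]; [have [] := nxtP 0%N 0%N|have [] := nxtP k.+1 (sq k)].
exists sq; split; first by move=> k /=; have [] := nxtP k.+1 (sq k).
have [v v2' hv] := @L2_complete R n (fun k => vk (sq k)) (fun k => v2 (sq k))
  (fun k m km => hA k _ _ (sB k k (leqnn k)) (sB m k km)).
by exists v.
Qed.

Theorem schatten_pow : schatten r P.
Proof.
split; first exact: pow_compact.
have adjP u v : P u v <-> adjoint P u v.
  split=> [uv|[u2 v2 h]].
    have [u2 v2] := op_L2 Plin uv; split => // f g fg.
    have [f2 g2] := op_L2 Plin fg.
    rewrite (inner_op Plin pow_all fg u2) (inner_conj v2 f2).
    by rewrite (inner_op Plin pow_all uv f2) -(inner_conj (pf_L2 u2) f2) pow_sym.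
  apply: (op_aeq Plin (pfE u2) u2 v2); first exact: aeq_refl.
  have d2 := L2_lc (-1) (pf_L2 u2) v2.
  apply: nsq_sub_aeq => //; first exact: pf_L2.
  set d := lc _ _ _ in d2 *; have := h d (pf d) (pfE d2).
  rewrite pow_sym// => h0.
  have : inner d d = 0.
    rewrite {2}/d inner_lcr//; last exact: pf_L2.
    by rewrite h0 rmorphN rmorph1 mulN1r addNr.
  by rewrite inner_self => -[].
(* [P] is positive and self-adjoint, hence its own absolute value. *)
exists P, psi, (fun k => tv k `^ (- nu)); split.
- split.
  + split; last exact: adjP.
    move=> u u2; exists (fun=> u), (fun=> pf u); split; first by move=> k; exact: pfE.
    apply/l2cvgE; split => //.
    rewrite (_ : (fun k => _) = fun=> 0); first exact: cvg_cst.
    apply/funext => k; rewrite (_ : lc _ _ _ = fun=> 0) ?nsq0//.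
    by apply/funext => x; rewrite /lc mulN1r addNr.
  + move=> u v uv; have [u2 _] := op_L2 Plin uv.
    rewrite (inner_op Plin pow_all uv u2); have [h1 h2 _] := pf_quad u2.
    by rewrite lecE h1 /= eqxx.
  + move=> u v; split=> -[w uw wv]; exists w => //; exact/adjP.
- split.
  + exact: psi_L2.
  + exact: psi_orth.
  + exact: (eigenvec_complete hE hT hT1 hcount infdim p0_gt0).
- by move=> k; have [p2 pE _ _] := psiP k; exact: pow_eigen.
- exact: eigenval_powR_series.
Qed.

End schatten_power.

(** * Fourier transform *)

Section poisson_kernel_line.
Context {R : realType}.
Implicit Types e z t c : R.

(** The Poisson kernel of the half plane, with total mass 2 pi: the Fourier transform of the Abel
    weight e^(-e |t|). *)
Definition pker e t : R := 2 * e / (e ^+ 2 + t ^+ 2).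

Lemma pker_gt0 e t : 0 < e -> 0 < pker e t.
Proof.
by move=> e0; rewrite divr_gt0 ?mulr_gt0// ltr_pwDl ?exprn_gt0// sqr_ge0.
Qed.

Lemma pker_le e t : 0 < e -> pker e t <= 2 / e.
Proof.
move=> e0; rewrite ler_pdivrMr; last by rewrite ltr_pwDl ?exprn_gt0// sqr_ge0.
have -> : 2 / e * (e ^+ 2 + t ^+ 2) = 2 * e + 2 / e * t ^+ 2 by field; rewrite gt_eqF.
by rewrite lerDl mulr_ge0 ?sqr_ge0// divr_ge0// ltW.
Qed.

Lemma pkerN e t : pker e (- t) = pker e t.
Proof. by rewrite /pker sqrrN. Qed.

Lemma continuous_pker e : 0 < e -> continuous (pker e).
Proof.
move=> e0 t; rewrite /pker; apply: cvgM; first exact: cvg_cst.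
apply: cvgV; first by rewrite gt_eqF// ltr_pwDl ?exprn_gt0// sqr_ge0.
by apply: cvgD; [exact: cvg_cst | exact: exprn_continuous].
Qed.

Lemma measurable_pker e : 0 < e -> measurable_fun setT (pker e).
Proof. by move=> e0; exact: continuous_measurable_fun (continuous_pker e0). Qed.

Lemma integral_pker e : 0 < e ->
  (\int[lebesgue_measure]_t (pker e t)%:E = (2 * pi)%:E)%E.
Proof.
move=> e0; rewrite ge0_symfun_integralT; last 3 first.
- by move=> t; exact/ltW/pker_gt0.
- exact: continuous_pker.
- by move=> t /=; rewrite pkerN.
rewrite -set_itvcy.
pose F t := 2 * atan (e^-1 * t).
have dF t : is_derive t 1 F (pker e t).
  have d1 : is_derive t 1 (fun t => e^-1 * t) (e^-1 * 1).
    exact: (@is_deriveZ _ _ _ id e^-1).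
  have d2 : is_derive (e^-1 * t) 1 (@atan R) (1 + (e^-1 * t) ^+ 2)^-1.
    exact: is_derive1_atan.
  have d3 := @is_derive1_comp _ _ _ _ _ _ d2 d1.
  apply: is_derive_eq (@is_deriveZ _ _ _ _ (2 : R) _ _ _ d3) _.
  rewrite /GRing.scale/= /pker; field.
  have h : 0 < e ^+ 2 + t ^+ 2 by rewrite ltr_pwDl ?exprn_gt0// sqr_ge0.
  by rewrite !gt_eqF//.
rewrite (@ge0_continuous_FTC2y _ _ F 0 pi).
- by rewrite /F mulr0 atan0 mulr0 -EFinB subr0 -EFinM.
- by move=> t _; exact/ltW/pker_gt0.
- by apply: continuous_subspaceT; exact: continuous_pker.
- rewrite /F; have -> : pi = 2 * (pi / 2) :> R by field.
  apply: cvgM; first exact: cvg_cst.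
  apply: (@cvg_comp _ _ _ (fun t => e^-1 * t) (@atan R) _ +oo); last exact: cvgy_atan.
  have ie : 0 < e^-1 by rewrite invr_gt0.
  exact: (gt0_cvgMry ie (f := id) cvg_id).
- by move=> t _; have [] := dF t.
- apply: cvg_at_right_filter; apply: differentiable_continuous.
  by apply/derivable1_diffP; have [] := dF 0.
- by move=> t _; rewrite derive1E; have [_ ->] := dF t.
Qed.

Definition pweight e t : R := expR (- (e * `|t|)).

Lemma continuous_pweight e : continuous (pweight e).
Proof.
move=> t; apply: (continuous_comp (f := fun t => - (e * `|t|)) (g := @expR R)).
  apply: cvgN; apply: cvgM; first exact: cvg_cst.
  exact: norm_continuous.
exact: continuous_expR.
Qed.

(** Adding 1 to the cosine makes the integrand nonnegative, as the fundamental theorem of calculus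
    on the half line requires. The case z = 0 then gives the integral of the weight alone, which is
    subtracted afterwards. *)
Lemma integral_pweight_cos e z : 0 < e ->
  (\int[lebesgue_measure]_t ((1 + cos (z * t)) * pweight e t)%:E =
   (2 / e + pker e z)%:E)%E.
Proof.
move=> e0; have s0 : 0 < e ^+ 2 + z ^+ 2 by rewrite ltr_pwDl ?exprn_gt0// sqr_ge0.
have f0 t : 0 <= (1 + cos (z * t)) * pweight e t.
  by rewrite mulr_ge0 ?expR_ge0// -lerBlDl sub0r cos_geN1.
have cf : continuous (fun t => (1 + cos (z * t)) * pweight e t).
  move=> t; apply: cvgM; last exact: continuous_pweight.
  apply: cvgD; first exact: cvg_cst.
  apply: (continuous_comp (f := fun t => z * t) (g := @cos R)); last exact: continuous_cos.
  by apply: cvgM; [exact: cvg_cst|exact: cvg_id].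
rewrite ge0_symfun_integralT//; last first.
  by move=> t /=; rewrite mulrN cosN /pweight normrN.
rewrite -set_itvcy.
pose G t := expR (- e * t).
(* The primitive of (1 + cos (z t)) e^(-e t) that vanishes at infinity. *)
pose F t := - e^-1 * G t + (e ^+ 2 + z ^+ 2)^-1 * (G t * (z * sin (z * t) - e * cos (z * t))).
have dF t : is_derive t 1 F ((1 + cos (z * t)) * G t).
  have l1 c : is_derive t 1 (fun t => c * t) (c * 1).
    exact: (@is_deriveZ _ _ _ id c).
  have dG : is_derive t 1 G (expR (- e * t) * (- e * 1)).
    exact: (@is_derive1_comp _ (@expR R) _ _ _ _ _ (l1 (- e))).
  have ds : is_derive t 1 (fun t => sin (z * t)) (cos (z * t) * (z * 1)).
    exact: (@is_derive1_comp _ (@sin R) _ _ _ _ _ (l1 z)).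
  have dc : is_derive t 1 (fun t => cos (z * t)) (- sin (z * t) * (z * 1)).
    exact: (@is_derive1_comp _ (@cos R) _ _ _ _ _ (l1 z)).
  have d1 : is_derive t 1 (fun t => z * sin (z * t) - e * cos (z * t))
      (z * (cos (z * t) * (z * 1)) - e * (- sin (z * t) * (z * 1))) :=
    @is_deriveB _ _ _ _ _ _ _ _ _ (@is_deriveZ _ _ _ _ z _ _ _ ds) (@is_deriveZ _ _ _ _ e _ _ _ dc).
  have d2 := @is_deriveM _ _ _ _ _ _ _ _ dG d1.
  have d3 := @is_deriveD _ _ _ _ _ _ _ _ _ (@is_deriveZ _ _ _ _ (- e^-1) _ _ _ dG) (@is_deriveZ _ _ _ _ (e ^+ 2 + z ^+ 2)^-1 _ _ _ d2).
  apply: is_derive_eq d3 _.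
  rewrite /GRing.scale/= /G; field.
  by rewrite !gt_eqF.
have G0 : G t @[t --> +oo] --> 0.
  rewrite (_ : G = (fun t => expR (- t)) \o (fun t => e * t)).
    apply: (@cvg_comp _ _ _ (fun t => e * t) (fun t => expR (- t)) _ +oo); last exact: cvgr_expR.
    exact: (gt0_cvgMry e0 (f := id) cvg_id).
  by apply/funext => t; rewrite /G/= mulNr.
rewrite (@ge0_continuous_FTC2y _ _ F 0 0).
- rewrite /F /G mulr0 expR0 mulr0 sin0 cos0 -EFinB -EFinM; congr EFin.
  by rewrite /pker; field; rewrite !gt_eqF.
- by move=> t _.
- exact: continuous_subspaceT.
- pose C := e^-1 + (e ^+ 2 + z ^+ 2)^-1 * (`|z| + e).
  apply/norm_cvg0P.
  apply: (@squeeze_cvgr _ _ _ _ (fun=> 0) (fun t => C * G t)).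
  + near=> t; rewrite normr_ge0/= /F mulrDl (le_trans (ler_normD _ _))// lerD//.
      by rewrite normrM normrN (gtr0_norm (x := e^-1)) ?invr_gt0// (ger0_norm (x := G t)) ?expR_ge0.
    rewrite !normrM (gtr0_norm (x := _^-1)) ?invr_gt0// (ger0_norm (x := G t)) ?expR_ge0// -mulrA.
    rewrite ler_wpM2l ?invr_ge0 ?(ltW s0)// mulrC ler_wpM2r ?expR_ge0//.
    rewrite (le_trans (ler_normB _ _))// !normrM lerD//.
      by rewrite ler_piMr// ler_norml sin_geN1 sin_le1.
    by rewrite (gtr0_norm e0) ler_piMr ?(ltW e0)// ler_norml cos_geN1 cos_le1.
  + exact: cvg_cst.
  + have -> : 0 = C * 0 :> R by rewrite mulr0.
    by apply: cvgM => //; exact: cvg_cst.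
- by move=> t _; have [] := dF t.
- apply: cvg_at_right_filter; apply: differentiable_continuous.
  by apply/derivable1_diffP; have [] := dF 0.
- move=> t; rewrite in_itv/= andbT => t0; rewrite derive1E; have [_ ->] := dF t.
  by rewrite /pweight gtr0_norm// /G mulNr.
Unshelve. all: by end_near. Qed.

Lemma integral_pweight e : 0 < e ->
  (\int[lebesgue_measure]_t (pweight e t)%:E = (2 / e)%:E)%E.
Proof.
move=> e0; have := integral_pweight_cos 0 e0.
rewrite (_ : pker e 0 = 2 / e); last by rewrite /pker; field; rewrite gt_eqF.
rewrite (_ : (\int[_]_t _)%E = (\int[lebesgue_measure]_t (2%:E * (pweight e t)%:E))%E); last first.
  by apply: eq_integral => t _; rewrite mul0r cos0 EFinM.
rewrite ge0_integralZl//; last 2 first.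
- apply/measurable_EFinP; exact: continuous_measurable_fun (@continuous_pweight e).
- by move=> t _; rewrite lee_fin expR_ge0.
move=> H; have := congr1 (fun x => (2^-1)%:E * x)%E H.
rewrite muleA -EFinM mulVf// mul1e => ->; rewrite -EFinM; congr EFin.
by field; rewrite gt_eqF.
Qed.

Lemma rint_pweight e : 0 < e -> rint lebesgue_measure (pweight e).
Proof.
move=> e0; apply/rint_lty; first exact: continuous_measurable_fun (@continuous_pweight e).
  by move=> t; exact: expR_ge0.
by rewrite integral_pweight// ltry.
Qed.

Lemma lebesgue_measure_opp (A : set (measurableTypeR R)) : measurable A ->
  lebesgue_measure A = lebesgue_measure ((fun t : R => - t) @^-1` A).
Proof.
have mopp : measurable_fun setT (fun t : measurableTypeR R => (- t : measurableTypeR R)).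
  by apply: continuous_measurable_fun => t; apply: cvgN; exact: cvg_id.
move=> mA.
rewrite (@lebesgue_measure_unique R (pushforward lebesgue_measure
  (fun t : measurableTypeR R => (- t : measurableTypeR R))))//.
move=> _ [[a b] _ <-] /=; rewrite /pushforward.
rewrite (_ : _ @^-1` _ = `[- b, - a[%classic); last first.
  by apply/seteqP; split => t /=; rewrite !in_itv/= lerNl ltrNr andbC.
rewrite [LHS]lebesgue_measure_itv [RHS]lebesgue_measure_itv/= !lte_fin ltrN2.
by case: ifP => // _; rewrite -!EFinB opprK addrC.
Qed.

Lemma Rintegral_odd (f : R -> R) : rint lebesgue_measure f ->
  (forall t, f (- t) = - f t) -> \int[lebesgue_measure]_t f t = 0.
Proof.
move=> fi fo; have mf := rint_meas fi.
have mopp : measurable_fun setT (fun t : measurableTypeR R => (- t : measurableTypeR R)).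
  by apply: continuous_measurable_fun => t; apply: cvgN; exact: cvg_id.
have E : \int[lebesgue_measure]_t f t = \int[lebesgue_measure]_t f (- t).
  congr fine.
  rewrite [LHS](eq_measure_integral (pushforward lebesgue_measure
    (fun t : measurableTypeR R => (- t : measurableTypeR R)))); last first.
    by move=> A mA _; exact: lebesgue_measure_opp.
  apply: (integral_pushforward mopp (f := EFin \o f)) => //.
    exact/measurable_EFinP.
  rewrite preimage_setT (_ : _ \o _ = fun t => (- f t)%:E); last first.
    by apply/funext => t; rewrite /= fo.
  by have := rintZ (-1) fi; under eq_fun do rewrite mulN1r.
move: E; under [X in _ = X -> _]eq_Rintegral do rewrite fo -mulN1r.
by rewrite RintegralZl// mulN1r; lra.
Qed.

Lemma cint_pweight_cis e z : 0 < e ->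
  cL1 lebesgue_measure (fun t => cis (z * t) * (pweight e t)%:C%C) /\
  cint lebesgue_measure (fun t => cis (z * t) * (pweight e t)%:C%C) = (pker e z)%:C%C.
Proof.
move=> e0; have wi := rint_pweight e0.
have mz : measurable_fun setT (fun t : R => z * t).
  by apply: measurable_funM => //; exact: measurable_cst.
have H : cL1 lebesgue_measure (fun t => cis (z * t) * (pweight e t)%:C%C).
  apply: (@le_cL1 _ (measurableTypeR R) R lebesgue_measure _ (pweight e)) => //.
    apply: cmeasM; first exact: cmeas_cis.
    by apply: cmeas_real; exact: rint_meas wi.
  by move=> t; rewrite ncM nc_cis mul1r nc_real ger0_norm// expR_ge0.
split => //; have [H1 H2] := H; apply: eqcP => /=.
  have := integral_pweight_cos z e0.
  rewrite (_ : (\int[_]_t _)%E = (\int[lebesgue_measure]_t (pweight e t + (complex.Re (cis (z * t) * (pweight e t)%:C%C)))%:E)%E); last first.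
    by apply: eq_integral => t _ /=; congr EFin; ring.
    move=> /(congr1 fine)/=; rewrite -[fine _]/(\int[_]_t _) RintegralD//.
    rewrite /Rintegral integral_pweight//= => E1; apply: (addrI (2 / e)).
    by rewrite -[RHS]E1.
apply: Rintegral_odd => // t /=.
by rewrite mulrN sinN cosN /pweight normrN; ring.
Qed.

End poisson_kernel_line.

(** * The regularised Fourier transform on R^n *)

Section fourier_regularisation.
Context {R : realType} {n : nat}.
Notation fct := ('rV[R]_n -> R[i]).
Notation mu := (@lebesgue_rV R n).
Implicit Types (e : R) (x y z xi : 'rV[R]_n) (f : fct).

(** A product over the coordinates, rather than a function of the Euclidean norm, so that its
    transform factors into one-dimensional kernels. *)
Definition weight e xi : R := \prod_(i < n) pweight e (xi ord0 i).
Definition kernel e z : R := \prod_(i < n) pker e (z ord0 i).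

Lemma weight_gt0 e xi : 0 < weight e xi.
Proof. by apply: prodr_gt0 => i _; exact: expR_gt0. Qed.

Lemma weight_le1 e xi : 0 < e -> weight e xi <= 1.
Proof.
move=> e0; apply: prodr_ile1 => i; rewrite expR_ge0/= -expR0 ler_expR oppr_le0.
by rewrite mulr_ge0// ltW.
Qed.

Lemma rint_weight e : 0 < e -> rint mu (weight e).
Proof.
move=> e0; apply: (rint_rV_prod (f := fun=> pweight e)) => [i t|i].
  exact: expR_ge0.
exact: rint_pweight.
Qed.

Lemma measurable_weight e : 0 < e -> measurable_fun setT (weight e).
Proof. by move=> e0; exact: rint_meas (rint_weight e0). Qed.

Lemma kernel_gt0 e z : 0 < e -> 0 < kernel e z.
Proof. by move=> e0; apply: prodr_gt0 => i _; exact: pker_gt0. Qed.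

Lemma kernelN e z : kernel e (- z) = kernel e z.
Proof. by apply: eq_bigr => i _; rewrite mxE pkerN. Qed.

Lemma measurable_kernel e : 0 < e -> measurable_fun setT (kernel e).
Proof.
by move=> e0; apply: (measurable_prod_rV (f := fun=> pker e)) => i; exact: measurable_pker.
Qed.

Lemma integral_kernel e : 0 < e ->
  (\int[mu]_z (kernel e z)%:E = ((2 * pi) ^+ n)%:E)%E.
Proof.
move=> e0; rewrite (integral_rV_prod (f := fun=> pker e) (c := fun=> 2 * pi)).
- by rewrite prodr_const card_ord.
- by move=> i t; exact/ltW/pker_gt0.
- by move=> i; exact: measurable_pker.
- by move=> i; exact: integral_pker.
Qed.

Lemma cis_dotp x y : cis (dotp x y) = \prod_(i < n) cis (x ord0 i * y ord0 i).
Proof. exact: (big_morph _ (@cisD R) (@cis0 R)). Qed.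

Lemma dotpNl x y : dotp (- x) y = - dotp x y.
Proof. by rewrite /dotp -sumrN; apply: eq_bigr => i _; rewrite mxE mulNr. Qed.

Lemma dotpDl x y z : dotp (x + y) z = dotp x z + dotp y z.
Proof. by rewrite /dotp -big_split; apply: eq_bigr => i _; rewrite mxE mulrDl. Qed.

Lemma cint_weight e z : 0 < e ->
  cL1 mu (fun xi => cis (dotp z xi) * (weight e xi)%:C%C) /\
  cint mu (fun xi => cis (dotp z xi) * (weight e xi)%:C%C) = (kernel e z)%:C%C.
Proof.
move=> e0; have H i := cint_pweight_cis (z ord0 i) e0.
have [H1 H2] := cint_rV_prod (fun i => (H i).1).
rewrite (_ : (fun xi => _) = (fun xi : 'rV[R]_n => \prod_(i < n)
    (cis (z ord0 i * xi ord0 i) * (pweight e (xi ord0 i))%:C%C))); last first.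
  by apply/funext => xi; rewrite big_split/= cis_dotp rmorph_prod.
split=> //; rewrite H2 /kernel rmorph_prod; apply: eq_bigr => i _.
exact: (H i).2.
Qed.

Lemma measurable_dotp : measurable_fun setT
  (fun p : 'rV[R]_n * 'rV[R]_n => dotp p.1 p.2).
Proof.
apply: measurable_sum => i; apply: measurable_funM.
  exact: measurableT_comp (@measurable_coord R n i) measurable_fst.
exact: measurableT_comp (@measurable_coord R n i) measurable_snd.
Qed.

Lemma measurable_rV_sub : measurable_fun setT
  (fun p : 'rV[R]_n * 'rV[R]_n => p.2 - p.1).
Proof.
apply: measurable_rVP => i; under eq_fun do rewrite !mxE.
apply: measurable_funB.
  exact: measurableT_comp (@measurable_coord R n i) measurable_snd.
exact: measurableT_comp (@measurable_coord R n i) measurable_fst.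
Qed.

Lemma cmeas_comp d1 d2 (T1 : measurableType d1) (T2 : measurableType d2)
    (g : T2 -> R[i]) (h : T1 -> T2) :
  cmeas g -> measurable_fun setT h -> cmeas (fun t => g (h t)).
Proof.
by move=> [g1 g2] mh; split; [exact: measurableT_comp g1 mh|exact: measurableT_comp g2 mh].
Qed.

Section regularised.
Variable f : fct.
Hypothesis fi : cL1 mu f.

Let ncf_ge0 x : 0 <= nc (f x). Proof. exact: nc_ge0. Qed.

Lemma cL1_cisM (s : 'rV[R]_n -> R) : measurable_fun setT s ->
  cL1 mu (fun x => cis (s x) * f x).
Proof.
move=> ms; apply: (le_cL1 (v := fun x => nc (f x))); last exact: cL1_nc fi.
  by apply: cmeasM; [exact: cmeas_cis|exact: cL1_meas fi].
by move=> x; rewrite ncM nc_cis mul1r.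
Qed.

Lemma measurable_dotp_left xi : measurable_fun setT (fun x => - dotp x xi).
Proof.
apply: measurable_funN; apply: measurable_sum => i.
by apply: measurable_funM; [exact: measurable_coord|exact: measurable_cst].
Qed.

Lemma nc_fourier xi : nc (fourier f xi) <= \int[mu]_x nc (f x).
Proof.
apply: le_trans (nc_cint (cL1_cisM (measurable_dotp_left xi))) _.
rewrite le_eqVlt; apply/orP; left; apply/eqP; apply: eq_Rintegral => x _.
by rewrite ncM nc_cis mul1r.
Qed.

(** Fubini gives measurability of partial integrals of integrable functions. A positive weight in
    [xi] is inserted to reach that case and divided out again. *)
Lemma cmeas_fourier : cmeas (fourier f).
Proof.
have e1 : 0 < 1 :> R by [].
pose F (p : 'rV[R]_n * 'rV[R]_n) := cis (- dotp p.1 p.2) * f p.1 * (weight 1 p.2)%:C%C.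
have mF : cmeas F.
  apply: cmeasM.
    apply: cmeasM; last exact: (cmeas_comp (cL1_meas fi) measurable_fst).
    by apply: cmeas_cis; apply: measurable_funN; exact: measurable_dotp.
  by apply: cmeas_real; exact: measurableT_comp (measurable_weight e1) measurable_snd.
have Fb x y : nc (F (x, y)) <= nc (f x) * weight 1 y.
  by rewrite !ncM nc_cis nc_real mul1r ger0_norm// ltW// weight_gt0.
have H := cL1_partial2 mF ncf_ge0 (fun y => ltW (weight_gt0 1 y)) (cL1_nc fi)
  (rint_weight e1) Fb.
rewrite (_ : fourier f = fun xi =>
  cint mu (fun x => F (x, xi)) * ((weight 1 xi)^-1)%:C%C).
  apply: cmeasM; first exact: cL1_meas H.
  apply: cmeas_real; rewrite (_ : (fun x => _) = (fun xi : 'rV[R]_n =>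
    \prod_(i < n) expR (1 * `|xi ord0 i|))); last first.
    apply/funext => xi; rewrite /weight -prodfV; apply: eq_bigr => i _.
    by rewrite /pweight expRN invrK.
  apply: (measurable_prod_rV (f := fun _ t => expR (1 * `|t|))) => i.
  apply: (measurableT_comp (@measurable_expR R)); apply: measurable_funM.
    exact: measurable_cst.
  exact: normr_measurable.
apply/funext => xi.
have -> : cint mu (fun x => F (x, xi)) = fourier f xi * (weight 1 xi)%:C%C :=
  cintZr (weight 1 xi)%:C%C (cL1_cisM (measurable_dotp_left xi)).
by rewrite -mulrA -rmorphM divff ?mulr1// gt_eqF// weight_gt0.
Qed.

(** The weight makes the triple integral over [x], [y] and [xi] absolutely convergent; two exchanges
    bring the [xi] integral inside, where it produces the kernel. *)
Lemma fourier_weight e : 0 < e ->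
  (\int[mu]_xi (nc (fourier f xi) ^+ 2 * weight e xi))%:C%C =
  cint mu (fun x => cint mu (fun y => f x * (f y)^* * (kernel e (y - x))%:C%C)).
Proof.
move=> e0; pose C1 := \int[mu]_x nc (f x).
have C10 : 0 <= C1 by apply: Rintegral_ge0 => x _; exact: nc_ge0.
have w0 xi : 0 <= weight e xi by exact/ltW/weight_gt0.
pose F (p : 'rV[R]_n * 'rV[R]_n) := cis (- dotp p.1 p.2) * f p.1 *
  ((weight e p.2)%:C%C * (fourier f p.2)^*).
have mF : cmeas F.
  apply: cmeasM.
    apply: cmeasM; last exact: (cmeas_comp (cL1_meas fi) measurable_fst).
    by apply: cmeas_cis; apply: measurable_funN; exact: measurable_dotp.
  apply: cmeasM; last exact/cmeas_conj/(cmeas_comp cmeas_fourier measurable_snd).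
  by apply: cmeas_real; exact: measurableT_comp (measurable_weight e0) measurable_snd.
have Fb x y : nc (F (x, y)) <= nc (f x) * (C1 * weight e y).
  rewrite !ncM nc_cis mul1r nc_real nc_conj ler_wpM2l ?nc_ge0// mulrC ger0_norm//.
  by rewrite ler_wpM2r// nc_fourier.
have C1w xi : 0 <= C1 * weight e xi by exact: mulr_ge0.
have iw := rint_weight e0.
have S1 := cint_swap mF ncf_ge0 C1w (cL1_nc fi) (rintZ C1 iw) Fb.
transitivity (cint mu (fun xi => cint mu (fun x => F (x, xi)))).
  rewrite -cint_real; apply: cint_eq => xi.
  have -> : cint mu (fun x => F (x, xi)) =
      fourier f xi * ((weight e xi)%:C%C * (fourier f xi)^*) :=
    cintZr ((weight e xi)%:C%C * (fourier f xi)^*) (cL1_cisM (measurable_dotp_left xi)).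
  rewrite mulrCA mulc_conj -rmorphM; congr (_%:C%C).
  exact: mulrC.
rewrite -S1; apply: cint_eq => x.
pose G (p : 'rV[R]_n * 'rV[R]_n) := cis (dotp p.2 p.1 - dotp x p.1) * (f p.2)^* *
  (weight e p.1)%:C%C.
have mxl : measurable_fun setT (fun p : 'rV[R]_n * 'rV[R]_n => dotp x p.1).
  apply: measurable_sum => i; apply: measurable_funM; first exact: measurable_cst.
  exact: measurableT_comp (@measurable_coord R n i) measurable_fst.
have mG : cmeas G.
  apply: cmeasM; last by apply: cmeas_real;
    exact: measurableT_comp (measurable_weight e0) measurable_fst.
  apply: cmeasM; last exact/cmeas_conj/(cmeas_comp (cL1_meas fi) measurable_snd).
  apply: cmeas_cis; apply: measurable_funB; last exact: mxl.
  apply: measurable_sum => i; apply: measurable_funM.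
    exact: measurableT_comp (@measurable_coord R n i) measurable_snd.
  exact: measurableT_comp (@measurable_coord R n i) measurable_fst.
have Gb xi y : nc (G (xi, y)) <= weight e xi * nc (f y).
  by rewrite !ncM nc_cis mul1r nc_real nc_conj mulrC ger0_norm.
have S2 := cint_swap mG w0 ncf_ge0 iw (cL1_nc fi) Gb.
transitivity (f x * cint mu (fun xi => cint mu (fun y => G (xi, y)))).
  rewrite -cintZ; last exact: (cL1_partial1 mG w0 ncf_ge0 iw (cL1_nc fi) Gb).
  apply: cint_eq => xi.
  have cG : cL1 mu (fun y => cis (dotp y xi - dotp x xi) * (f y)^*).
    apply: (le_cL1 (v := fun x => nc (f x))); last exact: cL1_nc fi.
      apply: cmeasM; last exact/cmeas_conj/(cL1_meas fi).
      apply: cmeas_cis; apply: measurable_funB; last exact: measurable_cst.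
      apply: measurable_sum => i; apply: measurable_funM; last exact: measurable_cst.
      exact: measurable_coord.
    by move=> y; rewrite ncM nc_cis mul1r nc_conj.
  have -> : cint mu (fun y => G (xi, y)) =
      cint mu (fun y => cis (dotp y xi - dotp x xi) * (f y)^*) * (weight e xi)%:C%C :=
    cintZr (weight e xi)%:C%C cG.
  have -> : cint mu (fun y => cis (dotp y xi - dotp x xi) * (f y)^*) =
      cis (- dotp x xi) * (fourier f xi)^*; last first.
    change (cis (- dotp x xi) * f x * ((weight e xi)%:C%C * (fourier f xi)^*) =
      f x * (cis (- dotp x xi) * (fourier f xi)^* * (weight e xi)%:C%C)).
    by move: (cis _) (f x) (weight e xi)%:C%C (fourier f xi)^* => a b c d; ring.
  rewrite -[fourier f xi]/(cint mu _) -cint_conj; last first.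
    exact: cL1_cisM (measurable_dotp_left xi).
  rewrite -cintZ; last exact/cL1_conj/(cL1_cisM (measurable_dotp_left xi)).
  apply: cint_eq => y; rewrite conjM conj_cis opprK mulrA -cisD.
  by congr (cis _ * _); exact: addrC.
rewrite S2 -cintZ; last exact: (cL1_partial2 mG w0 ncf_ge0 iw (cL1_nc fi) Gb).
apply: cint_eq => y; rewrite -mulrA; congr (_ * _).
have [K1 K2] := cint_weight (y - x) e0.
rewrite -K2 -(cintZ _ K1); apply: cint_eq => xi.
change (cis (dotp y xi - dotp x xi) * (f y)^* * (weight e xi)%:C%C =
  (f y)^* * (cis (dotp (y - x) xi) * (weight e xi)%:C%C)).
by rewrite dotpDl dotpNl -mulrA mulrCA.
Qed.

End regularised.
End fourier_regularisation.

(** * Plancherel's identity with an explicit defect *)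

Section plancherel.
Context {R : realType} {n : nat}.
Notation fct := ('rV[R]_n -> R[i]).
Notation mu := (@lebesgue_rV R n).
Implicit Types (e : R) (x y z xi : 'rV[R]_n) (f : fct).

(** Tonelli and translation invariance; evenness of [k] lets the second integral be taken in the
    other variable. *)
Lemma ge0_integral_conv (g k : 'rV[R]_n -> R) (c : R) :
  measurable_fun setT g -> (forall x, 0 <= g x) ->
  measurable_fun setT k -> (forall z, 0 <= k z) -> (forall z, k (- z) = k z) ->
  (\int[mu]_z (k z)%:E = c%:E)%E ->
  (\int[(mu \x mu)%E]_p (g p.1 * k (p.2 - p.1))%:E = c%:E * \int[mu]_x (g x)%:E)%E /\
  (\int[(mu \x mu)%E]_p (g p.2 * k (p.2 - p.1))%:E = c%:E * \int[mu]_x (g x)%:E)%E.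
Proof.
move=> mg g0 mk k0 kN kc.
have mk2 : measurable_fun setT (fun p : 'rV[R]_n * 'rV[R]_n => k (p.2 - p.1)).
  exact: measurableT_comp mk measurable_rV_sub.
have c0 : 0 <= c.
  by rewrite -lee_fin -kc; apply: integral_ge0 => z _; rewrite lee_fin.
have shift x : (\int[mu]_y (k (y - x))%:E = c%:E)%E.
  rewrite -kc; apply: (ge0_integral_shift_rV (- x) (f := fun z => (k z)%:E)).
    exact/measurable_EFinP.
  by move=> z; rewrite lee_fin.
have main x : (\int[mu]_y (g x * k (y - x))%:E = c%:E * (g x)%:E)%E.
  under eq_integral do rewrite EFinM.
  rewrite ge0_integralZl//; first by rewrite shift muleC.
  - apply/measurable_EFinP; apply: measurableT_comp mk _.
    exact: measurable_shift_rV.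
  - by move=> y _; rewrite lee_fin.
  - by rewrite lee_fin.
split.
  rewrite fubini_tonelli1/=; last 2 first.
  - apply/measurable_EFinP; apply: measurable_funM => //.
    exact: measurableT_comp mg measurable_fst.
  - by move=> p; rewrite lee_fin mulr_ge0.
  rewrite /fubini_F; under eq_integral do rewrite main.
  rewrite ge0_integralZl//.
  - exact/measurable_EFinP.
  - by move=> x _; rewrite lee_fin.
rewrite fubini_tonelli2/=; last 2 first.
- apply/measurable_EFinP; apply: measurable_funM => //.
  exact: measurableT_comp mg measurable_snd.
- by move=> p; rewrite lee_fin mulr_ge0.
rewrite /fubini_G; under eq_integral => y _.
  rewrite (_ : (\int[_]_x _)%E = (c%:E * (g y)%:E)%E); last first.
    rewrite -main; apply: eq_integral => x _ /=.
    by rewrite -[in LHS]kN opprB.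
  over.
rewrite ge0_integralZl//.
- exact/measurable_EFinP.
- by move=> x _; rewrite lee_fin.
Qed.

Lemma kernel_le e z : 0 < e -> kernel e z <= (2 / e) ^+ n.
Proof.
move=> e0; rewrite -[X in _ <= _ ^+ X](card_ord n) -prodr_const.
by apply: ler_prod => i _; rewrite (ltW (pker_gt0 _ e0)) pker_le.
Qed.

Variable f : fct.
Hypotheses (fi : cL1 mu f) (f2 : L2 f).

Let mf : cmeas f := cL1_meas fi.

Definition modulus e : R :=
  \int[(mu \x mu)%E]_p (nc (f p.1 - f p.2) ^+ 2 * kernel e (p.2 - p.1)).

(** Take f(x) conj f(y) = a conj b in 2 Re (a conj b) = |a|^2 + |b|^2 - |a - b|^2. The two squares
    each integrate to (2 pi)^n |f|^2 by the mass of the kernel, and the last term is the defect. *)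
Lemma fourier_weight_modulus e : 0 < e ->
  \int[mu]_xi (nc (fourier f xi) ^+ 2 * weight e xi) =
  (2 * pi) ^+ n * nsq f - modulus e / 2.
Proof.
move=> e0; have k0 z : 0 <= kernel e z by exact/ltW/kernel_gt0.
have mk2 : measurable_fun setT (fun p : 'rV[R]_n * 'rV[R]_n => kernel e (p.2 - p.1)).
  exact: measurableT_comp (measurable_kernel e0) measurable_rV_sub.
pose F (p : 'rV[R]_n * 'rV[R]_n) := f p.1 * (f p.2)^* * (kernel e (p.2 - p.1))%:C%C.
have mF : cmeas F.
  apply: cmeasM; last exact: cmeas_real.
  apply: cmeasM; first exact: cmeas_comp mf measurable_fst.
  exact/cmeas_conj/(cmeas_comp mf measurable_snd).
pose a x := (2 / e) ^+ n * nc (f x).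
have e20 : 0 <= (2 / e) ^+ n by rewrite exprn_ge0// divr_ge0// ltW.
have a0 x : 0 <= a x by rewrite mulr_ge0 ?nc_ge0.
have b0 x : 0 <= nc (f x) by exact: nc_ge0.
have Fab x y : nc (F (x, y)) <= a x * nc (f y).
  rewrite !ncM nc_conj nc_real (ger0_norm (k0 _)) /a mulrC !mulrA.
  by rewrite !ler_wpM2r// kernel_le.
have ib := cL1_nc fi; have ia := rintZ ((2 / e) ^+ n) ib.
have [iF _] := cL1_prod mF a0 b0 ia ib Fab.
have := fourier_weight fi e0.
rewrite -(cint_prodE mF a0 b0 ia ib Fab) => -[-> _].
have /L2P[_ i2] := f2; have m2 := rint_meas i2.
have s0 x : 0 <= nc (f x) ^+ 2 by exact: sqr_ge0.
have [C1 C2] := ge0_integral_conv m2 s0 (measurable_kernel e0) k0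
  (fun z => kernelN e z) (integral_kernel e0).
have fin : (\int[mu]_x (nc (f x) ^+ 2)%:E = (nsq f)%:E)%E.
  rewrite /nsq fineK// ge0_fin_numE; first exact: (rint_lty mu m2 s0).1 i2.
  by apply: integral_ge0 => x _; rewrite lee_fin.
rewrite fin -EFinM in C1; rewrite fin -EFinM in C2.
have G1 : rint (mu \x mu)%E (fun p => nc (f p.1) ^+ 2 * kernel e (p.2 - p.1)).
  apply/rint_lty; last by rewrite C1 ltry.
    by apply: measurable_funM => //; exact: measurableT_comp m2 measurable_fst.
  by move=> p; rewrite mulr_ge0.
have G2 : rint (mu \x mu)%E (fun p => nc (f p.2) ^+ 2 * kernel e (p.2 - p.1)).
  apply/rint_lty; last by rewrite C2 ltry.
    by apply: measurable_funM => //; exact: measurableT_comp m2 measurable_snd.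
  by move=> p; rewrite mulr_ge0.
have E : modulus e = (2 * pi) ^+ n * nsq f + (2 * pi) ^+ n * nsq f +
    -2 * \int[(mu \x mu)%E]_p complex.Re (F p).
  rewrite -[X in X + _ + _](_ : \int[(mu \x mu)%E]_p (nc (f p.1) ^+ 2 * kernel e (p.2 - p.1)) = _); last first.
    by rewrite /Rintegral C1.
  rewrite -[X in _ + X + _](_ : \int[(mu \x mu)%E]_p (nc (f p.2) ^+ 2 * kernel e (p.2 - p.1)) = _); last first.
    by rewrite /Rintegral C2.
  rewrite -RintegralZl// -RintegralD// -RintegralD//; last 2 first.
  - exact: rintD.
  - exact: rintZ.
  apply: eq_Rintegral => -[x y] _; rewrite /F !sqr_nc /=.
  by case: (f x) => c d; case: (f y) => c' d' /=; ring.
rewrite E; lra.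
Qed.

Lemma modulus_ge0 e : 0 < e -> 0 <= modulus e.
Proof.
by move=> e0; apply: Rintegral_ge0 => p _; rewrite mulr_ge0 ?sqr_ge0// ltW// kernel_gt0.
Qed.

Lemma rint_fourier_weight e : 0 < e ->
  rint mu (fun xi => nc (fourier f xi) ^+ 2 * weight e xi).
Proof.
move=> e0; have iw := rint_weight (n := n) e0.
have mF := cmeas_fourier fi.
apply: (le_rint (v := fun xi => (\int[mu]_x nc (f x)) ^+ 2 * weight e xi)).
- apply: measurable_funM; [exact: measurable_sqr_nc|exact: rint_meas iw].
- move=> xi; rewrite ger0_norm; last by rewrite mulr_ge0 ?sqr_ge0// ltW// weight_gt0.
  rewrite ler_wpM2r//; first by rewrite ltW// weight_gt0.
  by rewrite lerXn2r ?nnegrE ?nc_ge0 ?nc_fourier// Rintegral_ge0// => x _; exact: nc_ge0.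
- exact: rintZ.
Qed.

Let ek k : R := k.+1%:R^-1.
Let ek0 k : 0 < ek k. Proof. by rewrite invr_gt0. Qed.

Lemma nondecreasing_weight xi (k m : nat) : (k <= m)%N ->
  weight (ek k) xi <= weight (ek m) xi.
Proof.
move=> km; apply: ler_prod => i _; rewrite expR_ge0/= ler_expR lerN2.
by rewrite ler_wpM2r// lef_pV2 ?posrE// ler_nat.
Qed.

Lemma cvg_weight xi : weight (ek k) xi @[k --> \oo] --> (1 : R).
Proof.
have -> : (1 : R) = \prod_(i < n) 1 by rewrite big1.
apply: (cvg_big (P := predT) (@mul_continuous R)) => i _; rewrite -(@expR0 R).
apply: (@continuous_cvg _ _ _ _ _ (fun k => - (ek k * `|xi ord0 i|)) (@expR R)); first exact: continuous_expR.
rewrite -[X in _ --> X]oppr0; apply: cvgN.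
rewrite -[X in _ --> X](mul0r `|xi ord0 i|); apply: cvgM; last exact: cvg_cst.
exact: cvg_harmonic.
Qed.

Lemma cvg_fourier_weight :
  (\int[mu]_xi (nc (fourier f xi) ^+ 2 * weight (ek k) xi)%:E @[k --> \oo] -->
   \int[mu]_xi (nc (fourier f xi) ^+ 2)%:E)%E.
Proof.
have mF := measurable_sqr_nc (cmeas_fourier fi).
have H := @cvg_monotone_convergence _ _ _ mu setT measurableT
  (fun k xi => (nc (fourier f xi) ^+ 2 * weight (ek k) xi)%:E).
rewrite (_ : (\int[mu]_xi (nc (fourier f xi) ^+ 2)%:E)%E = (\int[mu]_xi
   limn (fun k => (nc (fourier f xi) ^+ 2 * weight (ek k) xi)%:E))%E).
  apply: H => [k|k xi _|xi _ k m km].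
  - apply/measurable_EFinP; apply: measurable_funM => //.
    exact: measurable_weight.
  - by rewrite lee_fin mulr_ge0 ?sqr_ge0// ltW// weight_gt0.
  - by rewrite lee_fin ler_wpM2l ?sqr_ge0// nondecreasing_weight.
apply: eq_integral => xi _; apply/esym/cvg_lim => //.
apply/fine_cvgP; split; first exact: nearW.
rewrite -[X in _ --> X]mulr1; apply: cvgM; [exact: cvg_cst|exact: cvg_weight].
Qed.

Lemma fourier_bessel :
  (\int[mu]_xi (nc (fourier f xi) ^+ 2)%:E <= ((2 * pi) ^+ n * nsq f)%:E)%E.
Proof.
apply: (cvge_le _ cvg_fourier_weight); apply: nearW => k.
have H := rint_fourier_weight (ek0 k).
rewrite -[leLHS]fineK; last exact: integrable_fin_num H.
rewrite lee_fin -[fine _]/(\int[mu]_xi _) fourier_weight_modulus// gerBl.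
by rewrite divr_ge0 ?modulus_ge0.
Qed.

Lemma L2_fourier : L2 (fourier f).
Proof.
apply/L2P; split; first exact: cmeas_fourier.
apply/rint_lty; first exact/measurable_sqr_nc/cmeas_fourier.
  by move=> x; exact: sqr_ge0.
exact: le_lt_trans fourier_bessel (ltry _).
Qed.

Lemma nsq_fourier_le : nsq (fourier f) <= (2 * pi) ^+ n * nsq f.
Proof.
rewrite -lee_fin; apply: le_trans fourier_bessel; rewrite /nsq fineK//.
have /L2P[_ H] := L2_fourier.
exact: integrable_fin_num H.
Qed.

Lemma nsq_fourier : modulus (ek k) @[k --> \oo] --> (0 : R) ->
  nsq (fourier f) = (2 * pi) ^+ n * nsq f.
Proof.
move=> H; apply/eqP; rewrite eq_le nsq_fourier_le/=.
have C : (2 * pi) ^+ n * nsq f - modulus (ek k) / 2 @[k --> \oo] --> (2 * pi) ^+ n * nsq f.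
  rewrite -[X in _ --> X]subr0 -[X in _ - X](mul0r 2^-1).
  by apply: cvgB; [exact: cvg_cst|apply: cvgM => //; exact: cvg_cst].
apply: (cvgr_to_le C).
apply: nearW => k; rewrite -fourier_weight_modulus//.
have /L2P[mF i2] := L2_fourier.
apply: le_Rintegral => //; first exact: rint_fourier_weight.
by move=> xi _; rewrite ler_piMr ?sqr_ge0// weight_le1.
Qed.

End plancherel.

Lemma Rintegral_dominated_cvg d (T : measurableType d) (R : realType)
    (mu : {measure set T -> \bar R}) (f_ : nat -> T -> R) (f g : T -> R) :
  (forall k, measurable_fun setT (f_ k)) ->
  (forall x, f_ k x @[k --> \oo] --> f x) -> rint mu g ->
  (forall k x, `|f_ k x| <= g x) ->
  \int[mu]_x f_ k x @[k --> \oo] --> \int[mu]_x f x.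
Proof.
move=> mf cf ig fg.
have mf0 : measurable_fun setT f.
  by apply: (measurable_fun_cvg mf) => x _; exact: cf.
have fg0 x : `|f x| <= g x.
  by apply: (cvgr_to_le (cvg_norm (cf x))); apply: nearW => k; exact: fg.
have If : rint mu f by exact: (le_rint mf0 fg0 ig).
have := @dominated_cvg _ _ _ mu setT measurableT
  (fun k => EFin \o f_ k) (EFin \o f) (EFin \o g).
move=> /(_ _ _ _ ig _) H.
have {H} : (\int[mu]_x (f_ k x)%:E @[k --> \oo] --> \int[mu]_x (f x)%:E)%E.
  apply: H => [k|x _|//|k x _].
  - exact/measurable_EFinP.
  - by apply: cvg_EFin; [exact: nearW|exact: cf].
  - by rewrite lee_fin.
rewrite -[(\int[mu]_x (f x)%:E)%E]fineK; last exact: integrable_fin_num If.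
by move=> /fine_cvgP[_].
Qed.

(** * The kernel as an approximate identity *)

Section approximate_identity.
Context {R : realType}.

Let ek k : R := k.+1%:R^-1.
Let ek0 k : 0 < ek k. Proof. by rewrite invr_gt0. Qed.
Let ek1 k : ek k <= 1. Proof. by rewrite invf_le1// ler1n. Qed.

(** A first moment of the kernel. Since [pker e] decays like t^-2, the factor |t| has to be cut off
    at 1 for the product to be integrable. *)
Definition mpker (e t : R) : R := Num.min 1 `|t| * pker e t.

Lemma mpker_ge0 e t : 0 < e -> 0 <= mpker e t.
Proof. by move=> e0; rewrite mulr_ge0 ?(ltW (pker_gt0 _ e0))// le_min ler01 normr_ge0. Qed.

Lemma measurable_mpker e : 0 < e -> measurable_fun setT (mpker e).
Proof.
move=> e0; apply: measurable_funM; last exact: measurable_pker.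
by apply: measurable_minr; [exact: measurable_cst|exact: normr_measurable].
Qed.

(** A majorant independent of [e]. For |t| <= 1, 2 e |t| <= e^2 + t^2 bounds the left side by 1; for
    |t| >= 1 it is at most 2 / t^2. *)
Lemma mpker_le e t : 0 < e <= 1 -> mpker e t <= 2 * pker 1 t.
Proof.
move=> /andP[e0 e1]; have d0 : 0 < e ^+ 2 + t ^+ 2 by rewrite ltr_pwDl ?exprn_gt0// sqr_ge0.
have d1 : 0 < 1 ^+ 2 + t ^+ 2 :> R by rewrite ltr_pwDl ?exprn_gt0// sqr_ge0.
rewrite /mpker /pker !mulrA ler_pdivrMr// [leRHS]mulrAC ler_pdivlMr//.
have := sqr_ge0 (`|t| - e); have := real_normK (num_real t); have := normr_ge0 t.
set s := `|t| => s0 st; rewrite -st => se.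
have [s1|s1] := leP 1 s.
  have s2 : 1 <= s ^+ 2 by rewrite exprn_ege1.
  have : e * s ^+ 2 <= s ^+ 2 by rewrite ler_piMl ?sqr_ge0.
  have := sqr_ge0 e; rewrite expr1n; lra.
have s2 : s ^+ 2 <= 1 by rewrite exprn_ile1// ltW.
have : 2 * s * e * (1 + s ^+ 2) <= (e ^+ 2 + s ^+ 2) * 2.
  by apply: ler_pM; rewrite ?addr_ge0 ?mulr_ge0 ?sqr_ge0 ?(ltW e0)//; lra.
have := sqr_ge0 e; have := sqr_ge0 s; rewrite expr1n.
lra.
Qed.

Lemma cvg_mpker t : mpker (ek k) t @[k --> \oo] --> (0 : R).
Proof.
have [->|t0] := eqVneq t 0.
  rewrite (_ : (fun k => _) = fun=> 0); first exact: cvg_cst.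
  by apply/funext => k; rewrite /mpker normr0 min_r// mul0r.
have t2 : 0 < t ^+ 2 by rewrite exprn_even_gt0.
apply: (@squeeze_cvgr _ _ _ _ (fun=> 0) (fun k => 2 / t ^+ 2 * ek k)).
- apply: nearW => k; rewrite mpker_ge0//=.
  have d0 : 0 < ek k ^+ 2 + t ^+ 2 by rewrite ltr_pwDl ?exprn_gt0// sqr_ge0.
  apply: (@le_trans _ _ (pker (ek k) t)).
    by rewrite /mpker ler_piMl ?(ltW (pker_gt0 _ _))// ge_min lexx.
  rewrite /pker ler_pdivrMr// mulrDr.
  rewrite (_ : _ * t ^+ 2 = 2 * ek k); last by field.
  by rewrite lerDr !mulr_ge0// ?invr_ge0 ?ltW// exprn_ge0// ltW.
- exact: cvg_cst.
- rewrite -[X in _ --> X](mulr0 (2 / t ^+ 2)); apply: cvgM; first exact: cvg_cst.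
  exact: cvg_harmonic.
Qed.

Lemma rint_mpker k : rint lebesgue_measure (mpker (ek k)).
Proof.
have ip : rint lebesgue_measure (pker (1 : R)).
  apply/rint_lty; first exact: measurable_pker.
    by move=> t; exact/ltW/pker_gt0.
  by rewrite integral_pker// ltry.
apply: le_rint (rintZ 2 ip); first exact: measurable_mpker.
by move=> t; rewrite ger0_norm ?mpker_ge0// mpker_le// ek0 ek1.
Qed.

Lemma cvg_integral_mpker :
  \int[lebesgue_measure]_t mpker (ek k) t @[k --> \oo] --> (0 : R).
Proof.
have ip : rint lebesgue_measure (pker (1 : R)).
  apply/rint_lty; first exact: measurable_pker.
    by move=> t; exact/ltW/pker_gt0.
  by rewrite integral_pker// ltry.
rewrite -[X in _ --> X](_ : \int[lebesgue_measure]_(t in @setT R) (0:R) = 0); last first.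
  by rewrite /Rintegral integral0_eq.
apply: (@Rintegral_dominated_cvg _ (measurableTypeR R) R lebesgue_measure
  (fun k => mpker (ek k)) (fun=> 0) (fun t => 2 * pker 1 t)).
- by move=> k; exact: measurable_mpker.
- exact: cvg_mpker.
- exact: rintZ.
- by move=> k t; rewrite ger0_norm ?mpker_ge0// mpker_le// ek0 ek1.
Qed.

End approximate_identity.

Section modulus.
Context {R : realType} {n : nat}.
Notation fct := ('rV[R]_n -> R[i]).
Notation mu := (@lebesgue_rV R n).
Variable f : fct.
Hypotheses (fi : cL1 mu f) (f2 : L2 f).

Let ek k : R := k.+1%:R^-1.
Let ek0 k : 0 < ek k. Proof. by rewrite invr_gt0. Qed.

Definition mkernel (i : 'I_n) (e : R) (z : 'rV[R]_n) : R :=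
  \prod_(j < n) (if j == i then mpker e else pker e) (z ord0 j).

Lemma mkernelE i e z : mkernel i e z = Num.min 1 `|z ord0 i| * kernel e z.
Proof.
rewrite /mkernel /kernel (bigD1 i)//= [in RHS](bigD1 i)//= eqxx mulrA.
by congr (_ * _); apply: eq_bigr => j /negbTE ->.
Qed.

Lemma mkernel_ge0 i e z : 0 < e -> 0 <= mkernel i e z.
Proof.
by move=> e0; apply: prodr_ge0 => j _; case: ifP => _; [exact: mpker_ge0|exact/ltW/pker_gt0].
Qed.

Lemma measurable_mkernel i e : 0 < e -> measurable_fun setT (mkernel i e).
Proof.
move=> e0; apply: (measurable_prod_rV (f := fun j => if j == i then mpker e else pker e)) => j.
by case: ifP => _; [exact: measurable_mpker|exact: measurable_pker].
Qed.

Lemma integral_mkernel i k :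
  (\int[mu]_z (mkernel i (ek k) z)%:E =
   ((\int[lebesgue_measure]_t mpker (ek k) t) * (2 * pi) ^+ n.-1)%:E)%E.
Proof.
pose c (j : 'I_n) := if j == i then \int[lebesgue_measure]_t mpker (ek k) t else 2 * pi.
rewrite (integral_rV_prod (f := fun j => if j == i then mpker (ek k) else pker (ek k)) (c := c)).
- rewrite (bigD1 i)//= /c eqxx; congr (_ * _)%:E.
  rewrite (eq_bigr (fun=> 2 * pi)); last by move=> j /negbTE ->.
  by rewrite prodr_const cardC1 card_ord.
- by move=> j t; case: ifP => _; [exact: mpker_ge0|exact/ltW/pker_gt0].
- by move=> j; case: ifP => _; [exact: measurable_mpker|exact: measurable_pker].
- move=> j; rewrite /c; case: ifP => _; last exact: integral_pker.
  by rewrite fineK//; exact: integrable_fin_num (rint_mpker k).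
Qed.

(** The assumed bound is linear in |f|, so the defect is at most a multiple of the L^1 norm of f
    times the truncated first moment in one direction. The n - 1 other directions contribute a mass
    2 pi each. *)
Lemma cvg_modulus (C : R) : 0 <= C ->
  (forall x y, nc (f x - f y) ^+ 2 <=
     C * \sum_(i < n) Num.min 1 `|(y - x) ord0 i| * (nc (f x) + nc (f y))) ->
  modulus f (ek k) @[k --> \oo] --> (0 : R).
Proof.
move=> C0 hf; have mf := cL1_meas fi; have nf := cL1_nc fi.
pose m k := \int[lebesgue_measure]_t mpker (ek k) t.
have m0 k : 0 <= m k by apply: Rintegral_ge0 => t _; exact: mpker_ge0.
pose N1 := \int[mu]_x nc (f x).
pose D := C * n%:R * (2 * pi) ^+ n.-1 * N1 * 2.
apply: (@squeeze_cvgr _ _ _ _ (fun=> 0) (fun k => D * m k)).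
- apply: nearW => k; rewrite modulus_ge0//=.
  have fin : (\int[mu]_x (nc (f x))%:E = N1%:E)%E.
    by rewrite fineK//; exact: integrable_fin_num nf.
  have mk i : measurable_fun setT (fun p : 'rV[R]_n * 'rV[R]_n => mkernel i (ek k) (p.2 - p.1)).
    exact: measurableT_comp (measurable_mkernel i (ek0 k)) measurable_rV_sub.
  have kN i z : mkernel i (ek k) (- z) = mkernel i (ek k) z.
    by rewrite !mkernelE kernelN mxE normrN.
  have nf0 x : 0 <= nc (f x) by exact: nc_ge0.
  have H i := ge0_integral_conv (rint_meas nf) nf0 (measurable_mkernel i (ek0 k))
    (fun z => mkernel_ge0 i z (ek0 k)) (kN i) (integral_mkernel i k).
  have G i : rint (mu \x mu)%E (fun p => nc (f p.1) * mkernel i (ek k) (p.2 - p.1)) /\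
             rint (mu \x mu)%E (fun p => nc (f p.2) * mkernel i (ek k) (p.2 - p.1)).
    have [H1 H2] := H i; split.
      apply/rint_lty; last by rewrite H1 fin -EFinM ltry.
        apply: measurable_funM => //; exact: measurableT_comp (rint_meas nf) measurable_fst.
      by move=> p; rewrite mulr_ge0// mkernel_ge0.
    apply/rint_lty; last by rewrite H2 fin -EFinM ltry.
      apply: measurable_funM => //; exact: measurableT_comp (rint_meas nf) measurable_snd.
    by move=> p; rewrite mulr_ge0// mkernel_ge0.
  have G12 i := rintD (G i).1 (G i).2.
  have GS (s : seq 'I_n) : rint (mu \x mu)%E (fun p => \sum_(i <- s)
        (nc (f p.1) * mkernel i (ek k) (p.2 - p.1) + nc (f p.2) * mkernel i (ek k) (p.2 - p.1))) /\
      \int[(mu \x mu)%E]_p (\sum_(i <- s)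
        (nc (f p.1) * mkernel i (ek k) (p.2 - p.1) + nc (f p.2) * mkernel i (ek k) (p.2 - p.1)))
      = (size s)%:R * (m k * (2 * pi) ^+ n.-1 * N1 * 2).
    elim: s => [|i s [IH1 IH2]].
      split; first by under eq_fun do rewrite big_nil; exact: integrable0.
      under eq_Rintegral do rewrite big_nil.
      by rewrite mul0r /Rintegral integral0_eq.
    split; first by under eq_fun do rewrite big_cons; exact: rintD.
    under eq_Rintegral do rewrite big_cons.
    rewrite (RintegralD measurableT (G12 i) IH1) IH2 (RintegralD measurableT (G i).1 (G i).2).
    rewrite /Rintegral (H i).1 (H i).2 fin -EFinM/= -/(m k).
    rewrite -[(size s).+1%:R]natr1; ring.
  have [GS1 GS2] := GS (index_enum 'I_n).
  apply: (@le_trans _ _ (\int[(mu \x mu)%E]_p (C * \sum_(i < n)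
        (nc (f p.1) * mkernel i (ek k) (p.2 - p.1) + nc (f p.2) * mkernel i (ek k) (p.2 - p.1))))).
    have bd p : nc (f p.1 - f p.2) ^+ 2 * kernel (ek k) (p.2 - p.1) <=
      C * \sum_(i < n) (nc (f p.1) * mkernel i (ek k) (p.2 - p.1) + nc (f p.2) * mkernel i (ek k) (p.2 - p.1)).
      apply: (@le_trans _ _ ((C * \sum_(i < n) Num.min 1 `|(p.2 - p.1) ord0 i| * (nc (f p.1) + nc (f p.2))) * kernel (ek k) (p.2 - p.1))).
        by rewrite ler_wpM2r ?hf// ltW// kernel_gt0.
      rewrite -mulrA ler_wpM2l// mulr_suml le_eqVlt; apply/orP; left; apply/eqP.
      by apply: eq_bigr => i _; rewrite mkernelE; ring.
    apply: le_Rintegral => //; last exact: rintZ.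
    apply: le_rint (rintZ C GS1).
      apply: measurable_funM; last first.
        exact: measurableT_comp (measurable_kernel (ek0 k)) measurable_rV_sub.
      apply: measurable_sqr_nc; apply: cmeasD.
        exact: cmeas_comp mf measurable_fst.
      under eq_fun do rewrite -mulN1r.
      by apply: cmeasM; [exact: cmeas_cst|exact: cmeas_comp mf measurable_snd].
    move=> p; rewrite ger0_norm; first exact: bd.
    by rewrite mulr_ge0 ?sqr_ge0// ltW// kernel_gt0.
  rewrite RintegralZl// GS2 -[index_enum _]enumT size_enum_ord /D.
  by rewrite le_eqVlt; apply/orP; left; apply/eqP; ring.
- exact: cvg_cst.
- rewrite -[X in _ --> X](mulr0 D); apply: cvgM; first exact: cvg_cst.
  exact: cvg_integral_mpker.
Qed.

Lemma plancherel (C : R) : 0 <= C ->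
  (forall x y, nc (f x - f y) ^+ 2 <=
     C * \sum_(i < n) Num.min 1 `|(y - x) ord0 i| * (nc (f x) + nc (f y))) ->
  nsq (fourier f) = (2 * pi) ^+ n * nsq f.
Proof. by move=> C0 hf; apply: (nsq_fourier fi f2); exact: cvg_modulus C0 hf. Qed.

End modulus.

(** * Schwartz functions *)

Section continuous_measurable_rV.
Context {R : realType} {n : nat}.
Implicit Types (x y : 'rV[R]_n).

Let grid (k : nat) (z : 'rV[int]_n) : 'rV[R]_n := \row_i ((z ord0 i)%:~R / k.+1%:R).
Let cell (k : nat) x : 'rV[int]_n := \row_i Num.floor (k.+1%:R * x ord0 i).

Let measurable_cell k z : measurable [set x | cell k x = z].
Proof.
rewrite (_ : [set x | _] = \bigcap_(i in [set: 'I_n]) ((fun x => x ord0 i) @^-1`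
    `[(z ord0 i)%:~R / k.+1%:R, (z ord0 i + 1)%:~R / k.+1%:R[%classic)).
  apply: fin_bigcap_measurable; first exact: finite_finset.
  by move=> i _; rewrite -[X in measurable X]setTI; exact: measurable_coord.
apply/seteqP; split => x /=.
  move=> <- i _ /=; rewrite in_itv/= !mxE ler_pdivrMr// ltr_pdivlMr// mulrC.
  exact: floor_itv.
move=> H; apply/rowP => i; rewrite mxE; apply: floor_def.
have := H i Logic.I; rewrite /= in_itv/= ler_pdivrMr// ltr_pdivlMr//.
by rewrite mulrC.
Qed.

(** The sigma-algebra is generated by coordinates, so [f] is approached by its values on the grid of
    mesh 1 / (k + 1): step functions with countably many measurable cells. *)
Lemma continuous_measurable_rV (f : 'rV[R]_n -> R) :
  continuous f -> measurable_fun setT f.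
Proof.
move=> cf; apply: (@measurable_fun_cvg _ _ _ setT (fun k x => f (grid k (cell k x)))).
  move=> k _ B mB; rewrite setTI.
  rewrite (_ : _ @^-1` _ = \bigcup_(z : 'rV[int]_n)
      ([set x | cell k x = z] `&` [set x | f (grid k z) \in B])).
    apply: countable_bigcupT_measurable; first exact: countableP.
    move=> z; apply: measurableI; first exact: measurable_cell.
    by have [fB|fB] := boolP (f (grid k z) \in B);
      [rewrite (_ : [set _ | _] = setT)//|rewrite (_ : [set _ | _] = set0)//];
      apply/seteqP; split => x //=; rewrite (negbTE fB).
  apply/seteqP; split => x /=.
    by move=> fB; exists (cell k x) => //; split => //=; rewrite inE.
  by move=> [z _ [/= <-]]; rewrite inE.
move=> x _; apply/cvgrPdist_lt => e e0.
have /cvgrPdist_lt/(_ e e0)/nbhs_ballP[d/= d0 H] := cf x.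
near=> k; apply: H; split => // i j; rewrite !mxE ord1 /ball/=.
have k0 : 0 < k.+1%:R :> R by [].
have /andP[h1 h2] := floor_itv (k.+1%:R * x ord0 j).
have kd : k.+1%:R^-1 < d by near: k; exact: near_infty_natSinv_lt (PosNum d0).
rewrite ger0_norm; last by rewrite subr_ge0 ler_pdivrMr// [leRHS]mulrC.
apply: le_lt_trans kd; rewrite lerBlDl -(ler_pM2r k0) mulrDl mulVf ?gt_eqF//.
rewrite divfK ?gt_eqF// [leLHS]mulrC; rewrite intrD in h2; exact: ltW h2.
Unshelve. all: by end_near. Qed.

End continuous_measurable_rV.

Section decay_weight.
Context {R : realType} {n : nat}.
Implicit Types (x y : 'rV[R]_n).

(** A product weight, so that [bracket x ^- N] is integrable for every N > 1 whatever the
    dimension. *)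
Definition bracket x : R := \prod_(i < n) (1 + `|x ord0 i|).

Lemma bracket_ge1 x : 1 <= bracket x.
Proof.
rewrite /bracket; elim/big_ind : _ => // [a b a1 b1|i _]; last by rewrite lerDl.
by rewrite -[1]mulr1 ler_pM.
Qed.

Lemma bracket_gt0 x : 0 < bracket x.
Proof. exact: lt_le_trans (bracket_ge1 x). Qed.

Lemma rint_bracket (N : nat) : (1 < N)%N ->
  rint (lebesgue_rV n) (fun x => bracket x ^- N).
Proof.
move=> N1; rewrite (_ : (fun x => _) = (fun x : 'rV[R]_n =>
    \prod_(i < n) (1 + `|x ord0 i|) `^ (- N%:R))).
  apply: (rint_rV_prod (f := fun _ t => (1 + `|t|) `^ (- N%:R))) => [i t|i].
    exact: powR_ge0.
  apply/rint_lty; last by apply: integral_powR_decay; rewrite ltr1n.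
    exact: continuous_measurable_fun (@powR_decay_continuous R N%:R).
  by move=> t; exact: powR_ge0.
apply/funext => x; rewrite -exprVn -prodfV -prodrXl; apply: eq_bigr => i _.
by rewrite powRN powR_mulrn ?addr_ge0// exprVn.
Qed.

Lemma sum_le_bracket x : 1 + \sum_(i < n) `|x ord0 i| <= bracket x.
Proof.
rewrite /bracket; elim: (index_enum _) => [|i s IHs]; first by rewrite !big_nil addr0.
rewrite !big_cons; apply: (@le_trans _ _ ((1 + `|x ord0 i|) * (1 + \sum_(j <- s) `|x ord0 j|))).
  have : 0 <= `|x ord0 i| * \sum_(j <- s) `|x ord0 j| by rewrite mulr_ge0// sumr_ge0.
  lra.
by rewrite ler_wpM2l// addr_ge0.
Qed.

Lemma bracket_shift x i t : `|t| <= 1 ->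
  bracket x <= 2 * bracket (x + t *: basis_rV i).
Proof.
move=> t1; rewrite /bracket (bigD1 i)//= [in leRHS](bigD1 i)//= mulrA.
rewrite (eq_bigr (fun j => 1 + `|x ord0 j|)); last by [].
rewrite [in leRHS](eq_bigr (fun j => 1 + `|x ord0 j|)); last first.
  by move=> j /negbTE ji; rewrite !mxE eqxx ji mulr0 addr0.
apply: ler_wpM2r; first by apply: prodr_ge0 => j _; rewrite addr_ge0.
rewrite !mxE !eqxx mulr1.
have := ler_normB (x ord0 i + t) t; rewrite addrK => h.
have := normr_ge0 (x ord0 i + t); lra.
Qed.

End decay_weight.

Section schwartz_decay.
Context {R : realType} {n : nat}.
Notation fct := ('rV[R]_n -> R[i]).
Implicit Types (u : fct).

(* On each of the [2 ^ n] regions cut out by the conditions [1 <= |x_i|], the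
   weight [bracket x ^+ N] is comparable to one monomial. *)
Lemma monomial_decay (g : 'rV[R]_n -> R) (N : nat) : (forall x, 0 <= g x) ->
  (forall alpha : 'I_n -> nat, exists C : R, forall x : 'rV[R]_n,
     `|\prod_(i < n) x ord0 i ^+ alpha i| * g x <= C) ->
  exists2 C : R, 0 <= C & forall x, g x <= C * bracket x ^- N.
Proof.
move=> g0 H; pose al (b : {ffun 'I_n -> bool}) (i : 'I_n) := if b i then N else 0%N.
pose C b := sval (cid (H (al b))).
have HC b (x : 'rV[R]_n) : `|\prod_(i < n) x ord0 i ^+ al b i| * g x <= C b.
  exact: (svalP (cid (H (al b)))).
have C0 b : 0 <= C b by apply: le_trans (HC b 0); rewrite mulr_ge0.
exists ((2 ^+ n) ^+ N * \sum_b C b); first by rewrite mulr_ge0 ?sumr_ge0// ?exprn_ge0.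
move=> x; rewrite ler_pdivlMr ?exprn_gt0 ?bracket_gt0//.
pose b := [ffun i => 1 <= `|x ord0 i|].
apply: (@le_trans _ _ ((2 ^+ n) ^+ N * C b)); last first.
  rewrite ler_wpM2l ?exprn_ge0// (bigD1 b)//= lerDl; exact: sumr_ge0.
apply: (@le_trans _ _ ((2 ^+ n) ^+ N * (`|\prod_(i < n) x ord0 i ^+ al b i| * g x)));
  last by rewrite ler_wpM2l ?exprn_ge0.
rewrite mulrC [leRHS]mulrA ler_wpM2r// normr_prod.
rewrite -[X in (_ ^+ X) ^+ _](card_ord n) -prodr_const -!prodrXl -big_split/=.
apply: ler_prod => i _; rewrite exprn_ge0/= ?addr_ge0// normrX /al ffunE.
case: ifP => [x1|/negbT]; last first.
  rewrite -ltNge => x1; rewrite expr0 mulr1 lerXn2r ?nnegrE ?addr_ge0//.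
  by rewrite -[2]/(1 + 1) lerD2l ltW.
by rewrite -exprMn lerXn2r ?nnegrE ?addr_ge0 ?mulr_ge0//; lra.
Qed.

Lemma schwartz_decay u (beta : 'I_n -> nat) (N : nat) : schwartz u ->
  exists2 C : R, 0 <= C & forall x,
    nc (cmulti_deriv (@basis_rV R n) beta u x) <= C * bracket x ^- N.
Proof.
move=> [_ H]; apply: (@monomial_decay
  (fun x => nc (cmulti_deriv (@basis_rV R n) beta u x))) => [x|al].
  exact: nc_ge0.
exact: H.
Qed.

End schwartz_decay.

(** * Derivatives along coordinate lines *)

Section line_derivative.
Context {R : realType} {n : nat}.
Implicit Types (x e : 'rV[R]_n) (P Q : 'rV[R]_n -> R).

(** Stated as a one-variable derivative on each line, so that the mean value theorem and the
    one-variable rules apply. *)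
Definition line_deriv P Q e : Prop :=
  forall x (t : R), is_derive t 1 (fun s : R => P (x + s *: e)) (Q (x + t *: e)).

Lemma derivable_line_deriv P e :
  (forall x, derivable P x e) -> line_deriv P ('D_e P) e.
Proof.
move=> dP x t; set phi := fun s : R => _.
have E : (fun h : R => h^-1 *: ((phi \o shift t) (h *: 1) - phi t)) =
    (fun h : R => h^-1 *: ((P \o shift (x + t *: e)) (h *: e) - P (x + t *: e))).
  apply/funext => h; congr (_ *: (_ - _)); rewrite /phi /= /shift/=.
  by congr P; rewrite -[h *: 1]/(h * 1) mulr1 scalerDl addrCA.
by split; [rewrite /derivable E; exact: dP|rewrite /derive E].
Qed.

Variables (P Q : 'rV[R]_n -> R) (i : 'I_n) (C : R) (N : nat).
Let e := @basis_rV R n i.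
Hypotheses (PQ : line_deriv P Q e) (C0 : 0 <= C).
Hypothesis Qb : forall x, `|Q x| <= C * bracket x ^- N.

Lemma line_deriv_continuous x : continuous (fun s : R => P (x + s *: e)).
Proof.
move=> t; apply: differentiable_continuous; apply/derivable1_diffP.
by have [] := PQ x t.
Qed.

Lemma line_deriv_lip x (t : R) : 0 <= t ->
  `|P (x + t *: e) - P x| <= t * C.
Proof.
move=> t0; have [c _] := @MVT_segment _ _ (fun s => Q (x + s *: e)) 0 t t0
  (fun s _ => PQ x s) (continuous_subspaceT (@line_deriv_continuous x)).
rewrite scale0r addr0 subr0 => ->; rewrite normrM (ger0_norm t0) mulrC.
rewrite ler_wpM2l//; apply: le_trans (Qb _) _; rewrite ler_piMr//.
by rewrite invf_le1 ?exprn_gt0 ?bracket_gt0// exprn_ege1// bracket_ge1.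
Qed.

(** Supplies the integrable majorant of the difference quotients; 2^N is the price for moving the
    weight from an intermediate point back to [x]. *)
Lemma line_deriv_bound x (t : R) : 0 <= t <= 1 ->
  `|P (x + t *: e) - P x| <= t * (C * 2 ^+ N * bracket x ^- N).
Proof.
move=> /andP[t0 t1]; have [c] := @MVT_segment _ _ (fun s => Q (x + s *: e)) 0 t t0
  (fun s _ => PQ x s) (continuous_subspaceT (@line_deriv_continuous x)).
rewrite in_itv/= => /andP[c0 ct].
rewrite scale0r addr0 subr0 => ->; rewrite normrM (ger0_norm t0) mulrC.
rewrite ler_wpM2l//; apply: le_trans (Qb _) _; rewrite -mulrA ler_wpM2l//.
rewrite ler_pdivlMr ?exprn_gt0 ?bracket_gt0// mulrC ler_pdivrMr ?exprn_gt0 ?bracket_gt0//.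
rewrite -exprMn lerXn2r ?nnegrE ?mulr_ge0 ?(ltW (bracket_gt0 _))//.
by apply: bracket_shift; rewrite ger0_norm// (le_trans ct).
Qed.

(** Difference quotients of [P] have integral zero by translation invariance, and dominated
    convergence passes this on to the derivative. *)
Lemma Rintegral_line_deriv : (1 < N)%N -> rint (lebesgue_rV n) P ->
  \int[lebesgue_rV n]_x Q x = 0.
Proof.
move=> N1 iP; have mP := rint_meas iP.
pose h k : R := k.+1%:R^-1; have h0 k : 0 < h k by rewrite invr_gt0.
have h1 k : h k <= 1 by rewrite invf_le1// ler1n.
pose f k x := (h k)^-1 * (P (x + h k *: e) - P x).
have mPh k : measurable_fun setT (fun x => P (x + h k *: e)).
  exact: measurableT_comp mP (measurable_shift_rV _).
have D := @Rintegral_dominated_cvg _ _ R (lebesgue_rV n) f Q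
  (fun x => C * 2 ^+ N * bracket x ^- N).
have {D} : \int[lebesgue_rV n]_x f k x @[k --> \oo] --> \int[lebesgue_rV n]_x Q x.
  apply: D.
  - move=> k; apply: measurable_funM; first exact: measurable_cst.
    exact: measurable_funB.
  - move=> x; have [d1 d2] := PQ x 0.
    have : (fun s : R => s^-1 *: (P (x + (s *: 1 + 0) *: e) - P (x + 0 *: e))) s
        @[s --> 0^'] --> Q x.
      by rewrite scale0r addr0 in d2; rewrite -d2; exact: d1.
    rewrite scale0r addr0 => H.
    have hc : h @ \oo --> (0 : R)^'.
      move=> U [d /= d0 dU]; have := @cvg_harmonic R.
      move=> /cvgrPdist_lt/(_ d d0); apply: filterS => k hk.
      by apply: dU; [exact: hk|rewrite gt_eqF].
    have := cvg_comp _ _ hc H; apply: cvg_trans.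
    by apply: near_eq_cvg; apply: nearW => k /=; rewrite /f addr0 -[h k *: 1]/(h k * 1) mulr1.
  - exact: rintZ (rint_bracket N1).
  - move=> k x; rewrite /f normrM gtr0_norm ?invr_gt0//.
    by rewrite ler_pdivrMl// line_deriv_bound// h1 ltW.
have -> : (fun k => \int[lebesgue_rV n]_x f k x) = fun=> 0.
  apply/funext => k; rewrite /f.
  have iPh : rint (lebesgue_rV n) (fun x => P (x + h k *: e)).
    apply/integrableP; split; first exact/measurable_EFinP.
    rewrite (ge0_integral_shift_rV (h k *: e) (f := fun x => `|(P x)%:E|%E)).
    - by have /integrableP[] := iP.
    - by apply: measurableT_comp => //; exact/measurable_EFinP.
    - by move=> x; exact: abse_ge0.
  rewrite RintegralZl//; last first.
    by have := rintD iPh (rintZ (-1) iP); under eq_fun do rewrite mulN1r.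
  by rewrite RintegralB// Rintegral_shift_rV// subrr mulr0.
by move=> /cvg_lim <-//; rewrite lim_cst.
Qed.

End line_derivative.

Section fourier_derivative.
Context {R : realType} {n : nat}.
Notation fct := ('rV[R]_n -> R[i]).
Notation mu := (@lebesgue_rV R n).
Implicit Types (x xi : 'rV[R]_n).

Lemma cL1_bracket (f : fct) (C : R) (N : nat) : (1 < N)%N -> cmeas f ->
  (forall x, nc (f x) <= C * bracket x ^- N) -> cL1 mu f.
Proof. by move=> N1 mf fC; apply: le_cL1 mf fC _; exact: rintZ (rint_bracket N1). Qed.

(** [G] is the derivative of cis (- x.xi) f(x) in direction [i], so its integral vanishes; written
    out, that is the claim. *)
Lemma fourier_line_deriv (f g : fct) (i : 'I_n) (C : R) (N : nat) xi :
  (1 < N)%N -> cmeas f -> cmeas g -> 0 <= C ->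
  line_deriv (fun x => complex.Re (f x)) (fun x => complex.Re (g x)) (basis_rV i) ->
  line_deriv (fun x => complex.Im (f x)) (fun x => complex.Im (g x)) (basis_rV i) ->
  (forall x, nc (f x) <= C * bracket x ^- N) ->
  (forall x, nc (g x) <= C * bracket x ^- N) ->
  fourier g xi = Complex 0 (xi ord0 i) * fourier f xi.
Proof.
move=> N1 mf mg C0 dr di fC gC.
have fi := cL1_bracket N1 mf fC; have gi := cL1_bracket N1 mg gC.
have md := measurable_dotp_left xi.
pose G x := cis (- dotp x xi) * (g x + - Complex 0 (xi ord0 i) * f x).
have iG : cL1 mu G by apply: (cL1_cisM _ md); apply: cL1D => //; exact: cL1Z.
have iF := cL1_cisM fi md.
pose C' := C + `|xi ord0 i| * C.
have C'0 : 0 <= C' by rewrite addr_ge0// mulr_ge0.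
have Gb x : nc (G x) <= C' * bracket x ^- N.
  rewrite ncM nc_cis mul1r (le_trans (ncD _ _))// ncM ncN mulrDl lerD//.
  rewrite -mulrA ler_pM ?nc_ge0//.
  by rewrite /= expr0n/= add0r sqrtr_sqr.
have dth x (t : R) : is_derive t (1 : R) (fun s : R => - dotp (x + s *: basis_rV i) xi) (- xi ord0 i).
  rewrite (_ : (fun s => _) = fun s : R => (- xi ord0 i) * s + (- dotp x xi)).
    have d1 : is_derive t (1 : R) (fun s : R => (- xi ord0 i) * s) ((- xi ord0 i) * 1).
      exact: (@is_deriveZ _ _ _ id (- xi ord0 i)).
    have d2 : is_derive t (1 : R) (fun s : R => (- xi ord0 i) * s + (- dotp x xi))
      ((- xi ord0 i) * 1 + 0) := is_deriveD d1 (is_derive_cst (- dotp x xi) t 1).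
    by apply: is_derive_eq d2 _; rewrite addr0 mulr1.
  apply/funext => s; rewrite dotpDl opprD addrC; congr (_ + _).
  rewrite /dotp (bigD1 i)//= big1 ?addr0; last first.
    by move=> j /negbTE ji; rewrite !mxE eqxx ji mulr0 mul0r.
  by rewrite !mxE !eqxx mulr1 mulNr mulrC.
have dG0 : cint mu G = 0.
  apply: eqcP => /=.
    apply: (@Rintegral_line_deriv _ _ (fun x => complex.Re (cis (- dotp x xi) * f x)) _ i C' N) => //.
    - move=> x t.
      have dc := @is_derive1_comp _ (@cos R) _ _ _ _ (is_derive_cos _) (dth x t).
      have ds := @is_derive1_comp _ (@sin R) _ _ _ _ (is_derive_sin _) (dth x t).
      have D : is_derive t (1 : R) (fun s : R => cos (- dotp (x + s *: basis_rV i) xi) * complex.Re (f (x + s *: basis_rV i)) -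
        sin (- dotp (x + s *: basis_rV i) xi) * complex.Im (f (x + s *: basis_rV i))) _ :=
        @is_deriveB _ _ _ _ _ _ _ _ _ (@is_deriveM _ _ _ _ _ _ _ _ dc (dr x t)) (@is_deriveM _ _ _ _ _ _ _ _ ds (di x t)).
      rewrite (_ : (fun s : R => complex.Re (cis (- dotp (x + s *: basis_rV i) xi) * f (x + s *: basis_rV i))) =
        (fun s : R => cos (- dotp (x + s *: basis_rV i) xi) * complex.Re (f (x + s *: basis_rV i)) -
        sin (- dotp (x + s *: basis_rV i) xi) * complex.Im (f (x + s *: basis_rV i)))); last first.
        by apply/funext => s; rewrite ReM.
      apply: is_derive_eq D _; rewrite /GRing.scale/= /G.
      rewrite ReM ReD ImD ReM ImM /=.
      by case: (f _) => a b; case: (g _) => c d /=; ring.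
    - by move=> x; apply: le_trans (normr_Re _) (Gb x).
    - exact: iF.1.
  apply: (@Rintegral_line_deriv _ _ (fun x => complex.Im (cis (- dotp x xi) * f x)) _ i C' N) => //.
  - move=> x t.
    have dc := @is_derive1_comp _ (@cos R) _ _ _ _ (is_derive_cos _) (dth x t).
    have ds := @is_derive1_comp _ (@sin R) _ _ _ _ (is_derive_sin _) (dth x t).
    have D : is_derive t (1 : R) (fun s : R => cos (- dotp (x + s *: basis_rV i) xi) * complex.Im (f (x + s *: basis_rV i)) +
      sin (- dotp (x + s *: basis_rV i) xi) * complex.Re (f (x + s *: basis_rV i))) _ :=
      @is_deriveD _ _ _ _ _ _ _ _ _ (@is_deriveM _ _ _ _ _ _ _ _ dc (di x t)) (@is_deriveM _ _ _ _ _ _ _ _ ds (dr x t)).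
    rewrite (_ : (fun s : R => complex.Im (cis (- dotp (x + s *: basis_rV i) xi) * f (x + s *: basis_rV i))) =
      (fun s : R => cos (- dotp (x + s *: basis_rV i) xi) * complex.Im (f (x + s *: basis_rV i)) +
      sin (- dotp (x + s *: basis_rV i) xi) * complex.Re (f (x + s *: basis_rV i)))); last first.
      by apply/funext => s; rewrite ImM.
    apply: is_derive_eq D _; rewrite /GRing.scale/= /G.
    rewrite ImM ReD ImD ReM ImM /=.
    by case: (f _) => a b; case: (g _) => c d /=; ring.
  - by move=> x; apply: le_trans (normr_Im _) (Gb x).
  - exact: iF.2.
have : cint mu G = fourier g xi + - Complex 0 (xi ord0 i) * fourier f xi.
  rewrite /fourier -!/(cint mu _) -cintZ// -cintD//; last 2 first.
  - exact: cL1_cisM.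
  - exact: cL1Z.
  by apply: cint_eq => x; rewrite /G mulrDr; congr (_ + _); rewrite mulrCA.
by rewrite dG0 => /esym/eqP; rewrite mulNr subr_eq0 => /eqP.
Qed.

End fourier_derivative.

(** * Iterated derivatives and the decay of Fourier transforms *)

Section iterated_derivatives.
Context {R : realType} (W : normedModType R) (m : nat) (e : 'I_m -> W).
Implicit Types (beta : 'I_m -> nat) (f : W -> R).

Let fold beta s f := foldr (fun i g => iter (beta i) (fun h => 'D_(e i) h) g) f s.

Let foldE beta j s f :
  fold beta (j :: s) f = iter (beta j) (fun h => 'D_(e j) h) (fold beta s f).
Proof. by []. Qed.

Definition pred_at (i : 'I_m) beta : 'I_m -> nat :=
  fun j => if j == i then (beta j).-1 else beta j.

Let eq_fold beta beta' s f : {in s, beta =1 beta'} -> fold beta s f = fold beta' s f.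
Proof.
elim: s => // i s IHs h; rewrite !foldE IHs; last by move=> j js; rewrite h// inE js orbT.
by rewrite h// mem_head.
Qed.

Let fold_first beta s : uniq s -> (forall j, j \in s -> beta j = 0%N) \/
  exists2 i, (i \in s) && (0 < beta i)%N &
    forall f, fold beta s f = 'D_(e i) (fold (pred_at i beta) s f).
Proof.
elim: s => [_|j s IHs]; first by left.
rewrite cons_uniq => /andP[js us].
case bj: (beta j) => [|k].
  case: (IHs us) => [h|[i /andP[si bi] h]]; [left|right].
    by move=> l; rewrite inE => /predU1P[->//|/h].
  exists i => [|f]; first by rewrite inE si orbT.
  by rewrite !foldE bj h {2}/pred_at bj /= if_same.
right; exists j => [|f]; first by rewrite mem_head bj.
rewrite !foldE bj {1}/pred_at eqxx bj (@eq_fold beta (pred_at j beta))//.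
move=> l ls; rewrite /pred_at; case: eqP => // lj.
by rewrite lj (negbTE js) in ls.
Qed.

(** [multi_deriv] nests the directions in the order of [enum], and the outermost derivative is the
    first [i] with a positive exponent. Peeling it off is the step of an induction on [mdeg]. *)
Lemma multi_deriv_first beta : (forall j, beta j = 0%N) \/
  exists2 i, (0 < beta i)%N & forall f,
    multi_deriv e beta f = 'D_(e i) (multi_deriv e (pred_at i beta) f).
Proof.
case: (fold_first beta (enum_uniq 'I_m)) => [h|[i /andP[_ bi] h]]; [left|right].
  by move=> j; apply: h; rewrite mem_enum.
by exists i.
Qed.

Lemma multi_deriv0 beta f : (forall j, beta j = 0%N) -> multi_deriv e beta f = f.
Proof. by rewrite /multi_deriv => b0; elim: (enum _) => //= i s ->; rewrite b0. Qed.

Lemma multi_deriv_basis i f :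
  multi_deriv e (fun j => nat_of_bool (j == i)) f = 'D_(e i) f.
Proof.
case: (multi_deriv_first (fun j => nat_of_bool (j == i))) => [/(_ i)|]; first by rewrite eqxx.
move=> [j]; case: eqP => // -> _ ->; rewrite multi_deriv0// => l.
by rewrite /pred_at; case: eqP.
Qed.

Lemma smooth_multi_deriv beta f : smooth f ->
  continuous (multi_deriv e beta f) /\ forall x v, derivable (multi_deriv e beta f) x v.
Proof.
move=> sf; suff [vs ->] : exists vs, multi_deriv e beta f = foldr (fun v h => 'D_v h) f vs.
  exact: sf vs.
rewrite /multi_deriv; elim: (enum _) => [|i s [vs E]]; first by exists [::].
exists (nseq (beta i) (e i) ++ vs); rewrite /= foldr_cat E.
by elim: (beta i) => //= k ->.
Qed.

End iterated_derivatives.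

Section schwartz_fourier.
Context {R : realType} {n : nat}.
Notation fct := ('rV[R]_n -> R[i]).
Notation mu := (@lebesgue_rV R n).
Implicit Types (x y xi : 'rV[R]_n) (beta : 'I_n -> nat).

Variable u : fct.
Hypothesis su : schwartz u.
Notation "'du' beta" := (cmulti_deriv (@basis_rV R n) beta u) (at level 10).

Lemma cmeas_multi_deriv beta : cmeas (du beta).
Proof.
have [[s1 s2] _] := su.
have [c1 _] := smooth_multi_deriv (@basis_rV R n) beta s1.
have [c2 _] := smooth_multi_deriv (@basis_rV R n) beta s2.
by split; exact: continuous_measurable_rV.
Qed.

Lemma cL1_multi_deriv beta : cL1 mu (du beta).
Proof.
have [C _ h] := schwartz_decay beta 2 su.
exact: cL1_bracket (cmeas_multi_deriv beta) h.
Qed.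

Lemma multi_deriv_id : du (fun=> 0%N) = u.
Proof.
by apply/funext => x; rewrite /cmulti_deriv !multi_deriv0//; case: (u x).
Qed.

Lemma schwartz_bound N : exists2 C : R, 0 <= C & forall x, nc (u x) <= C * bracket x ^- N.
Proof. by rewrite -multi_deriv_id; exact: schwartz_decay. Qed.

Lemma schwartz_cmeas : cmeas u.
Proof. by rewrite -multi_deriv_id; exact: cmeas_multi_deriv. Qed.

Lemma schwartz_cL1 : cL1 mu u.
Proof. by rewrite -multi_deriv_id; exact: cL1_multi_deriv. Qed.

Lemma schwartz_L2 : L2 u.
Proof.
have [C C0 h] := schwartz_bound 2; apply/L2P; split; first exact: schwartz_cmeas.
apply: (le_rint (v := fun x => C ^+ 2 * bracket x ^- 4)).
- exact: measurable_sqr_nc schwartz_cmeas.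
- move=> x; rewrite ger0_norm ?sqr_ge0// (_ : _ * _ = (C * bracket x ^- 2) ^+ 2).
    rewrite lerXn2r ?nnegrE ?nc_ge0// mulr_ge0// invr_ge0 exprn_ge0//.
    exact/ltW/bracket_gt0.
  by rewrite exprMn exprVn -exprM.
- exact: rintZ (rint_bracket _).
Qed.

Lemma line_deriv_pred beta i (f : 'rV[R]_n -> R) : smooth f ->
  (forall g, multi_deriv (@basis_rV R n) beta g =
     'D_(basis_rV i) (multi_deriv (@basis_rV R n) (pred_at i beta) g)) ->
  line_deriv (multi_deriv (@basis_rV R n) (pred_at i beta) f)
    (multi_deriv (@basis_rV R n) beta f) (basis_rV i).
Proof.
move=> sf h; rewrite h; apply: derivable_line_deriv => x.
exact: (smooth_multi_deriv _ _ sf).2.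
Qed.

(** Each derivative contributes a factor i xi_j; only moduli are recorded. *)
Lemma nc_fourier_multi_deriv beta xi :
  nc (fourier (du beta) xi) = `|\prod_(i < n) xi ord0 i ^+ beta i| * nc (fourier u xi).
Proof.
have [[s1 s2] _] := su.
elim: (mdeg beta) {-2}beta (erefl (mdeg beta)) => [|k IHk] {}beta db.
  have b0 j : beta j = 0%N.
    by move/eqP: db; rewrite /mdeg sum_nat_eq0 => /forallP/(_ j)/eqP.
  rewrite big1 ?normr1 ?mul1r; last by move=> i _; rewrite b0 expr0.
  by rewrite (_ : beta = fun=> 0%N) ?multi_deriv_id//; apply/funext.
case: (multi_deriv_first (@basis_rV R n) beta) => [b0|[i bi h]].
  by move: db; rewrite /mdeg big1// => j _; exact: b0.
have dp : mdeg (pred_at i beta) = k.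
  apply: eq_add_S; rewrite -db /mdeg (bigD1 i)//= [in RHS](bigD1 i)//=.
  rewrite {1}/pred_at eqxx -addSn prednK//; congr (_ + _)%N.
  by apply: eq_bigr => j /negbTE; rewrite /pred_at => ->.
have [C1 C10 h1] := schwartz_decay beta 2 su.
have [C2 C20 h2] := schwartz_decay (pred_at i beta) 2 su.
have b0 x : 0 <= bracket x ^- 2 by rewrite invr_ge0 exprn_ge0// ltW// bracket_gt0.
rewrite (@fourier_line_deriv _ _ (du (pred_at i beta)) (du beta) i (C1 + C2) 2)//.
- rewrite ncM (IHk _ dp) mulrA; congr (_ * _).
  rewrite [nc _](_ : _ = `|xi ord0 i|); last by rewrite /= expr0n/= add0r sqrtr_sqr.
  rewrite -normrM; congr `|_|; rewrite (bigD1 i)//= [in RHS](bigD1 i)//= mulrA.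
  rewrite /pred_at eqxx -exprS prednK//; congr (_ * _).
  by apply: eq_bigr => j /negbTE ->.
- exact: cmeas_multi_deriv.
- exact: cmeas_multi_deriv.
- exact: addr_ge0.
- exact: line_deriv_pred.
- exact: line_deriv_pred.
- by move=> x; apply: le_trans (h2 x) _; rewrite ler_wpM2r// lerDr.
- by move=> x; apply: le_trans (h1 x) _; rewrite ler_wpM2r// lerDl.
Qed.

(** A monomial times the transform is, in modulus, the transform of a derivative, hence bounded by
    the L^1 norm of that derivative. *)
Lemma fourier_decay N : exists2 C : R, 0 <= C & forall xi,
  nc (fourier u xi) <= C * bracket xi ^- N.
Proof.
apply: monomial_decay => [xi|al]; first exact: nc_ge0.
exists (\int[mu]_x nc (du al x)) => xi; rewrite -nc_fourier_multi_deriv.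
exact: nc_fourier (cL1_multi_deriv al) xi.
Qed.

Lemma schwartz_lip_coord i : exists2 L : R, 0 <= L & forall x t,
  nc (u (x + t *: basis_rV i) - u x) <= L * `|t|.
Proof.
have [[s1 s2] _] := su.
have [C C0 h] := schwartz_decay (fun j => nat_of_bool (j == i)) 0 su.
have D1 := derivable_line_deriv (fun x => (s1 [::]).2 x (basis_rV i)).
have D2 := derivable_line_deriv (fun x => (s2 [::]).2 x (basis_rV i)).
have B1 x : `|'D_(basis_rV i) (fun y => complex.Re (u y)) x| <= C * bracket x ^- 0.
  have := le_trans (normr_Re _) (h x).
  by rewrite /cmulti_deriv [X in `|X|]/= multi_deriv_basis.
have B2 x : `|'D_(basis_rV i) (fun y => complex.Im (u y)) x| <= C * bracket x ^- 0.
  have := le_trans (normr_Im _) (h x).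
  by rewrite /cmulti_deriv [X in `|X|]/= multi_deriv_basis.
have main x t : 0 <= t -> nc (u (x + t *: basis_rV i) - u x) <= (C + C) * t.
  move=> t0; apply: le_trans (nc_le_ReIm _) _; rewrite mulrDl lerD//.
    rewrite ReD (_ : complex.Re (- u x) = - complex.Re (u x)); last by case: (u x).
    by rewrite mulrC; exact: (line_deriv_lip D1 C0 B1 x t0).
  rewrite ImD (_ : complex.Im (- u x) = - complex.Im (u x)); last by case: (u x).
  by rewrite mulrC; exact: (line_deriv_lip D2 C0 B2 x t0).
exists (C + C) => [|x t]; first exact: addr_ge0.
have [t0|t0] := leP 0 t; first by rewrite ger0_norm ?main.
rewrite ltr0_norm// -ncN opprB.
have := main (x + t *: basis_rV i) (- t).
by rewrite scaleNr addrK; apply; rewrite oppr_ge0 ltW.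
Qed.

Lemma schwartz_lip : exists2 L : R, 0 <= L & forall x y,
  nc (u y - u x) <= L * \sum_(i < n) `|(y - x) ord0 i|.
Proof.
pose Li i := sval (cid2 (schwartz_lip_coord i)).
have L0 i : 0 <= Li i by rewrite /Li; case: cid2.
have LP i x t : nc (u (x + t *: basis_rV i) - u x) <= Li i * `|t|.
  by rewrite /Li; case: cid2.
exists (\sum_i Li i) => [|x y]; first exact: sumr_ge0.
have Lle i : Li i <= \sum_j Li j by rewrite (bigD1 i)//= lerDl sumr_ge0.
(* Corners of a path from [x] to [y] that changes one coordinate at a time. *)
pose z (s : seq 'I_n) : 'rV[R]_n := \row_i (if i \in s then y ord0 i else x ord0 i).
suff H s : uniq s -> nc (u (z s) - u x) <= (\sum_i Li i) * \sum_(i <- s) `|(y - x) ord0 i|.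
  have := H (index_enum 'I_n) (index_enum_uniq _).
  by rewrite (_ : z _ = y)//; apply/rowP => i; rewrite mxE mem_index_enum.
elim: s => [_|i s IHs /= /andP[si us]].
  rewrite big_nil mulr0 (_ : z _ = x); last by apply/rowP => i; rewrite mxE.
  by rewrite subrr ComplexField.Normc.normc0.
rewrite big_cons mulrDr.
have -> : z (i :: s) = z s + (y - x) ord0 i *: basis_rV i.
  apply/rowP => j; rewrite !mxE inE eqxx /=; case: (eqVneq j i) => [->|ji] /=.
    by rewrite (negbTE si) mulr1 addrC subrK.
  by rewrite mulr0 addr0.
rewrite -(subrK (u (z s)) (u (z s + _))) -addrA (le_trans (ncD _ _))// lerD ?IHs//.
by apply: le_trans (LP _ _ _) _; rewrite ler_wpM2r.
Qed.

Lemma schwartz_plancherel : nsq (fourier u) = (2 * pi) ^+ n * nsq u.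
Proof.
have [L L0 HL] := schwartz_lip; have [M M0 HM] := schwartz_bound 0.
have M1 x : nc (u x) <= M.
  by apply: le_trans (HM x) _; rewrite expr0 invr1 mulr1.
have mn (a : R) : 0 <= a -> 0 <= Num.min 1 a by move=> a0; rewrite le_min ler01.
apply: (plancherel schwartz_cL1 schwartz_L2 (C := M + M + L)); first by rewrite !addr_ge0.
move=> x y; rewrite -mulr_suml mulrA expr2 ler_pM ?nc_ge0//; last first.
  by apply: le_trans (ncD _ _) _; rewrite ncN.
have d1 : nc (u x - u y) <= M + M.
  by apply: le_trans (ncD _ _) _; rewrite ncN lerD.
have d2 := HL x y; rewrite -ncN opprB in d2.
have S0 : 0 <= \sum_(i < n) Num.min 1 `|(y - x) ord0 i| by apply: sumr_ge0 => i _; exact: mn.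
(* If some coordinate moves by at least 1, its summand alone is 1 and boundedness of [u] suffices.
   Otherwise no minimum truncates, and the Lipschitz bound applies. *)
have [[i hi]|no] := pselect (exists i : 'I_n, 1 <= `|(y - x) ord0 i|).
  apply: le_trans d1 _; apply: (@le_trans _ _ (M + M + L)); first by rewrite lerDl.
  rewrite ler_peMr ?addr_ge0// (bigD1 i)//= min_l// lerDl.
  by apply: sumr_ge0 => j _; exact: mn.
rewrite (eq_bigr (fun i => `|(y - x) ord0 i|)); last first.
  move=> i _; rewrite min_r//; have [//|h] := leP `|(y - x) ord0 i| 1.
  by case: no; exists i; exact: ltW.
apply: le_trans d2 _; rewrite ler_wpM2r ?sumr_ge0// lerDr addr_ge0//.
Qed.

End schwartz_fourier.

(** * Polynomial growth of tau-functions *)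

Section polynomial_growth.
Context {R : realType} {n : nat}.
Implicit Types (x y : 'rV[R]_n).

Lemma enorm_le_sum x : enorm x <= \sum_(i < n) `|x ord0 i|.
Proof.
rewrite /enorm -[X in _ <= X]ger0_norm ?sumr_ge0// -sqrtr_sqr ler_wsqrtr// /dotp.
elim: (index_enum _) => [|i s IHs]; first by rewrite !big_nil expr0n.
rewrite !big_cons sqrrD -expr2 real_normK ?num_real//.
have : 0 <= `|x ord0 i| * \sum_(j <- s) `|x ord0 j| by rewrite mulr_ge0 ?sumr_ge0.
by move: IHs; rewrite mulr2n; lra.
Qed.

Lemma coord_le_enorm x i : `|x ord0 i| <= enorm x.
Proof.
rewrite /enorm /dotp -sqrtr_sqr ler_wsqrtr// (bigD1 i)//= -expr2 lerDl.
by apply: sumr_ge0 => j _; rewrite -expr2 sqr_ge0.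
Qed.

Lemma enorm_basis (i : 'I_n) (r : R) : 0 <= r -> enorm (r *: basis_rV i) = r.
Proof.
move=> r0; rewrite /enorm /dotp (bigD1 i)//= big1 ?addr0; last first.
  by move=> j /negbTE ji; rewrite !mxE eqxx ji mulr0 mul0r.
by rewrite !mxE !eqxx mulr1 -expr2 sqrtr_sqr ger0_norm.
Qed.

Lemma continuous_bounded_box (f : 'rV[R]_n -> R) (r : R) : continuous f ->
  exists M : R, forall x, (forall i, `|x ord0 i| <= r) -> `|f x| <= M.
Proof.
move=> cf; pose K := [set x : 'rV[R]_n | forall i, `[- r, r]%classic (x ord0 i)].
have cK : compact K.
  by apply: (@rV_compact R n (fun=> `[- r, r]%classic)) => i; exact: segment_compact.
have cfK : compact (f @` K) by apply: continuous_compact cK; exact: continuous_subspaceT.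
have [M [Mr HM]] := compact_bounded cfK.
exists (M + 1) => x xr; apply: (HM (M + 1)); first by rewrite ltrDl.
by exists x => // i; rewrite /= in_itv/= -ler_norml.
Qed.

(** Outside a ball the power 1 / (2 tau) of q0 / 2 + Gamma is Lipschitz, so it grows at most
    linearly, and raising it to the power 2 tau gives the bound. Inside, continuity on a compact
    cube is enough. *)
Lemma tau_function_growth (tau : R) (Gamma : 'rV[R]_n -> R) : (0 < n)%N -> 0 < tau ->
  tau_function tau Gamma -> exists (C : R) (m : nat), 0 <= C /\
    forall x, `|Gamma x| <= C * bracket x ^+ m.
Proof.
move=> n0 t0 [cG [q0 [q00 Gq [c [r [c0 r0 H]]]]]].
(* A reference point of norm exactly [r], admissible in the Lipschitz estimate; it exists because n
   is positive. *)
pose p := 1 / (2 * tau); pose y0 := r *: basis_rV (Ordinal n0) : 'rV[R]_n.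
pose a := (q0 / 2 + Gamma y0) `^ p.
pose D := a + (1 + r) / c; have D0 : 0 <= D.
  by rewrite addr_ge0 ?powR_ge0// divr_ge0 ?addr_ge0 ?ltW.
have [M HM] := continuous_bounded_box r cG.
pose m := (Num.truncn (2 * tau)).+1.
have tm : 2 * tau <= m%:R by apply/ltW; rewrite truncnS_gt.
exists (`|M| + (q0 + D `^ (2 * tau))), m; split.
  by rewrite !addr_ge0 ?powR_ge0// ltW.
move=> x; have bm : 1 <= bracket x ^+ m by rewrite exprn_ege1// bracket_ge1.
have P0 : 0 <= q0 + D `^ (2 * tau) by rewrite addr_ge0 ?powR_ge0 ?ltW.
have [rx|xr] := leP r (enorm x); last first.
  apply: (@le_trans _ _ `|M|); last first.
    rewrite mulrDl; apply: (@le_trans _ _ (`|M| * bracket x ^+ m)); first exact: ler_peMr.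
    by rewrite lerDl mulr_ge0// ltW// (lt_le_trans _ bm).
  apply: le_trans (ler_norm M); apply: HM => i.
  exact: le_trans (coord_le_enorm x i) (ltW xr).
have G0 : 0 < q0 / 2 + Gamma x by have := Gq x; lra.
have h1 : (q0 / 2 + Gamma x) `^ p <= D * bracket x.
  have := H x y0 rx; rewrite (enorm_basis _ (ltW r0)) => /(_ (lexx _)) h.
  have e1 : enorm (x - y0) <= (1 + r) * bracket x.
    apply: le_trans (enorm_le_sum _) _.
    apply: (@le_trans _ _ (\sum_(i < n) `|x ord0 i| + \sum_(i < n) `|y0 ord0 i|)).
      by rewrite -big_split/=; apply: ler_sum => i _; rewrite !mxE ler_normB.
    have -> : \sum_(i < n) `|y0 ord0 i| = r.
      rewrite (bigD1 (Ordinal n0))//= big1 ?addr0; last first.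
        by move=> j /negbTE ji; rewrite !mxE eqxx ji mulr0 normr0.
      by rewrite !mxE !eqxx mulr1 gtr0_norm.
    have := sum_le_bracket x; have := bracket_ge1 x => b1 sb.
    have : r <= r * bracket x by rewrite ler_peMr// ltW.
    lra.
  have h2 : (q0 / 2 + Gamma x) `^ p - a <= (1 + r) * bracket x / c.
    rewrite ler_pdivlMr// mulrC; apply: le_trans e1; apply: le_trans h.
    by rewrite ler_wpM2l ?ler_norm// ltW.
  have : a <= a * bracket x by rewrite ler_peMr ?powR_ge0// bracket_ge1.
  by rewrite /D mulrDl mulrAC; lra.
have h2 : q0 / 2 + Gamma x <= D `^ (2 * tau) * bracket x ^+ m.
  have -> : q0 / 2 + Gamma x = ((q0 / 2 + Gamma x) `^ p) `^ (2 * tau).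
    by rewrite -powRrM /p div1r mulVf ?mulf_neq0 ?gt_eqF// powRr1// ltW.
  apply: (@le_trans _ _ ((D * bracket x) `^ (2 * tau))).
    by apply: ge0_ler_powR; rewrite ?nnegrE ?powR_ge0 ?mulr_ge0 ?(ltW t0) ?(ltW (bracket_gt0 _)).
  rewrite powRM ?(ltW (bracket_gt0 _))// ler_wpM2l ?powR_ge0//.
  rewrite -powR_mulrn ?(ltW (bracket_gt0 _))//; apply: ler_powR => //; exact: bracket_ge1.
have h3 : `|Gamma x| <= q0 + D `^ (2 * tau) * bracket x ^+ m.
  by rewrite ler_norml; have := Gq x; have := powR_ge0 D (2 * tau); nra.
apply: le_trans h3 _; rewrite mulrDl mulrDl.
have : q0 <= q0 * bracket x ^+ m by rewrite ler_peMr// ltW.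
have : 0 <= `|M| * bracket x ^+ m by rewrite mulr_ge0// (le_trans _ bm).
lra.
Qed.

End polynomial_growth.

(** * The energy of a Schwartz function *)

Section energy.
Context {R : realType} {n : nat}.
Notation fct := ('rV[R]_n -> R[i]).
Notation mu := (@lebesgue_rV R n).
Implicit Types (x y xi : 'rV[R]_n).
Variables (A V : 'rV[R]_n -> R) (q CA CV : R) (mA mV : nat).
Hypotheses (cA : continuous A) (cV : continuous V) (CA0 : 0 <= CA) (CV0 : 0 <= CV).
Hypothesis bA : forall xi, `|A xi| <= CA * bracket xi ^+ mA.
Hypothesis bV : forall x, `|V x| <= CV * bracket x ^+ mV.
Variable u : fct.
Hypothesis su : schwartz u.

Lemma cL1_symbolM (G : 'rV[R]_n -> R) (CG : R) (m : nat) (f : fct) :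
  continuous G -> 0 <= CG -> (forall x, `|G x| <= CG * bracket x ^+ m) -> cmeas f ->
  (forall N, exists2 C : R, 0 <= C & forall x, nc (f x) <= C * bracket x ^- N) ->
  cL1 mu (fun x => (G x)%:C%C * f x) /\ rint mu (fun x => G x * nc (f x) ^+ 2).
Proof.
move=> cG CG0 bG mf df; have mG := continuous_measurable_rV cG.
(* [m] powers absorb the growth of [G] and two remain for integrability; exponent 0 gives plain
   boundedness. *)
have [C C0 hC] := df (m + 2)%N; have [C' C'0 hC'] := df 0%N.
have b0 x : 0 < bracket x by exact: bracket_gt0.
have E x : CG * bracket x ^+ m * (C * bracket x ^- (m + 2)) = CG * C * bracket x ^- 2.
  have : bracket x ^+ m != 0 by rewrite gt_eqF ?exprn_gt0.
  rewrite exprD invfM; move: (bracket x ^+ m) (bracket x ^- 2) => z w z0.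
  by field.
have H x : nc ((G x)%:C%C * f x) <= CG * C * bracket x ^- 2.
  rewrite ncM nc_real -E; apply: ler_pM => //; exact: nc_ge0.
have i1 : cL1 mu (fun x => (G x)%:C%C * f x).
  apply: cL1_bracket H => //; apply: cmeasM => //; exact: cmeas_real.
split => //; apply: (le_rint (v := fun x => C' * nc ((G x)%:C%C * f x))).
- by apply: measurable_funM => //; exact: measurable_sqr_nc.
- move=> x; rewrite normrM (ger0_norm (sqr_ge0 _)) ncM nc_real expr2 mulrA mulrC.
  rewrite ler_wpM2r ?mulr_ge0 ?nc_ge0//; apply: le_trans (hC' x) _.
  by rewrite expr0 invr1 mulr1.
- exact: rintZ (cL1_nc i1).
Qed.

Let su_cL1 := schwartz_cL1 su.
Let su_cmeas := schwartz_cmeas su.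

(** Only the forward transform of [u] occurs: after the exchange, integrating in [x] first turns the
    conjugate of [u] into the conjugate of [fourier u xi]. *)
Lemma energy :
  [/\ rint mu (fun xi => A xi * nc (fourier u xi) ^+ 2),
      rint mu (fun x => V x * nc (u x) ^+ 2) &
      complex.Re (inner (T_schwartz q A V u) u) = q * nsq u +
        (2 * pi) ^- n * \int[mu]_xi (A xi * nc (fourier u xi) ^+ 2) +
        \int[mu]_x (V x * nc (u x) ^+ 2)].
Proof.
have [iA rA] := cL1_symbolM cA CA0 bA (cmeas_fourier su_cL1) (fourier_decay su).
have [iV rV] := cL1_symbolM cV CV0 bV su_cmeas (schwartz_bound su).
split => //; have L2u := schwartz_L2 su.
pose w xi := (A xi)%:C%C * fourier u xi.
pose F (p : 'rV[R]_n * 'rV[R]_n) := cis (dotp p.1 p.2) * w p.2 * (u p.1)^*.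
have mF : cmeas F.
  apply: cmeasM; last exact/cmeas_conj/(cmeas_comp su_cmeas measurable_fst).
  apply: cmeasM; last exact: (cmeas_comp (cL1_meas iA) measurable_snd).
  by apply: cmeas_cis; exact: measurable_dotp.
have Fab x xi : nc (F (x, xi)) <= nc (u x) * nc (w xi).
  by rewrite !ncM nc_cis mul1r nc_conj mulrC.
have n1 x : 0 <= nc (u x) by exact: nc_ge0.
have n2 xi : 0 <= nc (w xi) by exact: nc_ge0.
have iu := cL1_nc su_cL1; have iw := cL1_nc iA.
have P1 := cL1_partial1 mF n1 n2 iu iw Fab.
have S := cint_swap mF n1 n2 iu iw Fab.
pose k : R[i] := ((2 * pi) ^- n)%:C%C.
have mxl x : measurable_fun setT (fun xi : 'rV[R]_n => dotp x xi).
  apply: measurable_sum => i; apply: measurable_funM; first exact: measurable_cst.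
  exact: measurable_coord.
have E1 x : cint mu (fun xi => F (x, xi)) =
    cint mu (fun xi => cis (dotp x xi) * (A xi)%:C%C * fourier u xi) * (u x)^*.
  rewrite -(cintZr (u x)^*); first by apply: cint_eq => xi; rewrite /F /w mulrA.
  rewrite (_ : (fun _ => _) = fun xi => cis (dotp x xi) * w xi); first exact: cL1_cisM.
  by apply/funext => xi; rewrite mulrA.
have E2 xi : cint mu (fun x => F (x, xi)) = (A xi * nc (fourier u xi) ^+ 2)%:C%C.
  have -> : (A xi * nc (fourier u xi) ^+ 2)%:C%C =
      (A xi)%:C%C * (fourier u xi * (fourier u xi)^*) by rewrite mulc_conj -rmorphM.
  have iF := cL1_cisM su_cL1 (measurable_dotp_left xi).
  have E3 : (fourier u xi)^* = cint mu (fun x => cis (dotp x xi) * (u x)^*).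
    rewrite -[fourier u xi]/(cint mu (fun x => cis (- dotp x xi) * u x)) -(cint_conj iF).
    by apply: cint_eq => x; rewrite conjM conj_cis opprK.
  rewrite mulrA -/(w xi) E3 -cintZ; last first.
    apply: (le_cL1 (v := fun x => nc (u x))); last exact: iu.
      apply: cmeasM; last exact/cmeas_conj/su_cmeas.
      apply: cmeas_cis; apply: measurable_sum => i; apply: measurable_funM.
        exact: measurable_coord.
      exact: measurable_cst.
    by move=> x; rewrite ncM nc_cis mul1r nc_conj.
  apply: cint_eq => x; rewrite [LHS]/F.
  by rewrite mulrA [w xi * _]mulrC.
have iq : cL1 mu (fun x => q%:C%C * (u x * (u x)^*)) by exact/cL1Z/L2_prod.
have iM : cL1 mu (fun x => k * cint mu (fun xi => F (x, xi))) by exact: cL1Z.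
have iVu : cL1 mu (fun x => (V x * nc (u x) ^+ 2)%:C%C).
  by split; [exact: rV|exact: (integrable0 _ setT)].
have -> : inner (T_schwartz q A V u) u = cint mu (fun x =>
    q%:C%C * (u x * (u x)^*) + k * cint mu (fun xi => F (x, xi)) + (V x * nc (u x) ^+ 2)%:C%C).
  apply: cint_eq => x.
  have -> : (V x * nc (u x) ^+ 2)%:C%C = (V x)%:C%C * (u x * (u x)^*).
    by rewrite mulc_conj -rmorphM.
  rewrite E1; set z := cint mu _.
  change ((q%:C%C * u x + k * z + (V x)%:C%C * u x) * (u x)^* =
    q%:C%C * (u x * (u x)^*) + k * (z * (u x)^*) + (V x)%:C%C * (u x * (u x)^*)).
  have rg (a b c d e f : R[i]) : (f * b + d * c + e * b) * a = f * (b * a) + d * (c * a) + e * (b * a) by ring.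
  exact: rg.
rewrite (cintD (cL1D iq iM) iVu) (cintD iq iM) (cintZ _ (L2_prod L2u L2u)) (cintZ _ P1).
have -> : cint mu (fun x => u x * (u x)^*) = (nsq u)%:C%C by exact: inner_self.
rewrite S (cint_eq mu E2).
by rewrite !cint_real /k -!rmorphM -!rmorphD.
Qed.

End energy.

(** * Eigenvalue counting *)

Section bessel.
Context {R : realType} {n : nat}.
Notation fct := ('rV[R]_n -> R[i]).

Lemma bessel (f : nat -> fct) (h : fct) (N : nat) : L2 h ->
  (forall i, (i < N)%N -> L2 (f i)) ->
  (forall i j, (i < N)%N -> (j < N)%N -> inner (f i) (f j) = (i == j)%:R) ->
  \sum_(j < N) nc (inner (f j) h) ^+ 2 <= nsq h.
Proof.
move=> h2 f2 ff.
suff H m : (m <= N)%N -> exists2 r : fct, L2 r & nsq r = nsq h - \sum_(j < m) nc (inner (f j) h) ^+ 2 /\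
    (forall k, (m <= k < N)%N -> inner (f k) r = inner (f k) h).
  by have [r _ [E _]] := H N (leqnn N); rewrite -subr_ge0 -E nsq_ge0.
elim: m => [_|m IHm mN]; first by exists h => //; rewrite big_ord0 subr0.
have [r r2 [E1 E2]] := IHm (ltnW mN).
have fm := f2 _ mN; exists (lc (- inner r (f m)) (f m) r); first exact: L2_lc.
have E3 : inner (f m) r = inner (f m) h by apply: E2; rewrite leqnn.
split=> [|k /andP[mk kN]].
  have n1 : nsq (f m) = 1 by have := ff m m mN mN; rewrite inner_self eqxx => -[].
  rewrite (nsq_lc _ fm r2) (inner_conj fm r2) ncN nc_conj n1 E1 big_ord_recr -E3.
  rewrite mulNr [_^* * _]mulrC mulc_conj.
  rewrite -[complex.Re (- _)]/(- (nc (inner (f m) r) ^+ 2)).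
  by move: (nc _ ^+ 2) (nsq h) (\sum_j _) => a b c; rewrite /=; ring.
rewrite inner_lcr//; last exact: f2.
by rewrite ff// gtn_eqF// mulr0 add0r E2// kN ltnW.
Qed.

End bessel.

Section cubes.
Context {R : realType} {n : nat}.
Notation fct := ('rV[R]_n -> R[i]).
Notation mu := (@lebesgue_rV R n).
Implicit Types (rho : R) (x xi : 'rV[R]_n).

(** The indicator of a cube centred at 0, as a product over the coordinates so that its integral
    factors. *)
Definition chi rho x : R := \prod_(i < n) \1_(`[- rho, rho]%classic) (x ord0 i).

Lemma chiP rho x : chi rho x = 1 \/ chi rho x = 0 /\ exists i, rho < `|x ord0 i|.
Proof.
have [[i hi]|no] := pselect (exists i : 'I_n, rho < `|x ord0 i|); [right|left].
  split; last by exists i.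
  rewrite /chi (bigD1 i)//= indicE memNset ?mul0r//=.
  by rewrite in_itv/= -ler_norml leNgt hi.
rewrite /chi big1// => i _; rewrite indicE mem_set//= in_itv/= -ler_norml leNgt.
by apply/negP => h; apply: no; exists i.
Qed.

Lemma chi01 rho x : 0 <= chi rho x <= 1.
Proof. by case: (chiP rho x) => [->|[-> _]]; rewrite lexx ler01. Qed.

Lemma chi_sqr rho x : chi rho x ^+ 2 = chi rho x.
Proof. by case: (chiP rho x) => [->|[-> _]]; rewrite ?expr1n ?expr0n. Qed.

Let mcube rho : measurable (`[- rho, rho]%classic : set R).
Proof. exact: measurable_itv. Qed.

Lemma measurable_chi rho : measurable_fun setT (chi rho).
Proof.
apply: (measurable_prod_rV (f := fun=> \1_(`[- rho, rho]%classic))) => i.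
exact: measurable_indic.
Qed.

Lemma integral_chi rho : 0 <= rho ->
  (\int[mu]_x (chi rho x)%:E = ((2 * rho) ^+ n)%:E)%E.
Proof.
move=> r0; rewrite (integral_rV_prod (f := fun=> \1_(`[- rho, rho]%classic)) (c := fun=> 2 * rho)).
- by rewrite prodr_const card_ord.
- by move=> i t; rewrite indicE ler0n.
- by move=> i; exact: measurable_indic.
- move=> i; rewrite integral_indic// setIT; transitivity (rho - - rho)%:E.
    rewrite [LHS]lebesgue_measure_itv/= lte_fin; case: ltP => // h.
    by congr EFin; lra.
  by congr EFin; ring.
Qed.

Lemma rint_chi rho : 0 <= rho -> rint mu (chi rho).
Proof.
move=> r0; apply/rint_lty; first exact: measurable_chi.
  by move=> x; have /andP[] := chi01 rho x.
by rewrite integral_chi// ltry.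
Qed.

Lemma rint_mul01 (s g : 'rV[R]_n -> R) : measurable_fun setT s ->
  (forall x, 0 <= s x <= 1) -> rint mu g -> (forall x, 0 <= g x) ->
  rint mu (fun x => s x * g x).
Proof.
move=> ms s01 ig g0; apply: (le_rint _ _ ig).
  by apply: measurable_funM => //; exact: rint_meas ig.
by move=> x; have /andP[s0 s1] := s01 x; rewrite ger0_norm ?mulr_ge0// ler_piMl.
Qed.

Lemma L2_mul01 (s : 'rV[R]_n -> R) (f : fct) : measurable_fun setT s ->
  (forall x, 0 <= s x <= 1) -> L2 f ->
  L2 (fun x => (s x)%:C%C * f x) /\
  nsq (fun x => (s x)%:C%C * f x) = \int[mu]_x (s x ^+ 2 * nc (f x) ^+ 2).
Proof.
move=> ms s01 /L2P[mf f2].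
have E x : nc ((s x)%:C%C * f x) ^+ 2 = s x ^+ 2 * nc (f x) ^+ 2.
  by have /andP[s0 _] := s01 x; rewrite ncM nc_real exprMn (ger0_norm s0).
split; last by rewrite nsqE; apply: eq_Rintegral => x _; rewrite E.
apply/L2P; split; first by apply: cmeasM => //; exact: cmeas_real.
under eq_fun do rewrite E; apply: rint_mul01 => //; first exact: measurable_funX.
by move=> x; have /andP[s0 s1] := s01 x; rewrite exprn_ge0// exprn_ile1.
by move=> x; exact: sqr_ge0.
Qed.

Lemma cL1_chi rho (f : fct) : 0 <= rho -> L2 f -> cL1 mu (fun x => (chi rho x)%:C%C * f x).
Proof.
move=> r0 /L2P[mf f2].
apply: (le_cL1 (v := fun x => chi rho x + nc (f x) ^+ 2)).
- by apply: cmeasM => //; apply: cmeas_real; exact: measurable_chi.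
- move=> x; rewrite ncM nc_real.
  have := sqr_ge0 (nc (f x) - 1); have := nc_ge0 (f x); have := sqr_ge0 (nc (f x)).
  by case: (chiP rho x) => [->|[-> _]]; rewrite ?normr1 ?normr0; nra.
- apply: rintD f2; exact: rint_chi.
Qed.

Lemma fourier_chi_inner rho (f : fct) xi :
  fourier (fun x => (chi rho x)%:C%C * f x) xi =
  inner f (fun x => (chi rho x)%:C%C * cis (dotp x xi)).
Proof.
apply: (cint_eq mu) => x; rewrite conjM conj_cis.
have -> : (chi rho x)%:C%C^* = (chi rho x)%:C%C by apply: eqcP => //=; rewrite oppr0.
have rg (a b c : R[i]) : a * (b * c) = c * (b * a) by ring.
exact: rg.
Qed.

Lemma L2_chi_cis rho xi : 0 <= rho ->
  L2 (fun x => (chi rho x)%:C%C * cis (dotp x xi)) /\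
  nsq (fun x => (chi rho x)%:C%C * cis (dotp x xi)) = (2 * rho) ^+ n.
Proof.
move=> r0; have E x : nc ((chi rho x)%:C%C * cis (dotp x xi)) ^+ 2 = chi rho x.
  by rewrite ncM nc_cis mulr1 nc_real real_normK ?num_real// chi_sqr.
split; last first.
  by rewrite nsqE; under eq_Rintegral do rewrite E; rewrite /Rintegral integral_chi.
apply/L2P; split; last by under eq_fun do rewrite E; exact: rint_chi.
apply: cmeasM; first by apply: cmeas_real; exact: measurable_chi.
apply: cmeas_cis; apply: measurable_sum => i; apply: measurable_funM.
  exact: measurable_coord.
exact: measurable_cst.
Qed.

(** The factor 96 is chosen so that a vector with energy at most [2 * lam] above the minimum has at
    most 1/48 of its mass outside the cube. *)
Lemma growth_outside_cube (G : 'rV[R]_n -> R) (e C1 C2 b0 : R) :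
  0 < e -> 0 < C1 -> 0 < C2 -> (forall x, b0 <= G x) ->
  (forall x, C2 <= enorm x -> C1 * enorm x `^ e <= G x) ->
  exists2 K : R, 0 < K & forall (lam : R) x, 1 <= lam ->
    96 * lam * (1 - chi (K * lam `^ e^-1) x) <= G x - b0.
Proof.
move=> e0 C10 C20 Gb Gg; pose D := (96 + `|b0|) / C1.
have D0 : 0 <= D by rewrite divr_ge0 ?addr_ge0// ltW.
(* [C2 <= K] makes the growth bound available outside the cube, and D <= K^e with C1 D = 96 + |b0|
   makes it exceed (96 + |b0|) lam there. *)
pose K := C2 + D `^ e^-1.
have K0 : 0 < K by rewrite ltr_pwDl ?powR_ge0.
exists K => // lam x l1; have l0 : 0 <= lam by exact: le_trans l1.
case: (chiP (K * lam `^ e^-1) x) => [->|[-> [i hi]]].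
  by rewrite subrr mulr0 subr_ge0.
rewrite subr0 mulr1.
have le1 : 1 <= lam `^ e^-1.
  by rewrite -[1](powRr0 lam) ler_powR// invr_ge0 ltW.
have xe : K * lam `^ e^-1 <= enorm x by exact: le_trans (ltW hi) (coord_le_enorm x i).
have C2x : C2 <= enorm x.
  apply: le_trans xe; apply: (@le_trans _ _ K); first by rewrite lerDl powR_ge0.
  by rewrite ler_peMr// ltW.
have h1 : (K * lam `^ e^-1) `^ e <= enorm x `^ e.
  by apply: ge0_ler_powR => //; rewrite ?nnegrE ?mulr_ge0 ?powR_ge0 ?sqrtr_ge0 ?(ltW e0) ?(ltW K0).
rewrite powRM ?powR_ge0 ?(ltW K0)// -powRrM mulVf ?gt_eqF// powRr1// in h1.
have h2 : D <= K `^ e.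
  have -> : D = (D `^ e^-1) `^ e by rewrite -powRrM mulVf ?gt_eqF// powRr1.
  apply: ge0_ler_powR; rewrite ?nnegrE ?powR_ge0 ?(ltW e0) ?(ltW K0)//.
  by rewrite lerDr ltW.
have h3 : (96 + `|b0|) * lam <= C1 * enorm x `^ e.
  apply: (@le_trans _ _ (C1 * (K `^ e * lam))); last by rewrite ler_wpM2l// ltW.
  rewrite mulrA ler_wpM2r// mulrC -ler_pdivrMr//.
have := Gg x C2x; have := ler_norm b0.
have : `|b0| <= `|b0| * lam by rewrite ler_peMr.
by move: h3; rewrite mulrDl; lra.
Qed.

End cubes.

Section spectral_counting.
Context {R : realType} {n : nat}.
Notation fct := ('rV[R]_n -> R[i]).
Notation mu := (@lebesgue_rV R n).
Implicit Types (x xi : 'rV[R]_n).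

Lemma sqr_nc_sum3 (a b c : R[i]) :
  nc (a + - b + c) ^+ 2 <= 3 * nc a ^+ 2 + 3 * nc b ^+ 2 + 3 * nc c ^+ 2.
Proof.
rewrite !sqr_nc; case: a b c => [a a'] [b b'] [c c'] /=.
have := sqr_ge0 (a + b); have := sqr_ge0 (a - c); have := sqr_ge0 (b + c).
have := sqr_ge0 (a' + b'); have := sqr_ge0 (a' - c'); have := sqr_ge0 (b' + c').
rewrite !expr2; lra.
Qed.

(** The budget in units of P: 47/48 - 1/48 - 6/48 = 40/48 is left for [3 * I3], so I3 >= 5/18 P,
    which is more than required. *)
Let concentration_arith (P W I1 I2 I3 B D : R) : P * W = I1 + I2 ->
  I1 <= 3 * I3 + 3 * B + 3 * D -> B <= P / 48 -> D <= P / 48 -> I2 <= P / 48 ->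
  P * (47 / 48) <= P * W -> 0 <= P -> P / 6 <= I3.
Proof. by move=> -> h1 h2 h3 h4 h5 h6; lra. Qed.

(** Markov's inequality: outside the cube [G - b0] is at least [96 * lam], while its total against
    [g] is at most [2 * lam * M]. *)
Lemma rint_tail_le (G g : 'rV[R]_n -> R) (rho lam b0 M : R) : 0 < lam ->
  rint mu g -> (forall x, 0 <= g x) -> rint mu (fun x => G x * g x) ->
  (forall x, 96 * lam * (1 - chi rho x) <= G x - b0) ->
  \int[mu]_x (G x * g x) - b0 * \int[mu]_x g x <= 2 * lam * M ->
  \int[mu]_x ((1 - chi rho x) * g x) <= M / 48.
Proof.
move=> l0 ig g0 iG H HM.
have ic : rint mu (fun x => (1 - chi rho x) * g x).
  apply: rint_mul01 => //.
    by apply: measurable_funB; [exact: measurable_cst|exact: measurable_chi].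
  by move=> x; have := chi01 rho x; lra.
have ib := rintZ (- b0) ig.
have : \int[mu]_x (96 * lam * ((1 - chi rho x) * g x)) <= \int[mu]_x (G x * g x + - b0 * g x).
  apply: le_Rintegral => //; first exact: rintZ.
    exact: rintD.
  by move=> x _; rewrite -mulrDl mulrA ler_wpM2r.
rewrite (RintegralZl _ measurableT ic) (RintegralD measurableT iG ib) (RintegralZl _ measurableT ig).
set I := \int[mu]_x ((1 - _) * _) => h.
rewrite ler_pdivlMr// -(ler_pM2l l0).
by move: h HM; rewrite mulNr; lra.
Qed.

Variables (A V : 'rV[R]_n -> R) (q CA CV : R) (mA mV : nat).
Hypotheses (cA : continuous A) (cV : continuous V) (CA0 : 0 <= CA) (CV0 : 0 <= CV).
Hypothesis bA : forall xi, `|A xi| <= CA * bracket xi ^+ mA.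
Hypothesis bV : forall x, `|V x| <= CV * bracket x ^+ mV.
Variables (a0 b0 : R).
Hypotheses (Aa0 : forall xi, a0 <= A xi) (Vb0 : forall x, b0 <= V x) (qab : q + a0 + b0 = 1).

Let pn : 0 < (2 * pi) ^+ n :> R.
Proof. by rewrite exprn_gt0// mulr_gt0// pi_gt0. Qed.

(** With q = 1 - a0 - b0, Plancherel moves a0 |u|^2 to the frequency side. What exceeds |u|^2
    becomes two separately nonnegative terms, so an energy bound controls each of them. *)
Lemma energy_terms (u : fct) : schwartz u ->
  [/\ rint mu (fun xi => A xi * nc (fourier u xi) ^+ 2),
      rint mu (fun x => V x * nc (u x) ^+ 2),
      0 <= \int[mu]_xi (A xi * nc (fourier u xi) ^+ 2) - a0 * nsq (fourier u),
      0 <= \int[mu]_x (V x * nc (u x) ^+ 2) - b0 * nsq u &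
      complex.Re (inner (T_schwartz q A V u) u) = nsq u +
        (2 * pi) ^- n * (\int[mu]_xi (A xi * nc (fourier u xi) ^+ 2) - a0 * nsq (fourier u)) +
        (\int[mu]_x (V x * nc (u x) ^+ 2) - b0 * nsq u)].
Proof.
move=> su; have [rA rV E] := energy q cA cV CA0 CV0 bA bV su.
have /L2P[_ ru] := schwartz_L2 su.
have /L2P[_ rf] := L2_fourier (schwartz_cL1 su) (schwartz_L2 su).
split=> //.
- rewrite subr_ge0 nsqE -(RintegralZl _ measurableT rf).
  apply: le_Rintegral => //; first exact: rintZ.
  by move=> xi _; rewrite ler_wpM2r ?sqr_ge0.
- rewrite subr_ge0 nsqE -(RintegralZl _ measurableT ru).
  apply: le_Rintegral => //; first exact: rintZ.
  by move=> x _; rewrite ler_wpM2r ?sqr_ge0.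
- rewrite E (schwartz_plancherel su).
  have -> : q = 1 - a0 - b0 by rewrite -qab; ring.
  have : (2 * pi) ^+ n != 0 :> R by rewrite gt_eqF.
  by move: ((2 * pi) ^+ n) => c c0; field.
Qed.

Variable T : fct -> fct -> Prop.
Hypothesis hT : forall u v, T u v -> [/\ L2 u, L2 v & exists uk : nat -> fct,
  [/\ (forall k, schwartz (uk k)), l2cvg uk u &
      l2cvg (fun k => T_schwartz q A V (uk k)) v]].

Lemma energy_ge_nsq u v : T u v -> nsq u <= complex.Re (inner v u).
Proof.
move=> /hT[u2 v2 [uk [sk cu cv]]].
have h1 := nsq_cvg cu; have h2 := Re_inner_cvg cv cu.
apply: (ler_cvg_to h1 h2); apply: nearW => k.
have [_ _ p1 p2 ->] := energy_terms (sk k).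
by rewrite -addrA lerDl addr_ge0// mulr_ge0// invr_ge0 ltW.
Qed.

(** [T] is a graph closure, so the estimates are made on a Schwartz function [w] close to [u] in
    norm and in energy; the conclusion is then carried back to the truncation of [u]. *)
Lemma concentration (rho rho' lam : R) u v : 1 <= lam -> 0 <= rho -> 0 <= rho' ->
  (forall x, 96 * lam * (1 - chi rho x) <= V x - b0) ->
  (forall xi, 96 * lam * (1 - chi rho' xi) <= A xi - a0) ->
  T u v -> nsq u = 1 -> complex.Re (inner v u) <= lam ->
  (2 * pi) ^+ n / 6 <= \int[mu]_xi (chi rho' xi *
    nc (fourier (fun x => (chi rho x)%:C%C * u x) xi) ^+ 2).
Proof.
move=> l1 r0 r0' HV HA /hT[u2 v2 [uk [sk cu cv]]] u1 El.
have l0 : 0 < lam by exact: lt_le_trans l1.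
have h1 := nsq_cvg cu; have h2 := Re_inner_cvg cv cu.
have /l2cvgE[_ _ h3] := cu.
(* The limits are 1, at most [lam], and 0, so these margins hold for large [k]. *)
have [k [k1 k2 k3]] : exists k, [/\ 47 / 48 <= nsq (uk k),
    complex.Re (inner (T_schwartz q A V (uk k)) (uk k)) <= 2 * lam &
    nsq (lc (-1) (uk k) u) <= 1 / 48].
  have f1 : \forall k \near \oo, 47 / 48 < nsq (uk k).
    by apply: (cvgr_gt _ h1); rewrite u1; lra.
  have f2 : \forall k \near \oo, complex.Re (inner (T_schwartz q A V (uk k)) (uk k)) < 2 * lam.
    by apply: (cvgr_lt _ h2); lra.
  have f3 : \forall k \near \oo, nsq (lc (-1) (uk k) u) < 1 / 48.
    by apply: (cvgr_lt _ h3); lra.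
  have : \forall k \near \oo, [/\ 47 / 48 <= nsq (uk k),
    complex.Re (inner (T_schwartz q A V (uk k)) (uk k)) <= 2 * lam &
    nsq (lc (-1) (uk k) u) <= 1 / 48].
    near=> k; split; apply: ltW; near: k; [exact: f1|exact: f2|exact: f3].
  by move=> /filter_ex.
move: {sk}(sk k) k1 k2 k3; set w := uk k => sw k1 k2 k3.
have w2 := schwartz_L2 sw; have w1 := schwartz_cL1 sw.
have [rA rV p1 p2 E] := energy_terms sw.
have /L2P[mw rw] := w2; have F2 := L2_fourier w1 w2; have /L2P[mFw rf] := F2.
have s0 (f : fct) x : 0 <= nc (f x) ^+ 2 by exact: sqr_ge0.
have nw := nsq_ge0 w.
have t1 : \int[mu]_x ((1 - chi rho x) * nc (w x) ^+ 2) <= 1 / 48.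
  apply: (rint_tail_le l0 rw (s0 w) rV HV).
  rewrite -nsqE mulr1; apply: le_trans k2; rewrite E lerDr addr_ge0//.
  by rewrite mulr_ge0// invr_ge0 ltW.
have t2 : \int[mu]_xi ((1 - chi rho' xi) * nc (fourier w xi) ^+ 2) <= (2 * pi) ^+ n / 48.
  apply: (rint_tail_le l0 rf (s0 (fourier w)) rA HA).
  rewrite -nsqE -ler_pdivrMr// mulrC; apply: le_trans k2; rewrite E.
  by rewrite [nsq w + _]addrC -addrA lerDl addr_ge0.
pose d := lc (-1) w u.
have d2 : L2 d by exact: L2_lc.
have m1 : measurable_fun setT (fun x => 1 - chi rho x).
  by apply: measurable_funB; [exact: measurable_cst|exact: measurable_chi].
have m01 x : 0 <= 1 - chi rho x <= 1 by have := chi01 rho x; lra.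
pose fa x := (chi rho x)%:C%C * u x.
pose fb x := (chi rho x)%:C%C * d x.
pose fc x := (1 - chi rho x)%:C%C * w x.
have [a2 _] := L2_mul01 (measurable_chi rho) (chi01 rho) u2.
have [b2 Eb] := L2_mul01 (measurable_chi rho) (chi01 rho) d2.
have [c2 Ec] := L2_mul01 m1 m01 w2.
have a1 : cL1 mu fa by exact: cL1_chi.
have b1 : cL1 mu fb by exact: cL1_chi.
have c1 : cL1 mu fc.
  apply: (le_cL1 (v := fun x => nc (w x))); last exact: cL1_nc w1.
    by apply: cmeasM => //; exact: cmeas_real.
  move=> x; have /andP[m0 m1'] := m01 x.
  by rewrite ncM nc_real ger0_norm// ler_piMl// nc_ge0.
(* From w = chi u - chi (u - w) + (1 - chi) w. The last two pieces are small in L^2, and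
   [nsq_fourier_le] keeps their transforms small although the pieces need not be smooth. *)
have Fab xi : fourier w xi = fourier fa xi + - fourier fb xi + fourier fc xi.
  have ml := measurable_dotp_left xi.
  have ia := cL1_cisM a1 ml; have ib := cL1_cisM b1 ml; have ic := cL1_cisM c1 ml.
  rewrite -[fourier fa xi]/(cint mu (fun x => cis (- dotp x xi) * fa x)).
  rewrite -[fourier fb xi]/(cint mu (fun x => cis (- dotp x xi) * fb x)).
  rewrite -[fourier fc xi]/(cint mu (fun x => cis (- dotp x xi) * fc x)).
  rewrite -mulN1r -(cintZ (-1) ib) -(cintD ia (cL1Z (-1) ib)).
  rewrite -(cintD (cL1D ia (cL1Z (-1) ib)) ic); apply: (cint_eq mu) => x.
  rewrite /fa /fb /fc /d /lc.
  have -> : (1 - chi rho x)%:C%C = 1 - (chi rho x)%:C%C by rewrite rmorphB.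
  have rg (a b c e : R[i]) : a * c = a * (b * e) + -1 * (a * (b * (-1 * c + e))) + a * ((1 - b) * c) by ring.
  exact: rg.
have /L2P[_ ra] := L2_fourier a1 a2.
have L2b := L2_fourier b1 b2; have /L2P[_ rb] := L2b.
have L2c := L2_fourier c1 c2; have /L2P[_ rc] := L2c.
have nb : nsq (fourier fb) <= (2 * pi) ^+ n / 48.
  apply: le_trans (nsq_fourier_le b1 b2) _; rewrite ler_wpM2l ?(ltW pn)//.
  rewrite Eb -[_^-1]mul1r; apply: le_trans k3; rewrite nsqE.
  have /L2P[md rd] := d2.
  apply: le_Rintegral => //.
    apply: rint_mul01 => //; first by apply: measurable_funX; exact: measurable_chi.
    by move=> x; rewrite chi_sqr; exact: chi01.
  by move=> x _; rewrite chi_sqr ler_piMl// ?sqr_ge0//; have /andP[] := chi01 rho x.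
have ncc : nsq (fourier fc) <= (2 * pi) ^+ n / 48.
  apply: le_trans (nsq_fourier_le c1 c2) _; rewrite ler_wpM2l ?(ltW pn)//.
  rewrite Ec -[_^-1]mul1r; apply: le_trans t1.
  apply: le_Rintegral => //.
  - apply: rint_mul01 => //; first exact: measurable_funX.
    by move=> x; have /andP[m0 m1'] := m01 x; rewrite exprn_ge0// exprn_ile1.
  - exact: rint_mul01.
  - move=> x _; rewrite ler_wpM2r ?sqr_ge0//.
    by have /andP[m0 m1'] := m01 x; rewrite expr2 ler_piMl.
have mc := measurable_chi rho'; have c01 := chi01 rho'.
have ica : rint mu (fun xi => chi rho' xi * nc (fourier fa xi) ^+ 2).
  by apply: rint_mul01; [exact: mc|exact: c01|exact: ra|move=> xi; exact: sqr_ge0].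
have icf : rint mu (fun xi => chi rho' xi * nc (fourier w xi) ^+ 2).
  by apply: rint_mul01; [exact: mc|exact: c01|exact: rf|move=> xi; exact: sqr_ge0].
have itl : rint mu (fun xi => (1 - chi rho' xi) * nc (fourier w xi) ^+ 2).
  apply: rint_mul01 => //.
    by apply: measurable_funB; [exact: measurable_cst|exact: measurable_chi].
  by move=> x; have /andP[h0 h1'] := chi01 rho' x; rewrite subr_ge0 h1' gerBl h0.
have S1 : nsq (fourier w) = \int[mu]_xi (chi rho' xi * nc (fourier w xi) ^+ 2) +
    \int[mu]_xi ((1 - chi rho' xi) * nc (fourier w xi) ^+ 2).
  rewrite -(RintegralD measurableT icf itl) nsqE; apply: eq_Rintegral => xi _; ring.
have S2 : \int[mu]_xi (chi rho' xi * nc (fourier w xi) ^+ 2) <=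
    3 * \int[mu]_xi (chi rho' xi * nc (fourier fa xi) ^+ 2) +
    3 * nsq (fourier fb) + 3 * nsq (fourier fc).
  rewrite !nsqE -(RintegralZl _ measurableT ica) -(RintegralZl _ measurableT rb).
  rewrite -(RintegralZl _ measurableT rc).
  rewrite -(RintegralD measurableT (rintZ 3 ica) (rintZ 3 rb)).
  rewrite -(RintegralD measurableT (rintD (rintZ 3 ica) (rintZ 3 rb)) (rintZ 3 rc)).
  apply: le_Rintegral => //; first exact: (rintD (rintD (rintZ 3 ica) (rintZ 3 rb)) (rintZ 3 rc)).
  move=> xi _; rewrite Fab.
  case: (chiP rho' xi) => [->|[-> _]]; rewrite ?mul1r ?mul0r; first exact: sqr_nc_sum3.
  by rewrite mulr0 add0r addr_ge0// mulr_ge0 ?sqr_ge0.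
rewrite (schwartz_plancherel sw) in S1.
have S3 : (2 * pi) ^+ n * (47 / 48) <= (2 * pi) ^+ n * nsq w by rewrite ler_wpM2l// ltW.
exact: (concentration_arith S1 S2 nb ncc t2 S3 (ltW pn)).
Unshelve. all: by end_near. Qed.

Variables (gamma kappa C1 C2 : R).
Hypotheses (g0 : 0 < gamma) (k0 : 0 < kappa) (C10 : 0 < C1) (C20 : 0 < C2).
Hypothesis gA : forall xi, C2 <= enorm xi -> C1 * enorm xi `^ (2 * gamma) <= A xi.
Hypothesis gV : forall x, C2 <= enorm x -> C1 * enorm x `^ (2 * kappa) <= V x.

Lemma spectral_counting : exists K : R, forall (N : nat) (f : nat -> fct) (lam : R),
  1 <= lam ->
  (forall i, (i < N)%N -> exists v, T (f i) v /\ complex.Re (inner v (f i)) <= lam) ->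
  (forall i j, (i < N)%N -> (j < N)%N -> inner (f i) (f j) = (i == j)%:R) ->
  N%:R <= K * lam `^ (n%:R * (kappa + gamma) / (2 * kappa * gamma)).
Proof.
have ka0 : 0 < 2 * kappa by rewrite mulr_gt0.
have ga0 : 0 < 2 * gamma by rewrite mulr_gt0.
have [K K0 HK] := growth_outside_cube ka0 C10 C20 Vb0 gV.
have [K' K'0 HK'] := growth_outside_cube ga0 C10 C20 Aa0 gA.
(* The first factor inverts the lower bound of [concentration]; the second collects the sides of the
   two cubes without their powers of [lam]. *)
exists (6 / (2 * pi) ^+ n * (2 * K * (2 * K')) ^+ n) => N f lam l1 HT ort.
have l0 : 0 < lam by exact: lt_le_trans l1.
pose rho := K * lam `^ (2 * kappa)^-1; pose rho' := K' * lam `^ (2 * gamma)^-1.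
have r0 : 0 <= rho by rewrite mulr_ge0 ?powR_ge0// ltW.
have r0' : 0 <= rho' by rewrite mulr_ge0 ?powR_ge0// ltW.
have f2 i : (i < N)%N -> L2 (f i) by move=> /HT[v [/hT[]]].
have f1 i : (i < N)%N -> nsq (f i) = 1.
  by move=> iN; have := ort i i iN iN; rewrite inner_self eqxx => -[].
pose g i xi := nc (fourier (fun x => (chi rho x)%:C%C * f i x) xi) ^+ 2.
have gi i : (i < N)%N -> rint mu (fun xi => chi rho' xi * g i xi).
  move=> /f2 fi2; have [a2 _] := L2_mul01 (measurable_chi rho) (chi01 rho) fi2.
  have /L2P[_ ra] := L2_fourier (cL1_chi r0 fi2) a2.
  by apply: rint_mul01; [exact: measurable_chi|exact: chi01|exact: ra|move=> xi; exact: sqr_ge0].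
have low i : (i < N)%N -> (2 * pi) ^+ n / 6 <= \int[mu]_xi (chi rho' xi * g i xi).
  move=> iN; have [v [Tv Ev]] := HT i iN.
  apply: (concentration l1 r0 r0' _ _ Tv (f1 i iN) Ev) => x.
    exact: HK.
  exact: HK'.
have sums m : (m <= N)%N -> rint mu (fun xi => \sum_(i < m) (chi rho' xi * g i xi)) /\
    m%:R * ((2 * pi) ^+ n / 6) <= \int[mu]_xi \sum_(i < m) (chi rho' xi * g i xi).
  elim: m => [_|m IHm mN].
    split; first by under eq_fun do rewrite big_ord0; exact: integrable0.
    by under eq_Rintegral do rewrite big_ord0; rewrite mul0r /Rintegral integral0_eq.
  have [i1 i2] := IHm (ltnW mN).
  split; first by under eq_fun do rewrite big_ord_recr; exact: (rintD i1 (gi m mN)).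
  under eq_Rintegral do rewrite big_ord_recr.
  rewrite (RintegralD measurableT i1 (gi m mN)) -natr1 mulrDl mul1r.
  by rewrite lerD// low.
have [iS lS] := sums N (leqnn N).
have up : \int[mu]_xi \sum_(i < N) (chi rho' xi * g i xi) <= (2 * rho) ^+ n * (2 * rho') ^+ n.
  apply: (@le_trans _ _ (\int[mu]_xi ((2 * rho) ^+ n * chi rho' xi))); last first.
    by rewrite (RintegralZl _ measurableT (rint_chi r0')) /Rintegral integral_chi.
  apply: le_Rintegral => //; first exact: rintZ (rint_chi r0').
  move=> xi _; rewrite -mulr_sumr mulrC ler_wpM2r//; first by have /andP[] := chi01 rho' xi.
  have [h2 hn] := L2_chi_cis xi r0; rewrite -hn.
  under eq_bigr do rewrite /g fourier_chi_inner.
  exact: bessel.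
(* The exponents add up: n / (2 kappa) + n / (2 gamma) = n (kappa + gamma) / (2 kappa gamma). *)
have pw : rho ^+ n * rho' ^+ n = (K * K') ^+ n *
    lam `^ (n%:R * (kappa + gamma) / (2 * kappa * gamma)).
  rewrite -exprMn /rho /rho' mulrACA exprMn -powRD; last by rewrite (gt_eqF l0) implybT.
  congr (_ * _); rewrite -powR_mulrn ?powR_ge0// -powRrM; congr (_ `^ _).
  by field; rewrite !gt_eqF.
have tot := le_trans lS up.
have E : (2 * rho) ^+ n * (2 * rho') ^+ n = (2 * K * (2 * K')) ^+ n *
    lam `^ (n%:R * (kappa + gamma) / (2 * kappa * gamma)).
  transitivity ((2 * 2) ^+ n * (rho ^+ n * rho' ^+ n)).
    by rewrite -!exprMn; congr (_ ^+ n); ring.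
  by rewrite pw mulrA -!exprMn; congr (_ ^+ n * _); ring.
rewrite E in tot; apply: (@le_trans _ _ (6 / (2 * pi) ^+ n * (N%:R * ((2 * pi) ^+ n / 6)))).
  have := pn; move: ((2 * pi) ^+ n) => P P0.
  by rewrite le_eqVlt; apply/orP; left; apply/eqP; field; rewrite gt_eqF.
by rewrite -[leRHS]mulrA ler_wpM2l// divr_ge0// ltW.
Qed.

End spectral_counting.

(** * Infinite dimension of L^2 *)

Section infinite_dimension.
Context {R : realType} {n : nat}.
Notation fct := ('rV[R]_n -> R[i]).
Notation mu := (@lebesgue_rV R n).

Definition comb (c : nat -> R[i]) (g : nat -> fct) (m : nat) : fct :=
  fun x => \sum_(i < m) c i * g i x.

Lemma combS c g m : comb c g m.+1 = lc (c m) (g m) (comb c g m).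
Proof. by apply/funext => x; rewrite /comb big_ord_recr/= addrC. Qed.

Lemma L2_comb c g m : (forall i, L2 (g i)) -> L2 (comb c g m).
Proof.
move=> g2; elim: m => [|m IHm]; last by rewrite combS; exact: L2_lc.
by rewrite (_ : comb c g 0 = fun=> 0); [exact: L2_0|apply/funext => x; rewrite /comb big_ord0].
Qed.

Lemma inner_comb c g m h : (forall i, L2 (g i)) -> L2 h ->
  inner (comb c g m) h = \sum_(i < m) c i * inner (g i) h.
Proof.
move=> g2 h2; elim: m => [|m IHm].
  rewrite big_ord0 (_ : comb c g 0 = fun=> 0); first exact: inner0l.
  by apply/funext => x; rewrite /comb big_ord0.
by rewrite combS (inner_lcl _ (g2 m) (L2_comb c m g2) h2) IHm big_ord_recr/= addrC.
Qed.

Variable i0 : 'I_n.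

Definition unit_cell (k : nat) (i : 'I_n) : R -> R :=
  \1_(if i == i0 then `[k%:R, k.+1%:R[%classic else `[0, 1[%classic).

(** Indicator of the unit cube moved [k] steps along the axis [i0]. The cubes are disjoint, which
    provides infinitely many orthonormal vectors as soon as R^n has an axis. *)
Definition cell_fun k (x : 'rV[R]_n) : R := \prod_(i < n) unit_cell k i (x ord0 i).

Let measurable_cell k i : measurable_fun setT (unit_cell k i).
Proof. by apply: measurable_indic; case: ifP => _; exact: measurable_itv. Qed.

Let unit_cellM j k i t : unit_cell j i t * unit_cell k i t =
  if (i == i0) && (j != k) then 0 else unit_cell k i t.
Proof.
rewrite /unit_cell; case: eqP => _ /=; last by rewrite !indicE -natrM mulnb andbb.
case: eqVneq => [->|jk] /=; first by rewrite !indicE -natrM mulnb andbb.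
rewrite !indicE -natrM mulnb; case: andP => // -[].
rewrite !inE/= !in_itv/= => /andP[a1 a2] /andP[b1 b2].
have h1 := le_lt_trans a1 b2; have h2 := le_lt_trans b1 a2.
by rewrite !ltr_nat !ltnS in h1 h2; rewrite eqn_leq h1 h2 in jk.
Qed.

Let integral_unit_cell k i : (\int[lebesgue_measure]_t (unit_cell k i t)%:E = 1)%E.
Proof.
rewrite /unit_cell; case: eqP => _; rewrite integral_indic// setIT [LHS]lebesgue_measure_itv/=.
  by rewrite lte_fin ltr_nat ltnSn -EFinB -natr1; congr EFin; ring.
by rewrite lte_fin ltr01 sube0.
Qed.

Lemma integral_cell_fun j k :
  (\int[mu]_x (cell_fun j x * cell_fun k x)%:E = ((j == k)%:R : R)%:E)%E.
Proof.
under eq_integral do rewrite /cell_fun -big_split/=.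
rewrite (integral_rV_prod (f := fun i t => unit_cell j i t * unit_cell k i t)
  (c := fun i => if (i == i0) && (j != k) then 0 else 1)).
- congr EFin; case: (eqVneq j k) => jk /=; last by rewrite (bigD1 i0)//= eqxx mul0r.
  by rewrite big1// => i _; rewrite andbF.
- by move=> i t; rewrite mulr_ge0// /unit_cell indicE.
- by move=> i; exact: measurable_funM.
- move=> i; under eq_integral do rewrite unit_cellM.
  by case: ifP => _; [rewrite integral0_eq|rewrite integral_unit_cell].
Qed.

Lemma L2_cell k : L2 (fun x => (cell_fun k x)%:C%C).
Proof.
have mc : measurable_fun setT (cell_fun k).
  exact: (measurable_prod_rV (f := unit_cell k)).
apply/L2P; split; first exact: cmeas_real.
have E x : nc (cell_fun k x)%:C%C ^+ 2 = cell_fun k x * cell_fun k x.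
  by rewrite nc_real real_normK ?num_real// expr2.
under eq_fun do rewrite E; apply/rint_lty.
- exact: measurable_funM.
- by move=> x; rewrite -expr2 sqr_ge0.
- by rewrite integral_cell_fun ltry.
Qed.

Lemma inner_cell j k :
  inner (fun x => (cell_fun j x)%:C%C) (fun x => (cell_fun k x)%:C%C) = (j == k)%:R.
Proof.
transitivity (cint mu (fun x => (cell_fun j x * cell_fun k x)%:C%C)).
  apply: (cint_eq mu) => x; rewrite rmorphM; congr (_ * _).
  by apply: eqcP => //=; rewrite oppr0.
by rewrite cint_real /Rintegral integral_cell_fun /= rmorph_nat.
Qed.

(** A combination of one more orthonormal vector than there are conditions: the homogeneous linear
    system has a nonzero solution. *)
Lemma exists_orthogonal (s : seq fct) :
  (forall i, (i < size s)%N -> L2 (nth (fun=> 0) s i)) ->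
  exists w, [/\ L2 w, nsq w != 0 &
    forall i, (i < size s)%N -> inner w (nth (fun=> 0) s i) = 0].
Proof.
move=> s2; pose N := (size s).+1; pose g k : fct := fun x => (cell_fun k x)%:C%C.
pose M : 'M[R[i]]_(N, size s) := \matrix_(i, j) inner (g i) (nth (fun=> 0) s j).
have kM : kermx M != 0.
  rewrite -mxrank_eq0 mxrank_ker subn_eq0 -ltnNge ltnS; exact: rank_leq_col.
have [c cM c0] : exists2 c : 'rV[R[i]]_N, c *m M = 0 & c != 0.
  have /rowV0Pn[c /sub_kermxP cM c0] := kM; by exists c.
have [l cl] : exists l, c ord0 l != 0.
  apply/existsP; move: c0; apply: contraNT; rewrite negb_exists => /forallP h.
  by apply/eqP/rowP => l; rewrite mxE; apply/eqP; have := h l; rewrite negbK.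
pose cn k := c ord0 (inord k).
have g2 k : L2 (g k) by exact: L2_cell.
have w2 := L2_comb cn N g2; exists (comb cn g N); split => //.
  apply/negP => /eqP w0; have := cauchy_schwarz w2 (g2 l).
  rewrite w0 mul0r inner_comb// (bigD1 l)//= inner_cell eqxx mulr1 big1 ?addr0.
    rewrite /cn inord_val => h.
    have := nc_eq0 (c ord0 l); rewrite (negbTE cl) => /negbT.
    by rewrite -sqrf_eq0 eq_le h sqr_ge0.
  by move=> i il; rewrite inner_cell val_eqE (negbTE il) mulr0.
move=> i si; rewrite (inner_comb _ _ g2 (s2 i si)).
transitivity ((c *m M) ord0 (Ordinal si)); last by rewrite cM mxE.
rewrite [RHS]mxE.
by apply: eq_bigr => k _; rewrite mxE /cn inord_val.
Qed.

End infinite_dimension.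

(** * The integral of the symbol *)

Lemma powR_decay_prod (R : realType) n (x : 'rV[R]_n) (p : R) : 0 <= p ->
  (1 + enorm x) `^ (- (p * n%:R)) <= \prod_(i < n) (1 + `|x ord0 i|) `^ (- p).
Proof.
move=> p0; rewrite -mulNr powRrM powR_mulrn ?powR_ge0//.
rewrite -[X in _ ^+ X](card_ord n) -prodr_const; apply: ler_prod => i _.
have x0 : 0 < 1 + `|x ord0 i| by rewrite ltr_pwDl.
have e0 : 0 < 1 + enorm x by rewrite ltr_pwDl// sqrtr_ge0.
rewrite powR_ge0/= !powRN lef_pV2 ?posrE ?powR_gt0//.
by apply: ge0_ler_powR; rewrite ?nnegrE ?(ltW x0) ?(ltW e0)// lerD2l coord_le_enorm.
Qed.

(** For t >= C2 one has 1 + t <= (1 + 1 / C2) t; for smaller t, W >= 1 is enough. The slack 1 + a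
    allows for V <= (1 + |V(0)|) W, which follows from q + A + V(0) >= 1, and likewise for A. *)
Lemma growth_lower (R : realType) (s C1 C2 a : R) :
  0 < s -> 0 < C1 -> 0 < C2 -> 0 <= a ->
  exists2 c : R, 0 < c & forall t W : R, 0 <= t -> 1 <= W ->
    (C2 <= t -> C1 * t `^ s <= (1 + a) * W) -> c * (1 + t) `^ s <= W.
Proof.
move=> s0 C10 C20 a0; have a1 : 0 < 1 + a by rewrite ltr_pwDl.
pose K := 1 + C2^-1.
have K0 : 0 < K by rewrite ltr_pwDl// invr_ge0 ltW.
have D0 : 0 < 1 + C2 by rewrite ltr_pwDl// ltW.
pose c1 := C1 / ((1 + a) * K `^ s); pose c2 := ((1 + C2) `^ s)^-1.
have c10 : 0 < c1 by rewrite divr_gt0// mulr_gt0// powR_gt0.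
have c20 : 0 < c2 by rewrite invr_gt0 powR_gt0.
exists (Num.min c1 c2); first by rewrite lt_min c10 c20.
move=> t W t0 W1 H; have t1 : 0 <= 1 + t by rewrite addr_ge0.
have [Ct|tC] := leP C2 t.
  apply: (@le_trans _ _ (c1 * (1 + t) `^ s)).
    by rewrite ler_wpM2r ?powR_ge0// ge_min lexx.
  apply: (@le_trans _ _ (c1 * (K * t) `^ s)).
    rewrite ler_wpM2l ?(ltW c10)//; apply: ge0_ler_powR;
      rewrite ?nnegrE ?(ltW s0) ?mulr_ge0 ?(ltW K0)//.
    by rewrite mulrDl mul1r addrC lerD2l mulrC ler_pdivlMr// mul1r.
  rewrite powRM ?(ltW K0)// (_ : _ * _ = C1 * t `^ s / (1 + a)).
    by rewrite ler_pdivrMr// [leRHS]mulrC H.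
  by rewrite /c1; field; rewrite !gt_eqF ?powR_gt0.
apply: (@le_trans _ _ 1) => //.
apply: (@le_trans _ _ (c2 * (1 + t) `^ s)).
  by rewrite ler_wpM2r ?powR_ge0// ge_min lexx orbT.
rewrite /c2 mulrC ler_pdivrMr ?powR_gt0// mul1r.
by apply: ge0_ler_powR; rewrite ?nnegrE ?(ltW s0) ?(ltW D0)// lerD2l ltW.
Qed.

Lemma symbol_decay (R : realType) (a b c1 c2 mu th x y W : R) :
  0 < c1 -> 0 < c2 -> 0 < x -> 0 < y -> 0 <= mu -> 0 <= th <= 1 ->
  c1 * x `^ a <= W -> c2 * y `^ b <= W ->
  W `^ (- mu) <= c1 `^ (- (mu * th)) * c2 `^ (- (mu * (1 - th)))
    * (x `^ (- (a * (mu * th))) * y `^ (- (b * (mu * (1 - th))))).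
Proof.
move=> c10 c20 x0 y0 mu0 /andP[th0 th1] hx hy.
have W0 : 0 < W by apply: lt_le_trans hx; rewrite mulr_gt0// powR_gt0.
have aux (c z e r : R) : 0 < c -> 0 < z -> 0 <= r -> c * z `^ e <= W ->
    W `^ (- r) <= c `^ (- r) * z `^ (- (e * r)).
  move=> c0 z0 r0 h; rewrite -mulrN powRrM -powRM ?powR_ge0 ?(ltW c0)//.
  rewrite !powRN lef_pV2 ?posrE ?powR_gt0 ?mulr_gt0 ?powR_gt0//.
  by apply: ge0_ler_powR => //; rewrite nnegrE ltW// mulr_gt0 ?powR_gt0.
rewrite {1}(_ : - mu = - (mu * th) + - (mu * (1 - th))); last by ring.
rewrite powRD; last by rewrite (gt_eqF W0) implybT.
rewrite mulrACA ler_pM ?powR_ge0//; apply: aux => //; rewrite mulr_ge0//.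
by rewrite subr_ge0.
Qed.

Lemma integral_symbol_power (R : realType) (n : nat) (gamma kappa : R)
    (A V : 'rV[R]_n -> R) (q C1 C2 mu : R) :
  (0 < n)%N -> 0 < gamma -> 0 < kappa -> 0 < C1 -> 0 < C2 ->
  (forall x xi, 1 <= q + V x + A xi) ->
  (forall xi, C2 <= enorm xi -> C1 * enorm xi `^ (2 * gamma) <= A xi) ->
  (forall x, C2 <= enorm x -> C1 * enorm x `^ (2 * kappa) <= V x) ->
  n%:R * (kappa + gamma) / (2 * kappa * gamma) < mu ->
  (\int[lebesgue_rV n]_xi \int[lebesgue_rV n]_x
     ((q + A xi + V x) `^ (- mu))%:E < +oo)%E.
Proof.
move=> n0 g0 k0 C10 C20 W1 gA gV hmu.
have kg : 0 < kappa + gamma by rewrite addr_gt0.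
have nR : 0 < n%:R :> R by rewrite ltr0n.
have mu0 : 0 <= mu.
  by apply: le_trans (ltW hmu); rewrite divr_ge0// ?mulr_ge0// ltW.
have k2 : 0 < 2 * kappa by rewrite mulr_gt0.
have g2 : 0 < 2 * gamma by rewrite mulr_gt0.
have [c1 c10 H1] := growth_lower k2 C10 C20 (normr_ge0 (V 0)).
have [c2 c20 H2] := growth_lower g2 C10 C20 (normr_ge0 (A 0)).
(* This weight equalises the two exponents: 2 kappa mu th = 2 gamma mu (1 - th) = p n. The
   assumption on [mu] is exactly p > 1. *)
pose th := gamma / (kappa + gamma).
pose p := 2 * kappa * gamma * mu / (n%:R * (kappa + gamma)).
have p1 : 1 < p.
  move: hmu; rewrite ltr_pdivrMr ?mulr_gt0// /p ltr_pdivlMr ?mulr_gt0// mul1r => h.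
  by rewrite [ltRHS]mulrC.
have p0 : 0 <= p by rewrite ltW// (lt_trans _ p1).
have th01 : 0 <= th <= 1.
  by rewrite /th divr_ge0 ?(ltW g0) ?(ltW kg)//= ler_pdivrMr// mul1r lerDr ltW.
pose c := c1 `^ (- (mu * th)) * c2 `^ (- (mu * (1 - th))).
pose Phi (x : 'rV[R]_n) := \prod_(i < n) (1 + `|x ord0 i|) `^ (- p).
have Phi0 x : 0 <= Phi x by apply: prodr_ge0 => i _; exact: powR_ge0.
have iPhi : rint (lebesgue_rV n) Phi.
  apply: (rint_rV_prod (f := fun _ t => (1 + `|t|) `^ (- p))) => [i t|i].
    exact: powR_ge0.
  apply/rint_lty; last exact: integral_powR_decay.
    exact: continuous_measurable_fun (@powR_decay_continuous R p).
  by move=> t; exact: powR_ge0.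
have mPhi := rint_meas iPhi.
have c0 : 0 <= c by rewrite mulr_ge0 ?powR_ge0.
have bound xi x : (q + A xi + V x) `^ (- mu) <= c * (Phi x * Phi xi).
  have W1' : 1 <= q + A xi + V x by have := W1 x xi; lra.
  have b1 : c1 * (1 + enorm x) `^ (2 * kappa) <= q + A xi + V x.
    apply: H1 => //; first exact: sqrtr_ge0.
    move=> /gV h; apply: le_trans h _.
    have := W1 0 xi; have := ler_norm (V 0) => h1 h2.
    have : `|V 0| <= `|V 0| * (q + A xi + V x) by rewrite ler_peMr.
    lra.
  have b2 : c2 * (1 + enorm xi) `^ (2 * gamma) <= q + A xi + V x.
    apply: H2 => //; first exact: sqrtr_ge0.
    move=> /gA h; apply: le_trans h _.
    have := W1 x 0; have := ler_norm (A 0) => h1 h2.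
    have : `|A 0| <= `|A 0| * (q + A xi + V x) by rewrite ler_peMr.
    lra.
  have e0 (y : 'rV[R]_n) : 0 < 1 + enorm y by rewrite ltr_pwDl ?sqrtr_ge0.
  apply: le_trans (symbol_decay c10 c20 (e0 x) (e0 xi) mu0 th01 b1 b2) _.
  rewrite -/c ler_wpM2l//.
  have -> : 2 * kappa * (mu * th) = p * n%:R by rewrite /th /p; field; rewrite !gt_eqF.
  have -> : 2 * gamma * (mu * (1 - th)) = p * n%:R by rewrite /th /p; field; rewrite !gt_eqF.
  by apply: ler_pM; rewrite ?powR_ge0//; exact: powR_decay_prod.
pose I := \int[lebesgue_rV n]_x Phi x.
have EI : (\int[lebesgue_rV n]_x (Phi x)%:E = I%:E)%E.
  by rewrite /I /Rintegral fineK//; exact: integrable_fin_num iPhi.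
have I0 : 0 <= I by apply: Rintegral_ge0 => x _.
apply: (@le_lt_trans _ _ (\int[lebesgue_rV n]_xi ((c * I) * Phi xi)%:E)%E).
  apply: le_integral_ge0 => xi.
    by apply: integral_ge0 => x _; rewrite lee_fin powR_ge0.
  apply: (@le_trans _ _ (\int[lebesgue_rV n]_x ((c * Phi xi) * Phi x)%:E)%E).
    apply: le_integral_ge0 => x; rewrite lee_fin ?powR_ge0//.
    by rewrite -mulrA [Phi xi * _]mulrC.
  under eq_integral do rewrite EFinM.
  rewrite ge0_integralZl//; last 3 first.
  - exact/measurable_EFinP.
  - by move=> x _; rewrite lee_fin.
  - by rewrite lee_fin mulr_ge0.
  by rewrite EI -EFinM lee_fin mulrAC.
under eq_integral do rewrite EFinM.
rewrite ge0_integralZl//.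
- by rewrite EI -EFinM ltry.
- exact/measurable_EFinP.
- by move=> x _; rewrite lee_fin.
- by rewrite lee_fin mulr_ge0.
Qed.

Theorem theorem5p9 (R : realType) (n : nat) (hn : (0 < n)%N)
    (gamma kappa : R) (hgamma : 0 < gamma) (hkappa : 0 < kappa)
    (A V : 'rV[R]_n -> R)
    (hA : tau_function gamma A) (hV : tau_function kappa V)
    (q : R) (hq : 0 < q) (hqVA : forall x xi : 'rV[R]_n, 1 <= q + V x + A xi)
    (hgrowth : exists C1 C2 : R, [/\ 0 < C1, 0 < C2,
       (forall xi : 'rV[R]_n, C2 <= enorm xi ->
          C1 * enorm xi `^ (2 * gamma) <= A xi) &
       (forall x : 'rV[R]_n, C2 <= enorm x ->
          C1 * enorm x `^ (2 * kappa) <= V x)]) :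
  (forall mu : R, n%:R * (kappa + gamma) / (2 * kappa * gamma) < mu ->
     (\int[lebesgue_rV n]_xi \int[lebesgue_rV n]_x
        ((q + A xi + V x) `^ (- mu))%:E < +oo)%E)
  /\
  (smooth A -> smooth V ->
   Sigma_class gamma kappa q A V 1
     (fun p : 'rV[R]_n * 'rV[R]_n => (A p.2 + V p.1)%:C%C) ->
   forall r nu : R, 1 <= r ->
     n%:R * (kappa + gamma) / (2 * r * kappa * gamma) < nu ->
   forall T : op, is_T q A V T ->
   forall P : op, is_power T (- nu) P ->
     schatten r P).
Proof.
have [C1 [C2 [C10 C20 gA gV]]] := hgrowth.
split=> [mu hmu|_ _ _ r nu r1 hnu T [_ _ hT] P [E [hE hTE hP]]].
  exact: (integral_symbol_power hn hgamma hkappa C10 C20 hqVA gA gV hmu).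
have [CA [mA [CA0 bA]]] := tau_function_growth hn hgamma hA.
have [CV [mV [CV0 bV]]] := tau_function_growth hn hkappa hV.
have [cA _] := hA; have [cV _] := hV.
(* Taking the infimum over [x] in [hqVA] splits the joint lower bound into separate ones for [V] and
   [A] that sum to 1 - q. *)
pose b0 := inf (range V); pose a0 := 1 - q - b0.
have Vb0 x : b0 <= V x.
  apply: ge_inf; last by exists x.
  by exists (1 - q - A 0) => _ [y _ <-]; have := hqVA y 0; lra.
have Aa0 xi : a0 <= A xi.
  have : 1 - q - A xi <= b0; last by rewrite /a0; lra.
  apply: lb_le_inf; first by exists (V 0), 0.
  by move=> _ [y _ <-]; have := hqVA y xi; lra.
have qab : q + a0 + b0 = 1 by rewrite /a0; ring.
have hT' u v : T u v -> _ := fun h => (hT u v).1 h.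
have [K HK] := spectral_counting cA cV CA0 CV0 bA bV Aa0 Vb0 qab hT' hgamma hkappa C10 C20 gA gV.
have nR : 0 < n%:R :> R by rewrite ltr0n.
have r0 : 0 < r by exact: lt_le_trans r1.
have p0 : 0 < n%:R * (kappa + gamma) / (2 * kappa * gamma).
  by rewrite divr_gt0 ?mulr_gt0 ?addr_gt0.
have nur : n%:R * (kappa + gamma) / (2 * kappa * gamma) < nu * r.
  rewrite -ltr_pdivrMr//; apply: le_lt_trans hnu; rewrite le_eqVlt; apply/orP; left; apply/eqP.
  by field; rewrite !gt_eqF.
have nu0 : 0 < nu by rewrite -(pmulr_lgt0 _ r0); exact: lt_trans nur.
exact: (schatten_pow hE hTE (energy_ge_nsq cA cV CA0 CV0 bA bV Aa0 Vb0 qab hT') HK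
  (exists_orthogonal (Ordinal hn)) p0 nu0 r0 nur hP).
Qed.
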